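(* For every nonzero $g\in L^2(\mathbb{R})$ (complex-valued), each of the following two families of four functions of $t\in\mathbb{R}$ is linearly independent over $\mathbb{C}$ in $L^2(\mathbb{R})$: $$g(t),\quad g(t-1),\quad e^{2\pi i t}g(t),\quad e^{2\pi i\sqrt2\,t}g(t-\sqrt2);$$ $$g(t),\quad g(t-1),\quad e^{2\pi i t}g(t),\quad g(t-\pi).$$
   Context: Here $\pi=3.14159\ldots$ is the usual real number (also in the last function $g(t-\pi)$). *)

(* Defs.v *)
From mathcomp Require Import all_boot all_order all_algebra.
From mathcomp Require Import complex.
From mathcomp Require Import all_classical all_reals all_analysis.

Set Implicit Arguments.
Unset Strict Implicit.
Unset Printing Implicit Defensive.

Import Order.TTheory GRing.Theory Num.Theory.

Local Open Scope classical_set_scope.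
Local Open Scope ring_scope.
Local Open Scope complex_scope.

(* exp(i x) for real x; the libraries have no complex exponential. *)
Definition expi (R : realType) (x : R) : R[i] := cos x +i* sin x.

(* Complex-valued representatives of classes in L^2(R). [complex] carries no
   sigma-algebra here, so measurability is that of the two real coordinates,
   i.e. Borel measurability into C = R^2. Every class of L^2(R) has a Borel
   representative, so nothing is lost by the fact that [lebesgue_measure] lives
   on the Borel sigma-algebra. *)
Definition L2C (R : realType) (f : R -> R[i]) : Prop :=
  [/\ measurable_fun [set: R] (fun t => complex.Re (f t)),
      measurable_fun [set: R] (fun t => complex.Im (f t)) &
      finite_norm (@lebesgue_measure R) 2%:E
        (fun t => ComplexField.Normc.normc (f t))].

(* Vanishing in L^2(R): equality with 0 almost everywhere. *)
Definition ae_zero (R : realType) (f : R -> R[i]) : Prop :=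
  {ae (@lebesgue_measure R), forall t : R, f t = 0}.

(* Linear independence over C, in L^2(R), of the classes of the members of s,
   as a family: two a.e. equal members make it dependent. *)
Definition L2C_lin_indep (R : realType) (s : seq (R -> R[i])) : Prop :=
  (forall i : 'I_(size s), L2C (nth (fun=> 0) s i)) /\
  (forall c : 'I_(size s) -> R[i],
     ae_zero (fun t : R => \sum_(i < size s) c i * nth (fun=> 0) s i t) ->
     forall i : 'I_(size s), c i = 0).

(* Main.v *)
Require Import Defs.
From HB Require Import structures.
From mathcomp Require Import all_boot all_order all_algebra.
From mathcomp Require Import complex.
From mathcomp Require Import all_classical all_reals all_analysis.
From mathcomp Require Import measurable_realfun.
From mathcomp Require Import ring lra zify.

Set Implicit Arguments.
Unset Strict Implicit.
Unset Printing Implicit Defensive.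

Import Order.TTheory GRing.Theory Num.Theory.
Import ComplexField.Normc.
Import numFieldNormedType.Exports.

Local Open Scope classical_set_scope.
Local Open Scope ring_scope.
Local Open Scope complex_scope.

(** Write e(x) for exp(2 pi i x). A dependence relation has the form
      c0 g(t) + c1 g(t-1) + c2 e(t) g(t) + c3 e(y t) g(t-a) = 0,
    with (a, y) equal to (sqrt 2, sqrt 2) or to (pi, 0), and a is irrational in
    both cases. There are two regimes.

    If some coefficient vanishes ([degenerate_relation]), at most three terms
    are left. A translation and a multiplication by a chirp e(s t^2) bring
    them to the form a1 h(t) + a3 h(t-b) = a2 e(d t) h(t-x0). Correlating each
    side with its own translates removes x0, and leaves for the
    autocorrelation rho of h a second-order recurrence along progressions of
    step b whose coefficient sees the point only through e(d .). So rho(n b)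
    and rho(n b + z), where e(d z) = 1, obey the same recurrence. Their
    Wronskian has constant modulus and tends to 0, because rho decays; hence
    the two sequences are proportional. By Dirichlet's theorem n b + z can be
    brought close to 0 for some large n, so that rho(0), the squared norm of
    h, is controlled by a small multiple of itself: h = 0 ([three_points]).

    If all coefficients are nonzero ([four_points]), a chirp in the first
    family turns both relations into c3 h(t-a) = A(t) h(t) + B(t) h(t-1) with
    1-periodic A and B. The Zak transform, the sum over n of h(x+n) e(-n xi),
    turns the unit shift into the multiplication by e(-xi). For almost every
    xi there remains a first-order relation c3 H(x-a) = P(x) H(x) for a
    function H which is square integrable on [0, 1[ and has 1-periodic modulus;
    P is a Laurent polynomial in e(x). Such a relation is iterated q times,
    where q is a time of closest return of the rotation by a. If P has no
    root on the unit circle, the product of P along q steps of the orbit is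
    K e(m q x) (1 + small), where m is the winding number of P and |K| is the
    q-th power of its Mahler measure ([prod_cocycle]). Comparing norms, H = 0
    unless the Mahler measure equals |c3|. If m = 1 or m = -1, the factor
    e(m q x) changes sign when x moves by 1/(2q), a displacement too small to
    change a square integrable function noticeably: again H = 0
    ([fiber_vanishing]). Here P has degree at most 2, and apart from
    countably many xi at least one of the two mechanisms applies
    ([ae_fiber_cocycle]). All fibers vanish, hence so does h
    ([zak_vanishing]). *)

(** * Complex numbers and phases *)

Definition nsq (R : realType) (z : R[i]) : R :=
  complex.Re z ^+ 2 + complex.Im z ^+ 2.

Definition e1 (R : realType) (x : R) : R[i] := expi (2 * pi * x).

Section complex_basics.
Context (R : realType).
Implicit Types (z w : R[i]) (x y : R).

Lemma nsqE z : nsq z = normc z ^+ 2.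
Proof. by case: z => a b; rewrite /normc /nsq /= sqr_sqrtr // addr_ge0 ?sqr_ge0. Qed.

Lemma normc_ge0 z : 0 <= normc z.
Proof. by case: z => a b; rewrite /normc sqrtr_ge0. Qed.

Lemma nsq_ge0 z : 0 <= nsq z.
Proof. by rewrite addr_ge0 ?sqr_ge0. Qed.

Lemma nsqM z w : nsq (z * w) = nsq z * nsq w.
Proof. by rewrite !nsqE normcM exprMn. Qed.

Lemma nsqN z : nsq (- z) = nsq z.
Proof. by case: z => a b; rewrite /nsq /= !sqrrN. Qed.

Lemma nsq0 : nsq (0 : R[i]) = 0.
Proof. by rewrite /nsq /= expr0n /= addr0. Qed.

Lemma nsq_eq0 z : (nsq z == 0) = (z == 0).
Proof.
case: z => a b; rewrite /nsq /= paddr_eq0 ?sqr_ge0 // !sqrf_eq0.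
by rewrite eq_complex.
Qed.

Lemma normc_eq0 z : (normc z == 0) = (z == 0).
Proof. by rewrite -nsq_eq0 nsqE sqrf_eq0. Qed.

Lemma normc_gt0 z : (0 < normc z) = (z != 0).
Proof. by rewrite lt_neqAle normc_ge0 andbT eq_sym normc_eq0. Qed.

Lemma nsq_gt0 z : (0 < nsq z) = (z != 0).
Proof. by rewrite lt_neqAle nsq_ge0 andbT eq_sym nsq_eq0. Qed.

Lemma Re2_le (w : R[i]) : complex.Re w ^+ 2 <= nsq w.
Proof. by rewrite lerDl sqr_ge0. Qed.

Lemma Im2_le (w : R[i]) : complex.Im w ^+ 2 <= nsq w.
Proof. by rewrite lerDr sqr_ge0. Qed.

(** The crude constant 2 replaces the triangle inequality: all estimates
    are done on squared moduli, which integrate well. *)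
Lemma nsqD_le z w : nsq (z + w) <= 2 * nsq z + 2 * nsq w.
Proof.
case: z w => a b [c d]; rewrite /nsq /= -subr_ge0.
rewrite (_ : _ - _ = (a - c) ^+ 2 + (b - d) ^+ 2); last by ring.
by rewrite addr_ge0 ?sqr_ge0.
Qed.

Lemma nsqB_le z w : nsq (z - w) <= 2 * nsq z + 2 * nsq w.
Proof. by rewrite (le_trans (nsqD_le _ _)) // nsqN. Qed.

Lemma normcX z n : normc (z ^+ n) = normc z ^+ n.
Proof. by elim: n => [|n IH]; rewrite ?expr0 ?normc1 // !exprS normcM IH. Qed.

Lemma normc_sum (I : Type) (s : seq I) (P : pred I) (F : I -> R[i]) :
  normc (\sum_(i <- s | P i) F i) <= \sum_(i <- s | P i) normc (F i).
Proof.
elim/big_ind2 : _ => [|x a y b xa yb|//]; first by rewrite normc0.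
by rewrite (le_trans (le_normcD _ _)) // lerD.
Qed.

Lemma normc_prod (I : Type) (s : seq I) (P : pred I) (F : I -> R[i]) :
  normc (\prod_(i <- s | P i) F i) = \prod_(i <- s | P i) normc (F i).
Proof. by apply: (big_morph _ (@normcM R)); rewrite normc1. Qed.

Lemma le_normcB z w : normc (z - w) <= normc z + normc w.
Proof. by rewrite (le_trans (le_normcD _ _)) // normcN. Qed.

Lemma expiD x y : expi (x + y) = expi x * expi y.
Proof. by rewrite /expi cosD sinD; simpc; congr (_ +i* _); ring. Qed.

Lemma expi0 : expi (0 : R) = 1.
Proof. by rewrite /expi cos0 sin0. Qed.

Lemma nsq_expi x : nsq (expi x) = 1.
Proof. by rewrite /nsq /= cos2Dsin2. Qed.

Lemma e1D x y : e1 (x + y) = e1 x * e1 y.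
Proof. by rewrite /e1 mulrDr expiD. Qed.

Lemma e10 : e1 (0 : R) = 1.
Proof. by rewrite /e1 mulr0 expi0. Qed.

Lemma nsq_e1 x : nsq (e1 x) = 1. Proof. exact: nsq_expi. Qed.

Lemma normc_e1 x : normc (e1 x) = 1.
Proof. by rewrite /normc /e1 /expi cos2Dsin2 sqrtr1. Qed.

Lemma e1_neq0 x : e1 x != 0.
Proof. by rewrite -nsq_eq0 nsq_e1 oner_eq0. Qed.

Lemma e1N x : e1 (- x) = (e1 x)^-1.
Proof.
apply: (mulfI (e1_neq0 x)); rewrite -e1D subrr e10 mulfV //; exact: e1_neq0.
Qed.

Lemma e1B x y : e1 (x - y) = e1 x / e1 y.
Proof. by rewrite e1D e1N. Qed.

Lemma e11 : e1 (1 : R) = 1.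
Proof. by rewrite /e1 mulr1 mulrC mulr_natr /expi cos2pi sin2pi. Qed.

Lemma e1_half : e1 (2^-1 : R) = -1.
Proof.
rewrite /e1 mulrAC mulfV ?mul1r ?pnatr_eq0// /expi cospi sinpi.
by apply/eqP; rewrite eq_complex /= oppr0 !eqxx.
Qed.

Lemma e1MnE x n : e1 (x *+ n) = e1 x ^+ n.
Proof. by elim: n => [|n IH]; rewrite ?mulr0n ?e10 // mulrS e1D IH exprS. Qed.

Lemma e1_nat n : e1 (n%:R : R) = 1.
Proof. by rewrite e1MnE e11 expr1n. Qed.

Lemma e1_int (k : int) : e1 (k%:~R : R) = 1.
Proof.
case: k => n; first exact: e1_nat.
by rewrite NegzE mulrNz e1N -[X in e1 X]/(n.+1%:R) e1_nat invr1.
Qed.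

Lemma e1_conj x : (e1 x)^*%C = e1 (- x).
Proof. by rewrite /e1 mulrN /expi cosN sinN. Qed.

(** If y is the fractional part of x, cos (2 pi y) = 1 forces sin (pi y) = 0,
    while pi y lies in [0, pi[. *)
Lemma e1_eq1 x : e1 x = 1 -> exists k : int, x = k%:~R.
Proof.
move=> ex; exists (Num.floor x).
set y := x - (Num.floor x)%:~R.
suff: y = 0 by move/subr0_eq.
have ey : e1 y = 1 by rewrite /y e1B ex e1_int divr1.
have y0 : 0 <= y by rewrite subr_ge0 floor_le.
have y1 : y < 1 by rewrite ltrBlDl; have := floorD1_gt x; rewrite intrD.
apply/eqP; rewrite eq_le y0 andbT leNgt; apply/negP => y0'.
have : sin (pi * y) > 0.
  rewrite sin_gt0_pi // mulr_gt0 ?pi_gt0 //=.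
  by rewrite -[ltRHS]mulr1 ltr_pM2l // pi_gt0.
have [] : cos (2 * pi * y) = 1 by case: ey.
rewrite (_ : 2 * pi * y = (pi * y) *+ 2); last by rewrite -mulr_natr; ring.
rewrite cos_mulr2n cos2sin2 => /eqP.
rewrite -subr_eq0 (_ : _ - 1 = - (2 * sin (pi * y) ^+ 2)); last first.
  by rewrite -mulr_natr; ring.
by rewrite oppr_eq0 mulf_eq0 pnatr_eq0 /= sqrf_eq0 => /eqP ->; rewrite ltxx.
Qed.

Lemma e1_near1 (eps : R) : 0 < eps ->
  exists2 d : R, 0 < d & forall y, `|y| < d -> normc (1 - e1 y) < eps.
Proof.
move=> eps0.
have := @continuous_cos R 0.
rewrite /continuous_at cos0 => /cvgrPdist_lt /(_ (eps ^+ 2 / 2)).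
rewrite divr_gt0 ?exprn_gt0// => /(_ isT) [d /= d0 dP].
exists (d / (2 * pi)); first by rewrite divr_gt0 // mulr_gt0 // pi_gt0.
move=> y yd.
suff: nsq (1 - e1 y) < eps ^+ 2.
  by rewrite nsqE ltr_pXn2r ?nnegrE ?normc_ge0 // ltW.
rewrite /e1 /expi /nsq /=.
have := dP (2 * pi * y); rewrite /ball_ /= sub0r normrN.
have p0 : 0 < 2 * pi :> R by rewrite mulr_gt0 ?pi_gt0.
rewrite normrM (gtr0_norm p0) mulrC -ltr_pdivlMr // yd.
move=> /(_ isT); have := cos2Dsin2 (2 * pi * y).
rewrite ltr_norml => + /andP[_].
by rewrite sub0r sqrrN; nra.
Qed.

(** Pigeonhole on the fractional parts of the multiples of (N+1) x; using
    multiples of N+1 makes the approximation time n at least N. *)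
Lemma dirichlet x (N : nat) (eps : R) : 0 < eps ->
  exists n : nat, exists k : int, [/\ (N <= n)%N, (0 < n)%N & `|n%:R * x - k%:~R| < eps].
Proof.
move=> eps0.
pose fr (y : R) := y - (Num.floor y)%:~R.
have fr0 y : 0 <= fr y by rewrite subr_ge0 floor_le.
have fr1 y : fr y < 1 by rewrite ltrBlDl; have := floorD1_gt y; rewrite intrD.
have [M M1] : exists M : nat, eps^-1 < M.+1%:R.
  exists (Num.truncn eps^-1); exact: truncnS_gt.
pose g (i : 'I_M.+2) := fr (N.+1%:R * i%:R * x).
have bl (i : 'I_M.+2) : (Num.truncn (M.+1%:R * g i) < M.+1)%N.
  rewrite truncn_lt_nat ?mulr_ge0 ?fr0 //.
  by rewrite -[ltRHS]mulr1 ltr_pM2l ?ltr0n // fr1.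
have [inj|/injectivePn [i [j ij bij]]] :=
    boolP (injectiveb (fun i : 'I_M.+2 => Ordinal (bl i))).
  have := leq_card _ (injectiveP _ inj).
  by rewrite !card_ord ltnn.
wlog ltij : i j ij bij / (i < j)%N.
  move=> H; have /orP[?|?] : (i < j)%N || (j < i)%N by rewrite -neq_ltn.
    exact: (H i j).
  by apply: (H j i) => //; rewrite eq_sym.
have close : `|g j - g i| < eps.
  have eT : Num.truncn (M.+1%:R * g i) = Num.truncn (M.+1%:R * g j).
    by move: bij => /(congr1 val).
  have h1 := truncn_itv (mulr_ge0 (ler0n R M.+1) (fr0 (N.+1%:R * i%:R * x))).
  have h2 := truncn_itv (mulr_ge0 (ler0n R M.+1) (fr0 (N.+1%:R * j%:R * x))).
  move: h1 h2; rewrite -/(g i) -/(g j) eT -natr1 => /andP[a1 a2] /andP[b1 b2].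
  have : M.+1%:R * `|g j - g i| < 1.
    rewrite -[X in X * _]ger0_norm // -normrM ltr_norml mulrBr.
    by apply/andP; split; lra.
  rewrite mulrC -ltr_pdivlMr ?ltr0n // div1r => /lt_trans; apply.
  by rewrite invf_plt ?posrE // ?ltr0n.
exists (N.+1 * (j - i))%N.
exists (Num.floor (N.+1%:R * j%:R * x) - Num.floor (N.+1%:R * i%:R * x)).
have ji : (0 < j - i)%N by rewrite subn_gt0.
split; first by rewrite (leq_trans (leqnSn N)) // leq_pmulr.
  by rewrite muln_gt0.
rewrite (_ : _ - _ = g j - g i) //.
by rewrite /g /fr natrM natrB ?(ltnW ltij) // intrD mulrNz; ring.
Qed.

End complex_basics.

(** * Close returns and products along a rotation *)

Section products.
Context (R : realType).
Implicit Types (z w om : R[i]) (a : nat -> R[i]).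

Definition ppoly a q : {poly R[i]} := \prod_(j < q) (1 - (a j)%:P * 'X).

(** Newton's identities, in the form k e_k = - sum p_(i+1) e_(k-i-1) up to the
    signs absorbed in [ppoly], by induction on the number of factors. *)
Lemma newton a q k :
  k%:R * (ppoly a q)`_k =
  - \sum_(i < k) (\sum_(j < q) a j ^+ i.+1) * (ppoly a q)`_(k - i.+1).
Proof.
elim: q k => [|q IH] k.
  rewrite /ppoly big_ord0 coef1; case: k => [|k]; first by rewrite big_ord0 mul0r oppr0.
  rewrite mulr0 big1 ?oppr0 // => i _; by rewrite big_ord0 mul0r.
have coefS m : (ppoly a q.+1)`_m =
    (ppoly a q)`_m - a q * (if m is m'.+1 then (ppoly a q)`_m' else 0).
  rewrite /ppoly big_ord_recr /= mulrBr mulr1 coefB mulrCA coefCM coefMX.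
  by case: m.
case: k => [|k]; first by rewrite big_ord0 mul0r oppr0.
rewrite coefS mulrBr {1}IH.
under [in RHS]eq_bigr do rewrite big_ord_recr /= coefS mulrDl !mulrBr.
rewrite big_split /= !sumrB.
set A := (X in - X - _).
set B := \sum_(i < k.+1) a q ^+ i.+1 * (ppoly a q)`_(k.+1 - i.+1).
have -> : \sum_(i < k.+1) (\sum_(j < q) a j ^+ i.+1) *
   (a q * match (k.+1 - i.+1)%N with 0%N => 0 | m'.+1 => (ppoly a q)`_m' end)
   = - (a q * (k%:R * (ppoly a q)`_k)).
  rewrite big_ord_recr /= subnn !mulr0 addr0 IH mulrN opprK mulr_sumr.
  apply: eq_bigr => i _; rewrite mulrCA; congr (_ * (_ * _)).
  by rewrite subSS -(subnSK (ltn_ord i)).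
have -> : \sum_(i < k.+1) a q ^+ i.+1 *
   (a q * match (k.+1 - i.+1)%N with 0%N => 0 | m'.+1 => (ppoly a q)`_m' end)
   = B - a q * (ppoly a q)`_k.
  rewrite /B big_ord_recr /= subnn !mulr0 addr0 [in RHS]big_ord_recl /= expr1 subSS subn0.
  rewrite addrAC subrr add0r; apply: eq_bigr => i _.
  rewrite /bump /= add1n mulrA -exprSr; congr (_ * _).
  by rewrite !subSS -(subnSK (ltn_ord i)).
by rewrite -/A -[k.+1%:R]natr1; ring.
Qed.

Lemma ppoly0 a q : (ppoly a q)`_0 = 1.
Proof.
rewrite -horner_coef0 /ppoly horner_prod big1 // => i _.
rewrite !hornerE.
by rewrite subr0.
Qed.

Lemma ppoly_horner a q : (ppoly a q).[1] = \prod_(j < q) (1 - a j).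
Proof. by rewrite /ppoly horner_prod; apply: eq_bigr => i _; rewrite !hornerE. Qed.

Lemma geo_bound (x : R) n : 0 <= x -> x < 1 ->
  \sum_(i < n) x ^+ i <= (1 - x)^-1.
Proof.
move=> x0 x1; have x1' : 0 < 1 - x by rewrite subr_gt0.
rewrite -[leRHS]mul1r ler_pdivlMr //.
have := subrX1 x n; set S := \sum_(i < n) _ => h.
have := exprn_ge0 n x0; lra.
Qed.

(** By Newton's identities the coefficients c_k of prod (1 - a_j X) inherit the
    smallness of the power sums: |c_k| <= eta r2^k by induction on k, and the
    value at 1 is 1 plus the sum of these. The induction closes because of the
    room between r1 and r2, which is what the condition relating eta to
    r1 / r2 measures. *)
Lemma prod_near1 a q (eta r1 r2 : R) :
  0 <= eta -> 0 < r1 -> r1 < r2 -> r2 < 1 ->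
  eta * (r1 / r2) <= (1 - r1 / r2) ^+ 2 ->
  (forall k, normc (\sum_(j < q) a j ^+ k.+1) <= eta * k.+1%:R * r1 ^+ k.+1) ->
  normc (\prod_(j < q) (1 - a j) - 1) <= eta * (r2 / (1 - r2)).
Proof.
move=> eta0 r10 r12 r21 small sig.
have r20 : 0 < r2 by exact: lt_trans r12.
pose c k := normc (ppoly a q)`_k.
set x := r1 / r2 in small.
have x0 : 0 < x by rewrite divr_gt0.
have x1 : x < 1 by rewrite ltr_pdivrMr // mul1r.
have r1E : r1 = x * r2 by rewrite /x divfK // gt_eqF.
clearbody x.
have cB k : c k.+1 <= eta * r2 ^+ k.+1.
  elim/ltn_ind: k => k IH.
  have k0 : 0 < k.+1%:R :> R by rewrite ltr0n.
  rewrite -(ler_pM2l k0).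
  have -> : k.+1%:R * c k.+1 = normc (k.+1%:R * (ppoly a q)`_k.+1).
    rewrite normcM; congr (_ * _).
    by rewrite normcMn normc1.
  rewrite newton normcN (le_trans (normc_sum _ _ _)) //.
  rewrite big_ord_recr /= subnn ppoly0 mulr1.
  have hlast := sig k.
  have hsum : \sum_(i < k) normc ((\sum_(j < q) a j ^+ i.+1) * (ppoly a q)`_(k.+1 - i.+1))
     <= eta ^+ 2 * k.+1%:R * r2 ^+ k.+1 * (x * (1 - x)^-1).
    have -> : eta ^+ 2 * k.+1%:R * r2 ^+ k.+1 * (x * (1 - x)^-1) =
              (eta ^+ 2 * k.+1%:R * r2 ^+ k.+1 * x) * (1 - x)^-1 by ring.
    have h0 : 0 <= eta ^+ 2 * k.+1%:R * r2 ^+ k.+1 * x.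
      by rewrite !mulr_ge0 ?exprn_ge0 // ltW.
    apply: le_trans (ler_wpM2l h0 (geo_bound k (ltW x0) x1)).
    rewrite mulr_sumr ler_sum // => i _.
    rewrite normcM subSS -(subnSK (ltn_ord i)).
    have hi := IH (k - i.+1)%N.
    have ik : (k - i.+1 < k)%N by rewrite ltn_subrL /= (leq_ltn_trans _ (ltn_ord i)).
    have {hi} := hi ik => hi.
    have hs := sig i.
    apply: (le_trans (ler_pM (normc_ge0 _) (normc_ge0 _) hs hi)).
    rewrite r1E exprMn.
    have -> : eta ^+ 2 * k.+1%:R * r2 ^+ k.+1 * x * x ^+ i =
       k.+1%:R * (eta ^+ 2 * x ^+ i.+1 * (r2 ^+ i.+1 * r2 ^+ (k - i.+1).+1)).
      have -> : r2 ^+ k.+1 = r2 ^+ i.+1 * r2 ^+ (k - i.+1).+1.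
        by rewrite (subnSK (ltn_ord i)) -exprD addSn subnKC // ltnW.
      by rewrite [x ^+ i.+1]exprS; ring.
    rewrite [leLHS](_ : _ = i.+1%:R * (eta ^+ 2 * x ^+ i.+1 * (r2 ^+ i.+1 * r2 ^+ (k - i.+1).+1))); last by ring.
    apply: ler_wpM2r; last by rewrite ler_nat ltnS ltnW.
    by rewrite !mulr_ge0 ?exprn_ge0 // ltW.
  apply: (le_trans (lerD hsum hlast)).
  rewrite r1E exprMn.
  have xk : x ^+ k.+1 <= x by rewrite exprS ger_pMr // exprn_ile1 // ltW.
  have hx : eta * (x * (1 - x)^-1) + x ^+ k.+1 <= 1.
    have x1' : 0 < 1 - x by rewrite subr_gt0.
    have : eta * (x * (1 - x)^-1) <= 1 - x.
      by rewrite mulrA ler_pdivrMr // -expr2.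
    lra.
  rewrite (_ : _ + _ = k.+1%:R * (eta * r2 ^+ k.+1) * (eta * (x * (1 - x)^-1) + x ^+ k.+1)); last by ring.
  by rewrite -[leRHS]mulr1 ler_wpM2l // !mulr_ge0 ?exprn_ge0 // ltW.
rewrite -ppoly_horner horner_coef.
under eq_bigr do rewrite expr1n mulr1.
case sz : (size (ppoly a q)) => [|m].
  have := ppoly0 a q; rewrite nth_default ?sz // => /eqP.
  by rewrite eq_sym oner_eq0.
rewrite big_ord_recl /= ppoly0 addrAC subrr add0r.
apply: (le_trans (normc_sum _ _ _)).
apply: (@le_trans _ _ (\sum_(i < m) (eta * r2) * r2 ^+ i)).
  by apply: ler_sum => i _; rewrite /bump /= add1n -mulrA -exprS; exact: cB.
rewrite -mulr_sumr mulrA ler_wpM2l ?geo_bound ?mulr_ge0 // ltW //.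
Qed.

(** The time of closest return: the minimality of q is what keeps the small
    divisors |1 - om^k|, k < q, above eps. *)
Definition first_return om (eps : R) (q : nat) : Prop :=
  [/\ (0 < q)%N, normc (1 - om ^+ q) < eps &
      forall k, (0 < k < q)%N -> eps <= normc (1 - om ^+ k)].

Lemma first_return_ex om eps : (exists2 q, (0 < q)%N & normc (1 - om ^+ q) < eps) ->
  exists q, first_return om eps q.
Proof.
move=> [q0 q00 h0].
have ex : exists q, (0 < q)%N && (normc (1 - om ^+ q) < eps).
  by exists q0; rewrite q00.
case: (ex_minnP ex) => q /andP[q1 hq] qmin.
exists q; split => // k /andP[k0 kq]; rewrite leNgt; apply/negP => hk.
by have := qmin k; rewrite k0 hk leqNgt kq => /(_ isT).
Qed.

Definition nonroot om := forall k, (0 < k)%N -> om ^+ k != 1.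

Lemma min_dist om (K : nat) : nonroot om ->
  exists2 d : R, 0 < d & forall k, (0 < k <= K)%N -> d <= normc (1 - om ^+ k).
Proof.
move=> nr; elim: K => [|K [d d0 dP]].
  by exists 1 => // k /andP[]; case: k.
exists (Num.min d (normc (1 - om ^+ K.+1))).
  by rewrite lt_min d0 normc_gt0 subr_eq0 eq_sym nr.
move=> k /andP[k0]; rewrite leq_eqVlt => /predU1P[->|]; first by rewrite ge_min lexx orbT.
by rewrite ltnS => kK; rewrite ge_min dP // k0.
Qed.

(** Close returns are late, since no earlier power of om is equal to 1. *)
Lemma first_return_large om (N : nat) : nonroot om ->
  exists2 e0 : R, 0 < e0 & forall eps q, eps <= e0 -> first_return om eps q -> (N < q)%N.
Proof.
move=> nr; have [d d0 dP] := min_dist N nr.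
exists d => // eps q ed [q0 hq _]; rewrite ltnNge; apply/negP => qN.
have := dP q; rewrite q0 qN => /(_ isT).
by rewrite leNgt (lt_le_trans hq ed).
Qed.

Lemma dist_mul om k m : normc om = 1 ->
  normc (1 - om ^+ (k * m)) <= m%:R * normc (1 - om ^+ k).
Proof.
move=> om1; elim: m => [|m IH]; first by rewrite muln0 expr0 subrr normc0 mul0r.
have -> : 1 - om ^+ (k * m.+1) = (1 - om ^+ (k * m)) + om ^+ (k * m) * (1 - om ^+ k).
  by rewrite mulnS exprD; ring.
rewrite (le_trans (le_normcD _ _)) // normcM normcX om1 expr1n mul1r.
by rewrite -natr1 mulrDl mul1r lerD.
Qed.

(** The power sum is (1 - om^(qk)) / (1 - om^k). Its numerator is at most k eps,
    which gives the second bound; the first one follows from |1 - om^k| >= eps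
    when k < q, and is trivial when k >= q. *)
Lemma power_sum om eps q k : normc om = 1 -> nonroot om -> first_return om eps q ->
  (0 < k)%N ->
  normc (\sum_(j < q) (om ^+ j) ^+ k) <= k%:R /\
  normc (\sum_(j < q) (om ^+ j) ^+ k) <= k%:R * (eps / normc (1 - om ^+ k)).
Proof.
move=> om1 nr [q0 hq hk] k0.
set S := \sum_(j < q) _.
have nk : 0 < normc (1 - om ^+ k) by rewrite normc_gt0 subr_eq0 eq_sym nr.
have SE : normc S * normc (1 - om ^+ k) <= k%:R * normc (1 - om ^+ q).
  rewrite -normcM mulrC.
  have -> : (1 - om ^+ k) * S = 1 - om ^+ (q * k).
    rewrite /S; under eq_bigr do rewrite -exprM mulnC exprM.
    have := subrX1 (om ^+ k) q; rewrite -exprM (mulnC k).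
    by move=> h; rewrite -[LHS]opprK -mulNr opprB -h opprB.
  exact: dist_mul.
split; last first.
  rewrite mulrA ler_pdivlMr // (le_trans SE) // ler_wpM2l //; exact: ltW.
have [kq|kq] := ltnP k q.
  rewrite -(ler_pM2r nk) (le_trans SE) // ler_wpM2l //.
  by rewrite ltW // (lt_le_trans hq) // hk // k0.
apply: (le_trans (normc_sum _ _ _)).
under eq_bigr do rewrite !normcX om1 !expr1n.
by rewrite sumr_const card_ord ler_nat.
Qed.

(** Were om a primitive q-th root of unity, the product would be 1 - w^q, which
    tends to 1. At a close return the power sums of the w om^j are almost those
    of the roots of unity: the finitely many indices k <= K are handled by the
    smallness of eps, the others by the geometric decay of w^k. *)
Lemma return_prod om (rho del : R) : normc om = 1 -> nonroot om ->
  0 < rho -> rho < 1 -> 0 < del ->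
  exists2 e0 : R, 0 < e0 & forall eps q w, eps <= e0 -> 
     first_return om eps q -> normc w <= rho ->
     normc (\prod_(j < q) (1 - w * om ^+ j) - 1) <= del.
Proof.
move=> om1 nr rho0 rho1 del0.
have [r1 [r2 [h1 h2 h3]]] : exists r1 r2 : R, [/\ rho < r1, r1 < r2 & r2 < 1].
  by exists (rho + (1 - rho) / 3), (rho + 2 * (1 - rho) / 3); split; lra.
have r10 : 0 < r1 by exact: lt_trans h1.
have r20 : 0 < r2 by exact: lt_trans h2.
set x := r1 / r2.
have x0 : 0 < x by rewrite divr_gt0.
have x1 : x < 1 by rewrite ltr_pdivrMr // mul1r.
have hr2 : 0 < r2 / (1 - r2) by rewrite divr_gt0 // subr_gt0.
(* [eta] is small enough for [prod_near1] and makes its bound at most [del]. *)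
pose eta := Num.min ((1 - x) ^+ 2 / x) (del / (r2 / (1 - r2))).
have eta0 : 0 < eta.
  rewrite lt_min; apply/andP; split; apply: divr_gt0 => //.
  by rewrite exprn_gt0 // subr_gt0.
have y1 : 1 < r1 / rho by rewrite ltr_pdivlMr // mul1r.
(* Beyond K the gain (r1 / rho)^k compensates for the missing factor eta. *)
have [K KP] : exists K : nat, 1 <= eta * (r1 / rho) ^+ K.
  have q1 : `|rho / r1| < 1.
    by rewrite ger0_norm ?divr_ge0 ?(ltW rho0) ?(ltW r10)// ltr_pdivrMr // mul1r.
  have /cvgrPdist_lt /(_ _ eta0) [K _ /(_ K (leqnn K))] := cvg_expr q1.
  rewrite sub0r normrN ger0_norm ?exprn_ge0 ?divr_ge0 ?(ltW rho0) ?(ltW r10)//.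
  move=> hK; exists K; rewrite -invf_div exprVn -[_ / _ ^+ K]/(eta / _).
  by rewrite ler_pdivlMr ?exprn_gt0 ?divr_gt0 // mul1r ltW.
have [d d0 dP] := min_dist K nr.
exists (d * eta); first by rewrite mulr_gt0.
move=> eps q w he fr hw.
apply: (@le_trans _ _ (eta * (r2 / (1 - r2)))); last first.
  by rewrite -ler_pdivlMr // ge_min lexx orbT.
apply: (@prod_near1 (fun j => w * om ^+ j) q eta r1 r2) => //; first exact: ltW.
  by rewrite -ler_pdivlMr // ge_min lexx.
move=> k.
have -> : \sum_(j < q) (w * om ^+ j) ^+ k.+1 = w ^+ k.+1 * \sum_(j < q) (om ^+ j) ^+ k.+1.
  by rewrite mulr_sumr; apply: eq_bigr => j _; rewrite exprMn.
rewrite normcM normcX.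
have [p1 p2] := power_sum om1 nr fr (ltn0Sn k).
have hwk : normc w ^+ k.+1 <= rho ^+ k.+1.
  by rewrite lerXn2r // nnegrE ?normc_ge0 // ltW.
apply: (le_trans (ler_wpM2r (normc_ge0 _) hwk)).
have rk : 0 < rho ^+ k.+1 by rewrite exprn_gt0.
have r1k : r1 ^+ k.+1 = rho ^+ k.+1 * (r1 / rho) ^+ k.+1.
  by rewrite -exprMn mulrCA divff ?mulr1 // gt_eqF.
have [kK|kK] := leqP k.+1 K.
  apply: (le_trans (ler_wpM2l (ltW rk) p2)).
  have hd : eps / normc (1 - om ^+ k.+1) <= eta.
    have dk : d <= normc (1 - om ^+ k.+1) by rewrite dP.
    rewrite ler_pdivrMr ?(lt_le_trans d0) // (le_trans he) // mulrC.
    by rewrite ler_pM2l.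
  have hy : rho ^+ k.+1 <= r1 ^+ k.+1.
    by rewrite lerXn2r ?nnegrE ?(ltW rho0) ?(ltW r10) ?(ltW h1).
  have hd0 : 0 <= k.+1%:R * (eps / normc (1 - om ^+ k.+1)).
    exact: le_trans (normc_ge0 _) p2.
  apply: (le_trans (ler_pM (ltW rk) hd0 hy (ler_wpM2l (ler0n _ _) hd))).
  by rewrite (_ : _ * _ = eta * k.+1%:R * r1 ^+ k.+1) //; ring.
apply: (le_trans (ler_wpM2l (ltW rk) p1)).
rewrite r1k.
have hy : 1 <= eta * (r1 / rho) ^+ k.+1.
  rewrite (le_trans KP) // ler_wpM2l ?(ltW eta0) // ler_eXn2l //; exact: ltnW.
rewrite (_ : eta * _ * _ = (rho ^+ k.+1 * k.+1%:R) * (eta * (r1 / rho) ^+ k.+1)); last by ring.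
by rewrite -[leLHS]mulr1 ler_wpM2l // mulr_ge0 // ltW.
Qed.

End products.

(** * Birkhoff products of a trigonometric polynomial *)

Section cocycle_products.
Context (R : realType) (alpha : R).
Implicit Types (r c : R[i]) (rs : seq R[i]).
Let om : R[i] := e1 alpha.

Lemma distV (z : R[i]) k : normc z = 1 -> normc (1 - z^-1 ^+ k) = normc (1 - z ^+ k).
Proof.
move=> z1; have z0 : z != 0 by rewrite -normc_gt0 z1.
have -> : 1 - z^-1 ^+ k = - (z^-1 ^+ k * (1 - z ^+ k)).
  by rewrite mulrBr mulr1 exprVn mulVf ?expf_neq0 // opprB.
by rewrite normcN normcM normcX normcV z1 invr1 expr1n mul1r.
Qed.

Lemma nonrootV (z : R[i]) : nonroot z -> nonroot z^-1.
Proof. by move=> nr k k0; rewrite exprVn invr_eq1 nr. Qed.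

Lemma first_returnV (z : R[i]) eps q : normc z = 1 -> first_return z eps q ->
  first_return z^-1 eps q.
Proof. by move=> z1 [q0 h1 h2]; split => //; rewrite ?distV // => k /h2; rewrite distV. Qed.

(** The Laurent polynomial c z^(-k) prod (z - r) at z = e(x), given by its roots. *)
Definition cocycle c (k : nat) rs (x : R) : R[i] :=
  c * e1 (- k%:R * x) * \prod_(r <- rs) (e1 x - r).

(** By Jensen's formula this is the Mahler measure of [cocycle c k rs]. *)
Definition mahler c rs : R := normc c * \prod_(r <- rs) Num.max 1 (normc r).

(** By the argument principle this is the winding number around 0 of the loop
    [cocycle c k rs], as long as no root lies on the unit circle. *)
Definition winding (k : nat) rs : R :=
  (\sum_(r <- rs) (normc r < 1)%R%:R) - k%:R.

Hypothesis nr : nonroot om.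

Lemma e1xj x j : e1 (x - j%:R * alpha) = e1 x * om^-1 ^+ j.
Proof. by rewrite e1B mulr_natl e1MnE exprVn. Qed.

(** A root inside the unit disc is divided out as z - r = z (1 - r/z), a root
    outside as z - r = - r (1 - z/r); in both cases [return_prod] applies, for
    om or for its inverse. *)
Lemma prod_linear r (del : R) : normc r != 1 -> 0 < del ->
  exists2 e0 : R, 0 < e0 & forall eps q, eps <= e0 -> first_return om eps q ->
    exists2 K : R[i], normc K = Num.max 1 (normc r) ^+ q & forall x, 
      exists2 err : R[i], normc err <= del &
      \prod_(j < q) (e1 (x - j%:R * alpha) - r) =
      K * e1 ((normc r < 1)%R%:R * q%:R * x) * (1 + err).
Proof.
move=> r1 del0; have om1 : normc om = 1 by exact: normc_e1.
have om0 : om != 0 by exact: e1_neq0.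
have omV1 : normc om^-1 = 1 by rewrite normcV om1 invr1.
have [rlt|rgt|/eqP] := ltgtP (normc r) 1; last by rewrite (negbTE r1).
- have h1 : 0 < (1 + normc r) / 2 by have := normc_ge0 r; lra.
  have h2 : (1 + normc r) / 2 < 1 by lra.
  have [e0 e00 H] := return_prod om1 nr h1 h2 del0.
  exists e0 => // eps q he fr.
  exists (\prod_(j < q) om^-1 ^+ j).
    rewrite normc_prod; under eq_bigr do rewrite normcX omV1 expr1n.
    by rewrite big1 // expr1n.
  move=> x; exists (\prod_(j < q) (1 - (r * e1 (- x)) * om ^+ j) - 1).
    apply: (H eps) => //; rewrite normcM normc_e1 mulr1; lra.
  rewrite addrC subrK mul1r mulr_natl e1MnE.
  rewrite [e1 x ^+ q](_ : _ = \prod_(j < q) e1 x); last by rewrite prodr_const card_ord.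
  rewrite -!big_split /=; apply: eq_bigr => j _.
  rewrite e1xj e1N mulrBr mulr1; congr (_ - _); first by rewrite mulrC.
  have x0 := e1_neq0 x.
  by rewrite exprVn; field; rewrite x0 expf_neq0.
have r0 : r != 0 by rewrite -normc_gt0 (lt_trans _ rgt).
have h1 : 0 < (normc r)^-1 by rewrite invr_gt0 (lt_trans _ rgt).
have h2 : (normc r)^-1 < 1 by rewrite invf_lt1 // (lt_trans _ rgt).
have [e0 e00 H] := return_prod omV1 (nonrootV nr) h1 h2 del0.
exists e0 => // eps q he fr.
exists ((- r) ^+ q); first by rewrite normcX normcN.
move=> x; exists (\prod_(j < q) (1 - (r^-1 * e1 x) * om^-1 ^+ j) - 1).
  apply: (H eps q (r^-1 * e1 x) he (first_returnV om1 fr)).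
  rewrite normcM (normc_e1 x).
  rewrite mulr1.
  rewrite (normcV r).
  exact: lexx.
rewrite addrC subrK !mul0r e10 mulr1.
rewrite [(- r) ^+ q](_ : _ = \prod_(j < q) (- r)); last by rewrite prodr_const card_ord.
rewrite -!big_split /=; apply: eq_bigr => j _.
by rewrite e1xj; field.
Qed.

(** Multiply the estimates of [prod_linear] over the roots; the relative errors
    a and b of two factors combine into a + b + a b. *)
Lemma prod_cocycle c k rs (del : R) : all (fun r => normc r != 1) rs -> 0 < del ->
  exists2 e0 : R, 0 < e0 & forall eps q, eps <= e0 -> first_return om eps q ->
    exists2 K : R[i], normc K = mahler c rs ^+ q & forall x, 
      exists2 err : R[i], normc err <= del &
      \prod_(j < q) cocycle c k rs (x - j%:R * alpha) =
      K * e1 (winding k rs * q%:R * x) * (1 + err).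
Proof.
elim: rs del => [|r rs IH] del.
  move=> _ del0; exists 1 => // eps q _ _.
  exists (c ^+ q * \prod_(j < q) e1 (k%:R * (j%:R * alpha))).
    rewrite normcM normcX normc_prod big1 ?mulr1 => [|i _]; last exact: normc_e1.
    by rewrite /mahler big_nil mulr1.
  move=> x; exists 0; first by rewrite normc0 ltW.
  rewrite addr0 mulr1 /winding big_nil add0r /cocycle.
  have dE (j : 'I_q) : - k%:R * (x - j%:R * alpha) = - k%:R * x + k%:R * (j%:R * alpha).
    by ring.
  under eq_bigr do rewrite big_nil mulr1 dE e1D.
  rewrite big_split /= prodr_const card_ord big_split /= -!mulrA; congr (_ * _).
  rewrite prodr_const card_ord mulrC; congr (_ * _).
  by rewrite -e1MnE -mulr_natl; congr e1; ring.
move=> /= /andP[r1 rs1] del0.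
(* d' <= 1 bounds the cross term, so that the combined error is at most 3 d'. *)
pose d' := Num.min del 1 / 3.
have d'0 : 0 < d' by rewrite divr_gt0 // lt_min del0 ltr01.
have d'1 : d' <= 1 by rewrite ler_pdivrMr // mul1r ge_min; apply/orP; right; lra.
have d'd : 3 * d' <= del by rewrite mulrC divfK // ge_min lexx.
have [ea ea0 Ha] := IH _ rs1 d'0.
have [eb eb0 Hb] := prod_linear r1 d'0.
exists (Num.min ea eb); first by rewrite lt_min ea0.
move=> eps q; rewrite le_min => /andP[h1 h2] fr.
have [Ka Ka1 Pa] := Ha _ _ h1 fr; have [Kb Kb1 Pb] := Hb _ _ h2 fr.
exists (Ka * Kb).
  rewrite normcM Ka1 Kb1 -exprMn /mahler big_cons; congr (_ ^+ _); ring.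
move=> x; have [a ha Ea] := Pa x; have [b hb Eb] := Pb x.
exists (a + b + a * b).
  apply: (le_trans (le_normcD _ _)); rewrite normcM.
  have := le_normcD a b; have := normc_ge0 a; have := normc_ge0 b => h3 h4 h5.
  have : normc a * normc b <= 1 * d' by apply: ler_pM => //; exact: le_trans d'1.
  lra.
have -> : \prod_(j < q) cocycle c k (r :: rs) (x - j%:R * alpha) =
  (\prod_(j < q) cocycle c k rs (x - j%:R * alpha)) *
  \prod_(j < q) (e1 (x - j%:R * alpha) - r).
  rewrite -big_split /=; apply: eq_bigr => j _; rewrite /cocycle big_cons.
  by rewrite [RHS]mulrAC -!mulrA.
rewrite Ea Eb.
have -> : winding k (r :: rs) * q%:R * x = (winding k rs * q%:R * x) + ((normc r < 1)%R%:R * q%:R * x).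
  by rewrite /winding big_cons; ring.
by rewrite e1D; ring.
Qed.

End cocycle_products.

(** * Measurability, translations and L2 mass *)

(** Borel measurability into C, identified with R^2 by the coordinates. *)
Definition cmeas (R : realType) d (T : measurableType d) (f : T -> R[i]) : Prop :=
  measurable_fun [set: T] (fun t => complex.Re (f t)) /\
  measurable_fun [set: T] (fun t => complex.Im (f t)).

Section cmeas_theory.
Context (R : realType) d (T : measurableType d).
Implicit Types (f g : T -> R[i]).

Lemma cmeas_cst (c : R[i]) : cmeas (fun _ : T => c).
Proof. by split; exact: measurable_cst. Qed.

Lemma cmeasD f g : cmeas f -> cmeas g -> cmeas (fun t => f t + g t).
Proof.
move=> [f1 f2] [g1 g2]; split.
  rewrite (_ : (fun t => _) = (fun t => complex.Re (f t) + complex.Re (g t))).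
    exact: measurable_funD.
  by apply/funext => t; case: (f t) (g t) => ? ? [].
rewrite (_ : (fun t => _) = (fun t => complex.Im (f t) + complex.Im (g t))).
  exact: measurable_funD.
by apply/funext => t; case: (f t) (g t) => ? ? [].
Qed.

Lemma cmeasM f g : cmeas f -> cmeas g -> cmeas (fun t => f t * g t).
Proof.
move=> [f1 f2] [g1 g2]; split.
  rewrite (_ : (fun t => _) = (fun t => complex.Re (f t) * complex.Re (g t) - complex.Im (f t) * complex.Im (g t))).
    by apply: measurable_funB; exact: measurable_funM.
  by apply/funext => t; case: (f t) (g t) => ? ? [].
rewrite (_ : (fun t => _) = (fun t => complex.Re (f t) * complex.Im (g t) + complex.Im (f t) * complex.Re (g t))).
  by apply: measurable_funD; exact: measurable_funM.
by apply/funext => t; case: (f t) (g t) => ? ? [].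
Qed.

Lemma cmeasZ c f : cmeas f -> cmeas (fun t => c * f t).
Proof. by move=> mf; apply: cmeasM => //; exact: cmeas_cst. Qed.

Lemma cmeasN f : cmeas f -> cmeas (fun t => - f t).
Proof.
move=> mf; rewrite (_ : (fun t => _) = (fun t => -1 * f t)); first exact: cmeasZ.
by apply/funext => t; rewrite mulN1r.
Qed.

Lemma cmeasB f g : cmeas f -> cmeas g -> cmeas (fun t => f t - g t).
Proof. by move=> mf mg; apply: cmeasD => //; exact: cmeasN. Qed.

Lemma cmeas_conj f : cmeas f -> cmeas (fun t => (f t)^*%C).
Proof.
move=> [f1 f2]; split.
  by rewrite (_ : (fun t => _) = (fun t => complex.Re (f t))) //; apply/funext => t; case: (f t).
rewrite (_ : (fun t => _) = (fun t => - complex.Im (f t))).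
  exact: measurable_funN.
by apply/funext => t; case: (f t).
Qed.

Lemma cmeas_sum (I : Type) (s : seq I) (F : I -> T -> R[i]) :
  (forall i, cmeas (F i)) -> cmeas (fun t => \sum_(i <- s) F i t).
Proof.
move=> mF; elim: s => [|i s IH].
  under eq_fun do rewrite big_nil; exact: cmeas_cst.
by under eq_fun do rewrite big_cons; exact: cmeasD.
Qed.

Lemma cmeas_expi (p : T -> R) : measurable_fun setT p -> cmeas (fun t => expi (p t)).
Proof.
move=> mp; split.
  apply: (@measurableT_comp _ _ _ _ _ _ (@cos R)) => //.
  by apply: continuous_measurable_fun; exact: continuous_cos.
apply: (@measurableT_comp _ _ _ _ _ _ (@sin R)) => //.
by apply: continuous_measurable_fun; exact: continuous_sin.
Qed.

Lemma cmeas_e1 (p : T -> R) : measurable_fun setT p -> cmeas (fun t => e1 (p t)).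
Proof. by move=> mp; apply: cmeas_expi; exact: measurable_funM. Qed.

Lemma cmeas_nsq f : cmeas f -> measurable_fun setT (fun t => nsq (f t)).
Proof. by move=> [f1 f2]; apply: measurable_funD; exact: measurable_funX. Qed.

Lemma cmeas_ensq f : cmeas f -> measurable_fun setT (fun t => (nsq (f t))%:E).
Proof. by move=> mf; apply/measurable_EFinP; exact: cmeas_nsq. Qed.

End cmeas_theory.

Lemma cmeas_comp (R : realType) d d' (T : measurableType d) (T' : measurableType d')
  (f : T' -> R[i]) (p : T -> T') : cmeas f -> measurable_fun setT p ->
  cmeas (fun t => f (p t)).
Proof. by move=> [f1 f2] mp; split; [exact: (measurableT_comp f1 mp)|exact: (measurableT_comp f2 mp)]. Qed.

Section shift.
Context (R : realType).
Notation mu := (@lebesgue_measure R).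
Local Open Scope ereal_scope.
Notation RR := (measurableTypeR R).

Lemma measurable_shift (a : R) : measurable_fun [set: RR] (fun x : RR => (x + a)%R : RR).
Proof. exact: measurable_funD. Qed.

(** Both sides are measures that agree on intervals. *)
Lemma mu_shift (a : R) (A : set RR) : measurable A ->
  mu ((fun x => (x + a)%R) @^-1` A) = mu A.
Proof.
move=> mA.
pose phi : {mfun RR >-> RR} := HB.pack (fun x : RR => (x + a)%R : RR)
  (isMeasurableFun.Build _ _ _ _ _ (measurable_shift a)).
have H X : ocitv X -> mu X = pushforward mu phi X.
  move=> [[b c]] _ <-; rewrite /pushforward /=.
  have -> : (fun x => (x + a)%R) @^-1` `]b, c] = [set` `](b - a)%R, (c - a)%R]].
    by apply/seteqP; split => x /=; rewrite !in_itv /= ltrBlDr lerBrDr.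
  rewrite !lebesgue_measure_itv /= !lte_fin ltrD2r; case: ifP => // _.
  by rewrite -!EFinB; congr EFin; ring.
have := @lebesgue_measure_unique R (pushforward mu phi) H A mA.
by move=> /(_ (measurable_shift a)).
Qed.

Lemma integral_shift (a : R) (D : set RR) (f : RR -> \bar R) :
  measurable D -> measurable_fun setT f -> (forall x, 0 <= f x) ->
  \int[mu]_(x in (fun x : RR => (x + a)%R) @^-1` D) f (x + a)%R = \int[mu]_(x in D) f x.
Proof.
move=> mD mf f0.
rewrite -[LHS](@ge0_integral_pushforward _ _ _ _ _ _ (measurable_shift a) mu D f) //.
  apply: eq_measure_integral.
    exact: measurable_shift.
  by move=> ? A mA _; exact: (mu_shift a mA).
exact: measurable_funTS.
Qed.

Lemma integral_shiftT (a : R) (f : RR -> \bar R) :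
  measurable_fun setT f -> (forall x, 0 <= f x) ->
  \int[mu]_x f (x + a)%R = \int[mu]_x f x.
Proof. by move=> mf f0; rewrite -(@integral_shift a setT f). Qed.

Lemma ae_imp (P Q : R -> Prop) : (forall x, P x -> Q x) ->
  {ae mu, forall x, P x} -> {ae mu, forall x, Q x}.
Proof. by move=> PQ; apply: negligibleS => x /= nQ /PQ. Qed.

Lemma ae_imp2 (P Q S : R -> Prop) : (forall x, P x -> Q x -> S x) ->
  {ae mu, forall x, P x} -> {ae mu, forall x, Q x} -> {ae mu, forall x, S x}.
Proof.
move=> PQ hP hQ; apply: negligibleS (negligibleU hP hQ) => x /= nS.
by have [Px|] := pselect (P x); [right => /(PQ _ Px)|left].
Qed.

Lemma ae_shift (a : R) (P : R -> Prop) :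
  {ae mu, forall x, P x} -> {ae mu, forall x, P (x + a)%R}.
Proof.
move=> [N [mN N0 PN]]; exists ((fun x : RR => (x + a)%R) @^-1` N); split.
- by rewrite -[X in measurable X]setTI; exact: measurable_shift.
- by rewrite mu_shift.
- by move=> x /= nP; apply: PN.
Qed.

End shift.

Section energy.
Context (R : realType).
Notation mu := (@lebesgue_measure R).
Local Open Scope ereal_scope.
Notation RR := (measurableTypeR R).
Implicit Types (f g : RR -> R[i]) (D : set RR).

(** The squared L2 norm of the restriction of f to D. *)
Definition energy (D : set R) (f : R -> R[i]) : \bar R :=
  \int[mu]_(t in D) (nsq (f t))%:E.

Lemma energy_ge0 D f : 0 <= energy D f.
Proof. by apply: integral_ge0 => t _; rewrite lee_fin nsq_ge0. Qed.

Lemma le_energy_ae D f g (k : R) : measurable D -> cmeas f -> cmeas g -> (0 <= k)%R ->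
  {ae mu, forall t, D t -> (nsq (f t) <= k * nsq (g t))%R} ->
  energy D f <= k%:E * energy D g.
Proof.
move=> mD mf mg k0 fg; rewrite /energy -ge0_integralZl_EFin //; last 2 first.
- by move=> t _; rewrite lee_fin nsq_ge0.
- by apply: measurable_funTS; exact: cmeas_ensq.
apply: ae_ge0_le_integral => //.
- by move=> t _; rewrite lee_fin nsq_ge0.
- by apply: measurable_funTS; exact: cmeas_ensq.
- by move=> t _; rewrite -EFinM lee_fin mulr_ge0 // nsq_ge0.
- apply: measurable_funTS; under eq_fun do rewrite -EFinM.
  by apply/measurable_EFinP; apply: measurable_funM => //; exact: cmeas_nsq.
Qed.

Lemma le_energy D f g (k : R) : measurable D -> cmeas f -> cmeas g -> (0 <= k)%R ->
  (forall t, D t -> (nsq (f t) <= k * nsq (g t))%R) ->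
  energy D f <= k%:E * energy D g.
Proof. by move=> mD mf mg k0 fg; apply: le_energy_ae => //; exact: aeW. Qed.

Lemma energyD_le D f g : measurable D -> cmeas f -> cmeas g ->
  energy D (fun t => f t + g t)%R <= 2%:E * energy D f + 2%:E * energy D g.
Proof.
move=> mD mf mg; rewrite /energy.
have mE h : cmeas h -> measurable_fun D (fun t => (nsq (h t))%:E).
  by move=> mh; apply: measurable_funTS; exact: cmeas_ensq.
have mE2 h : cmeas h -> measurable_fun D (fun t => 2%:E * (nsq (h t))%:E).
  move=> mh; apply: measurable_funTS; under eq_fun do rewrite -EFinM.
  by apply/measurable_EFinP; apply: measurable_funM => //; exact: cmeas_nsq.
have nn h t : 0 <= (nsq (h t : R[i]))%:E by rewrite lee_fin nsq_ge0.
rewrite -!ge0_integralZl_EFin //; [|exact: mE|exact: mE].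
rewrite -ge0_integralD //; last 4 first.
- by move=> t _; rewrite mule_ge0.
- exact: mE2.
- by move=> t _; rewrite mule_ge0.
- exact: mE2.
apply: ge0_le_integral => //.
- by apply: mE; exact: cmeasD.
- by apply: emeasurable_funD; exact: mE2.
- by move=> t _; rewrite -!EFinM -EFinD lee_fin nsqD_le.
Qed.

Lemma energy_sub D D' f : measurable D -> measurable D' -> cmeas f -> D `<=` D' ->
  energy D f <= energy D' f.
Proof.
move=> mD mD' mf DD'; apply: ge0_subset_integral => //.
  by apply: measurable_funTS; exact: cmeas_ensq.
by move=> t _; rewrite lee_fin nsq_ge0.
Qed.

Lemma eq_energy D f g : (forall t, D t -> f t = g t) -> energy D f = energy D g.
Proof. by move=> fg; apply: eq_integral => t; rewrite inE => /fg ->. Qed.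

Lemma energy_eq0 D f : measurable D -> cmeas f -> energy D f = 0 ->
  {ae mu, forall t, D t -> f t = 0%R}.
Proof.
move=> mD mf E0.
have mE : measurable_fun D (fun t => (nsq (f t))%:E).
  by apply: measurable_funTS; exact: cmeas_ensq.
have /(ae_eq_integral_abs mu mD mE) : \int[mu]_(x in D) `|(nsq (f x))%:E| = 0.
  by rewrite -[RHS]E0; apply: eq_integral => t _; rewrite gee0_abs // lee_fin nsq_ge0.
apply: filterS => t /= H /H [] /eqP; rewrite nsq_eq0 => /eqP -> //.
Qed.

Lemma energy_shift f (a : R) : cmeas f ->
  energy setT (fun t => f (t + a)%R) = energy setT f.
Proof.
move=> mf; rewrite /energy (@integral_shiftT _ a (fun t => (nsq (f t))%:E)) //.
  exact: cmeas_ensq.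
by move=> t; rewrite lee_fin nsq_ge0.
Qed.

Lemma cmeas_shift f (a : R) : cmeas f -> cmeas (fun t : RR => f (t + a)%R).
Proof. by move=> mf; apply: (cmeas_comp mf); exact: measurable_shift. Qed.

(** Finiteness is insensitive to the exponent 1/2 of the norm. *)
Lemma L2C_energy f : L2C f <-> cmeas f /\ energy setT f < +oo.
Proof.
have E : cmeas f -> (finite_norm mu 2%:E (fun t => normc (f t)) <-> energy setT f < +oo).
  move=> mf; rewrite /finite_norm unlock /Lnorm.
  have -> : \int[mu]_x `|(EFin \o (fun t => normc (f t))) x| `^ 2 = energy setT f.
    apply: eq_integral => t _ /=.
    by rewrite ger0_norm ?normc_ge0 // powR_mulrn ?normc_ge0 // nsqE.
  have := energy_ge0 setT f; case: (energy _ _) => [r| |] //= r0.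
  - by split => _; rewrite ltry.
  - by rewrite gt_eqF ?invr_gt0 // ltxx.
split; first by move=> [m1 m2 /E H]; have mf : cmeas f by []; split => //; exact: H.
by move=> [[m1 m2] H]; split=> //; exact/E.
Qed.

(** A shift by 0 <= h <= 1 moves the piece [b, b+h[ of the period to
    [b+1, b+1+h[; larger and negative shifts reduce to this case by iteration. *)
Lemma periodic_integral (F : RR -> \bar R) (a : R) :
  measurable_fun setT F -> (forall x, 0 <= F x) ->
  {ae mu, forall x, F (x + 1)%R = F x} ->
  \int[mu]_(x in `[0%R, 1%R[) F (x + a)%R = \int[mu]_(x in `[0%R, 1%R[) F x.
Proof.
move=> mF F0 per.
pose J (b c : R) := \int[mu]_(x in `[b, c[) F x.
have Jshift (b c h : R) : \int[mu]_(x in `[b, c[) F (x + h)%R = J (b + h)%R (c + h)%R.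
  rewrite /J -(@integral_shift _ h [set` `[(b + h)%R, (c + h)%R[]) //.
  congr (integral _ _ _); apply/seteqP; split => x /=;
    by rewrite !in_itv /= lerD2r ltrD2r.
have Jper (b c : R) : J (b + 1)%R (c + 1)%R = J b c.
  rewrite -Jshift; apply: ge0_ae_eq_integral => //.
  - by apply: measurable_funTS; apply: (measurableT_comp mF); exact: measurable_shift.
  - exact: measurable_funTS.
  - by apply: ae_imp per => x -> _.
have Jsplit (b c d : R) : (b <= c)%R -> (c <= d)%R -> J b d = J b c + J c d.
  move=> bc cd; rewrite /J -ge0_integral_setU //.
  - congr (integral _ _ _); apply/seteqP; split => x /=; rewrite !in_itv /=.
      move=> /andP[bx xd]; case: (ltP x c) => xc; [left|right]; rewrite ?bx ?xc //=.
    by case=> /andP[h1 h2]; rewrite ?h1 ?h2 ?(le_trans bc) ?(lt_le_trans h2) //=.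
  - exact: measurable_funTS.
  - rewrite disj_set2E; apply/eqP; rewrite -subset0 => x /= []; rewrite !in_itv /=.
    by move=> /andP[_ xc] /andP[cx _]; move: (lt_le_trans xc cx); rewrite ltxx.
have step (b h : R) : (0 <= h <= 1)%R -> J (b + h)%R (b + h + 1)%R = J b (b + 1)%R.
  move=> /andP[h0 h1].
  rewrite (@Jsplit b (b + h)%R) ?lerDl ?lerD2l // (@Jsplit (b + h)%R (b + 1)%R).
  - rewrite addeC; congr (_ + _); rewrite -(Jper b); congr (J _ _); ring.
  - by rewrite lerD2l.
  - by rewrite -addrA lerD2l lerDr.
have stepn (n : nat) (b h : R) : (0 <= h <= 1)%R ->
    J (b + h *+ n)%R (b + h *+ n + 1)%R = J b (b + 1)%R.
  move=> h01; elim: n => [|n IH]; first by rewrite mulr0n addr0.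
  by rewrite mulrS addrCA addrC step.
have pos (b h : R) : (0 <= h)%R -> J (b + h)%R (b + h + 1)%R = J b (b + 1)%R.
  move=> h0; pose n := (Num.truncn h).+1.
  have n0 : (0 < n%:R :> R)%R by rewrite ltr0n.
  rewrite -(stepn n b (h / n%:R)%R).
    by rewrite -[(_ *+ n)%R]mulr_natr divfK // gt_eqF.
  rewrite divr_ge0 ?(ltW n0) //= ler_pdivrMr // mul1r ltW //; exact: truncnS_gt.
rewrite Jshift add0r (addrC 1%R a).
have [a0|a0] := leP 0%R a; first by have := pos 0%R a a0; rewrite !add0r.
have := pos a (- a)%R; rewrite oppr_ge0 (ltW a0) => /(_ isT).
by rewrite subrr add0r => <-.
Qed.

End energy.

(** * Continuity of translations in L2 *)

Section translation_continuity.
Context (R : realType).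
Notation mu := (@lebesgue_measure R).
Notation RR := (measurableTypeR R).

(** Uniform continuity on a compact interval, with the second point allowed to
    leave the interval. *)
Lemma heine (p : R -> R) (a b eta : R) : continuous p -> 0 < eta ->
  exists2 d : R, 0 < d & forall h x, `|h| < d -> a <= x <= b -> `|p (x + h) - p x| < eta.
Proof.
move=> cp eta0.
have /compact_near_coveringP cov := @segment_compact R a b.
have : \forall h \near (0:R), `[a, b] `<=` [set x | `|p (x + h) - p x| < eta].
  apply: (cov R (nbhs (0:R)) (fun h x => `|p (x + h) - p x| < eta)) => x _.
  have eta2 : 0 < eta / 2 by rewrite divr_gt0.
  have /cvgrPdist_lt /(_ _ eta2) [d /= d0 dP] := cp x.
  have d20 : 0 < d / 2 by rewrite divr_gt0.
  exists (ball x (d / 2), ball (0:R) (d / 2)) => /=.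
    by split; exact: nbhsx_ballx.
  move=> [y h] /= [xy h0].
  have h1 := dP (y + h); have h2 := dP y.
  rewrite /ball_ /= in h1 h2.
  rewrite /ball /= in xy; rewrite /ball /= sub0r normrN in h0.
  have {}h1 : `|p x - p (y + h)| < eta / 2.
    apply: h1; rewrite (_ : x - (y + h) = (x - y) - h); last by ring.
    by rewrite (le_lt_trans (ler_normB _ _)) // (splitr d) ltrD.
  have {}h2 : `|p x - p y| < eta / 2.
    by apply: h2; rewrite (lt_trans xy) // ltr_pdivrMr // mulr_natr mulr2n ltrDl.
  rewrite (_ : _ - _ = (p x - p y) - (p x - p (y + h))); last by ring.
  by rewrite (le_lt_trans (ler_normB _ _)) // (splitr eta) ltrD.
move=> [d /= d0 dP]; exists d => // h x hd xab.
apply: (dP h) => /=; first by rewrite /ball_ /= sub0r normrN.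
by rewrite in_itv.
Qed.

Local Open Scope ereal_scope.

(** Approximate g in L1 by a continuous function on an interval with a margin
    of 1 on both sides of the one used for the comparison, so that translates
    by less than 1 stay inside; the continuous function is uniformly continuous
    there. *)
Lemma L1_translation (g : R -> R) (K : R) : measurable_fun [set: RR] (g : RR -> R) ->
  (forall t, (`|g t| <= K)%R) -> (forall t, (K < `|t|)%R -> g t = 0%R) -> 
  forall eps : R, (0 < eps)%R -> exists2 d : R, (0 < d)%R &
    forall h : R, (`|h| < d)%R -> \int[mu]_t (`|g (t + h) - g t|%R)%:E <= eps%:E.
Proof.
move=> mg gK gsupp eps eps0.
have K0 : (0 <= K)%R by apply: le_trans (gK 0%R).
pose E' := [set` `[(- (K + 2))%R, (K + 2)%R]].
pose E := [set` `[(- (K + 1))%R, (K + 1)%R]].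
have mE : measurable (E : set RR) by exact: measurable_itv.
have mE' : measurable (E' : set RR) by exact: measurable_itv.
have fE' : mu E' < +oo.
  by rewrite lebesgue_measure_itv /=; case: ifP => // _; rewrite -EFinB ltry.
have ig : mu.-integrable E' (EFin \o g).
  apply: measurable_bounded_integrable => //.
    exact: measurable_funTS.
  by exists K; split; [exact: num_real|move=> x Kx t _; exact: le_trans (gK t) (ltW Kx)].
have [ph [cph iph lph]] := approximation_continuous_integrable mE' fE' ig.
pose e4 := (eps / 4)%R.
have e40 : (0 < e4)%R by rewrite divr_gt0.
have [n hn] : exists n, \int[mu]_(z in E') `|(g z - ph n z)%:E| <= e4%:E.
  have /fine_cvgP [hfin /cvgrPdist_lt /(_ _ e40) hl] := lph.
  have [n [h1 h2]] := filter_ex (filterI hfin hl).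
  exists n; rewrite -(fineK h1) lee_fin.
  by move: h2; rewrite /= sub0r normrN => /ltW; apply: le_trans; exact: ler_norm.
have mph : measurable_fun [set: RR] (ph n : RR -> R).
  exact: continuous_measurable_fun.
pose eta := (e4 / (2 * K + 2))%R.
have eta0 : (0 < eta)%R by rewrite divr_gt0 //; lra.
have [d d0 dP] := heine (- (K + 1))%R (K + 1)%R (cph n) eta0.
exists (Num.min d 1%R); first by rewrite lt_min d0 ltr01.
move=> h; rewrite lt_min => /andP[hd h1].
have mdiff (f1 f2 : R -> R) D : measurable_fun [set: RR] (f1 : RR -> R) ->
    measurable_fun [set: RR] (f2 : RR -> R) ->
    measurable_fun (D : set RR) (fun t : RR => (`|f1 t - f2 t|%R)%:E).
  move=> m1 m2; apply: measurable_funTS; apply/measurable_EFinP.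
  apply: measurableT_comp => //; exact: measurable_funB.
have msh (f : R -> R) : measurable_fun [set: RR] (f : RR -> R) ->
    measurable_fun [set: RR] (fun t : RR => f (t + h)%R).
  by move=> mf; apply: (measurableT_comp mf); exact: measurable_shift.
have -> : \int[mu]_t (`|g (t + h) - g t|%R)%:E = \int[mu]_(t in E) (`|g (t + h) - g t|%R)%:E.
  rewrite [RHS]integral_mkcond; apply: eq_integral => t _; rewrite patchE.
  case: ifPn => //; rewrite notin_setE /E /= in_itv /= => /negP tE.
  have tK : (K + 1 < `|t|)%R by rewrite ltNge ler_norml.
  rewrite !gsupp ?subrr ?normr0 //; first by rewrite (lt_trans _ tK) // ltrDl.
  have := ler_normB (t + h)%R h; rewrite addrK; lra.
apply: (@le_trans _ _ (\int[mu]_(t in E) ((`|g (t + h) - ph n (t + h)|%R)%:E +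
   ((`|ph n (t + h) - ph n t|%R)%:E + (`|g t - ph n t|%R)%:E)))).
  apply: ge0_le_integral => //.
  - apply: mdiff => //; exact: msh.
  - apply: emeasurable_funD; first by apply: mdiff; exact: msh.
    by apply: emeasurable_funD; apply: mdiff => //; exact: msh.
  - move=> t _; rewrite -!EFinD lee_fin.
    rewrite (_ : g (t + h) - g t = (g (t + h) - ph n (t + h)) + ((ph n (t + h) - ph n t) - (g t - ph n t)))%R; last by ring.
    rewrite (le_trans (ler_normD _ _)) // lerD2l.
    exact: ler_normB.
rewrite ge0_integralD //; last 3 first.
- by apply: mdiff; exact: msh.
- by move=> t _; rewrite adde_ge0.
- by apply: emeasurable_funD; apply: mdiff => //; exact: msh.
rewrite ge0_integralD //; last 2 first.
- by apply: mdiff => //; exact: msh.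
- by apply: mdiff.
have b1 : \int[mu]_(t in E) (`|g (t + h) - ph n (t + h)|%R)%:E <= e4%:E.
  apply: le_trans hn.
  have mF : measurable_fun [set: RR] (fun t : RR => (`|g t - ph n t|%R)%:E).
    exact: mdiff.
  rewrite -(@integral_shift _ h E' (fun t => `|(g t - ph n t)%:E|)) //.
  apply: ge0_subset_integral => //.
  - by rewrite -[X in measurable X]setTI; exact: measurable_shift.
  - apply: measurable_funTS; apply: (measurableT_comp mF); exact: measurable_shift.
  - move=> t; rewrite /E /E' /= !in_itv /= -!ler_norml => tK.
    by rewrite (le_trans (ler_normD _ _)) //; lra.
have b2 : \int[mu]_(t in E) (`|ph n (t + h) - ph n t|%R)%:E <= e4%:E.
  apply: (@le_trans _ _ (\int[mu]_(t in E) (eta)%:E)).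
    apply: ge0_le_integral => //.
    - by apply: mdiff => //; exact: msh.
    - by move=> t; rewrite /E /= in_itv /= => tE; rewrite lee_fin ltW // dP.
  rewrite integral_cst //.
  have muE : mu E = (2 * K + 2)%:E.
    rewrite lebesgue_measure_itv /= lte_fin.
    rewrite (_ : (- (K + 1) < K + 1)%R = true); last by lra.
    by rewrite -EFinB; congr EFin; ring.
  rewrite [X in _ * X]muE -EFinM lee_fin /eta.
  by rewrite divfK // gt_eqF //; lra.
have b3 : \int[mu]_(t in E) (`|g t - ph n t|%R)%:E <= e4%:E.
  apply: le_trans hn; apply: ge0_subset_integral => //.
  - by apply: mdiff.
  - move=> t; rewrite /E /E' /= !in_itv /= -!ler_norml; lra.
apply: (le_trans (leeD b1 (leeD b2 b3))).
by rewrite -!EFinD lee_fin /e4; lra.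
Qed.

Lemma cmeas_indic (A : set RR) : measurable A ->
  cmeas (fun t : RR => ((\1_A t : R)%:C)%C).
Proof. by move=> mA; split; [exact: measurable_indic|exact: measurable_cst]. Qed.

Definition cutoff (A : set RR) (f : RR -> R[i]) (t : R) : R[i] :=
  (((\1_A t : R)%:C)%C * f t)%R.

Lemma cmeas_cutoff (A : set RR) f : measurable A -> cmeas f -> cmeas (cutoff A f).
Proof. by move=> mA mf; apply: cmeasM => //; exact: cmeas_indic. Qed.

Lemma cutoffE (A : set RR) (f : RR -> R[i]) t :
  cutoff A f t = (if t \in A then f t else 0)%R.
Proof. by rewrite /cutoff indicE; case: ifP => _; rewrite ?mul1r ?mul0r. Qed.

(** Dominated convergence, with the square of f as dominating function. *)
Lemma dom_energy (f : RR -> R[i]) (B : nat -> set RR) : cmeas f ->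
  energy setT f < +oo -> (forall n, measurable (B n)) ->
  (forall t, \forall n \near \oo, ~ B n t) ->
  energy setT (cutoff (B n) f) @[n --> \oo] --> 0.
Proof.
move=> mf fin mB Bv.
have mF n : cmeas (cutoff (B n) f).
  exact: cmeas_cutoff.
have [|||||] := @dominated_convergence _ _ _ mu setT measurableT
  (fun n t => (nsq (cutoff (B n) f t)%R)%:E) (fun=> 0)
  (fun t => (nsq (f t))%:E).
- by move=> n; exact: (cmeas_ensq (mF n)).
- exact: measurable_cst.
- apply: aeW => t _; apply: cvg_near_cst.
  have := Bv t; apply: filterS => n nB.
  by rewrite cutoffE memNset // nsq0.
- apply/integrableP; split; first exact: cmeas_ensq.
  rewrite (_ : integral _ _ _ = energy setT f) //.
  by apply: eq_integral => t _; rewrite /= ger0_norm // nsq_ge0.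
- apply: aeW => t n _; rewrite gee0_abs ?lee_fin ?nsq_ge0 //.
  by rewrite cutoffE; case: ifP => // _; rewrite nsq0 nsq_ge0.
by rewrite integral0.
Qed.

(** A bounded function has |f(t+h) - f(t)|^2 <= C |f(t+h) - f(t)|, so that the
    L1 statement for the coordinates suffices. *)
Lemma L2_translation_bounded (f : RR -> R[i]) (K : R) : cmeas f ->
  (forall t, (`|complex.Re (f t)| <= K)%R /\ (`|complex.Im (f t)| <= K)%R) ->
  (forall t, (K < `|t|)%R -> f t = 0%R) ->
  forall eps : R, (0 < eps)%R -> exists2 d : R, (0 < d)%R &
    forall h : R, (`|h| < d)%R -> energy setT (fun t => f (t + h) - f t)%R <= eps%:E.
Proof.
move=> mf fK fsupp eps eps0.
have K0 : (0 <= K)%R by have [h _] := fK 0%R; apply: le_trans h.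
have K1 : (0 < 4 * (K + 1))%R by lra.
pose e' := (eps / (4 * (K + 1)))%R.
have e'0 : (0 < e')%R by rewrite divr_gt0.
have [m1 m2] := mf.
have [d1 d10 H1] := L1_translation m1 (fun t => (fK t).1) (fun t tK => congr1 _ (fsupp t tK)) e'0.
have [d2 d20 H2] := L1_translation m2 (fun t => (fK t).2) (fun t tK => congr1 _ (fsupp t tK)) e'0.
exists (Num.min d1 d2); first by rewrite lt_min d10.
move=> h; rewrite lt_min => /andP[/H1 b1 /H2 b2].
have ms (g : RR -> R) : measurable_fun setT g -> measurable_fun setT (fun t : RR => (`|g (t + h) - g t|%R)%:E).
  move=> mg; apply/measurable_EFinP; apply: measurableT_comp => //.
  by apply: measurable_funB => //; apply: (measurableT_comp mg); exact: measurable_shift.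
have K2 : (0 <= 2 * (K + 1))%R by lra.
apply: (@le_trans _ _ (\int[mu]_t ((2 * (K + 1))%:E * ((`|complex.Re (f (t + h)) - complex.Re (f t)|%R)%:E + (`|complex.Im (f (t + h)) - complex.Im (f t)|%R)%:E)))).
  apply: ge0_le_integral => //.
  - by move=> t _; rewrite lee_fin nsq_ge0.
  - by apply: cmeas_ensq; apply: cmeasB => //; exact: cmeas_shift.
  - by apply: emeasurable_funM => //; apply: emeasurable_funD; exact: ms.
  - move=> t _; rewrite -EFinD -EFinM lee_fin.
    have [r1 i1] := fK t; have [r2 i2] := fK (t + h)%R.
    rewrite (_ : nsq _ = `|complex.Re (f (t + h)) - complex.Re (f t)| ^+ 2 + `|complex.Im (f (t + h)) - complex.Im (f t)| ^+ 2)%R; last first.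
      by rewrite -!normrX !ger0_norm ?sqr_ge0 //; case: (f _) (f t) => ? ? [].
    rewrite mulrDr lerD // expr2 ler_wpM2r // (le_trans (ler_normB _ _)) //; lra.
rewrite ge0_integralZl_EFin //; first last.
- by apply: emeasurable_funD; exact: ms.
- by move=> t _; rewrite adde_ge0.
rewrite ge0_integralD //; [|exact: ms|exact: ms].
apply: (@le_trans _ _ ((2 * (K + 1))%:E * (e'%:E + e'%:E))).
  by rewrite lee_wpmul2l ?lee_fin // leeD.
rewrite -EFinD -EFinM lee_fin /e'.
rewrite [leLHS](_ : _ = eps)%R //; field; lra.
Qed.

(** Cut f off where it or its argument is large; the remainder has small energy,
    translated or not. *)
Lemma L2_translation (f : RR -> R[i]) : cmeas f -> energy setT f < +oo ->
  forall eps : R, (0 < eps)%R -> exists2 d : R, (0 < d)%R &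
    forall h : R, (`|h| < d)%R -> energy setT (fun t => f (t + h) - f t)%R <= eps%:E.
Proof.
move=> mf fin eps eps0.
pose A n := [set t : RR | (`|complex.Re (f t)| <= n%:R)%R] `&`
   ([set t : RR | (`|complex.Im (f t)| <= n%:R)%R] `&` [set t : RR | (`|t| <= n%:R)%R]).
have [m1 m2] := mf.
have mle (g : RR -> R) (c : R) : measurable_fun setT g -> measurable [set t : RR | (`|g t| <= c)%R].
  move=> mg; rewrite (_ : [set t | _] = setT `&` (fun t => `|g t|%R) @^-1` [set` `]-oo, c]]).
    by apply: (measurableT_comp _ mg) => //.
  by rewrite setTI; apply/seteqP; split => t /=; rewrite in_itv.
have mA n : measurable (A n).
  by apply: measurableI; [exact: mle|apply: measurableI; [exact: mle|apply: mle]].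
pose B n := ~` A n.
have mB n : measurable (B n) by exact: measurableC.
have Bv t : \forall n \near \oo, ~ B n t.
  have : \forall n \near \oo, (`|complex.Re (f t)| + `|complex.Im (f t)| + `|t| <= n%:R :> R)%R.
    exact: nbhs_infty_ger.
  apply: filterS => n hn; rewrite /B /= => nA; apply: nA; rewrite /A /=.
  have := normr_ge0 (complex.Re (f t)); have := normr_ge0 (complex.Im (f t)).
  by have := normr_ge0 t => h1 h2 h3; repeat split; lra.
have eps8 : (0 < eps / 16)%R by rewrite divr_gt0.
have /fine_cvgP [hfin /cvgrPdist_lt /(_ _ eps8) hl] := dom_energy mf fin mB Bv.
have [n [h1 h2]] := filter_ex (filterI hfin hl).
pose g t := (cutoff (A n) f t)%R.
pose r t := (cutoff (B n) f t)%R.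
have mg : cmeas g by exact: cmeas_cutoff.
have mr : cmeas r by exact: cmeas_cutoff.
have er : energy setT r <= (eps / 16)%:E.
  rewrite -(fineK h1) lee_fin.
  by move: h2; rewrite /= sub0r normrN => /ltW; apply: le_trans; exact: ler_norm.
have fgr t : (f t = g t + r t)%R.
  rewrite /g /r !cutoffE /B; case: ifPn => hA.
    by rewrite ifN ?addr0 // notin_setE /= => nA; apply: nA; exact: set_mem.
  by rewrite ifT ?add0r // inE /=; move: hA; rewrite notin_setE.
have eps4 : (0 < eps / 4)%R by rewrite divr_gt0.
have gK t : (`|complex.Re (g t)| <= n%:R)%R /\ (`|complex.Im (g t)| <= n%:R)%R.
  by rewrite /g cutoffE; case: ifPn => [/set_mem [? []] //|_]; rewrite /= normr0.
have gs t : (n%:R < `|t|)%R -> g t = 0%R.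
  rewrite /g cutoffE; case: ifPn => // /set_mem [_ [_ /= tn]] nt.
  by have := lt_le_trans nt tn; rewrite ltxx.
have [d d0 dP] := L2_translation_bounded mg gK gs eps4.
exists d => // h hd.
have mgd : cmeas (fun t : RR => g (t + h) - g t)%R by apply: cmeasB => //; exact: cmeas_shift.
have mrd : cmeas (fun t : RR => r (t + h) - r t)%R by apply: cmeasB => //; exact: cmeas_shift.
rewrite (@eq_energy _ _ _ (fun t => (g (t + h) - g t) + (r (t + h) - r t))%R); last first.
  by move=> t _; rewrite !fgr; ring.
apply: (le_trans (energyD_le measurableT mgd mrd)).
have erd : energy setT (fun t => r (t + h) - r t)%R <= (eps / 4)%:E.
  apply: (le_trans (energyD_le measurableT (cmeas_shift h mr) (cmeasN mr))).
  rewrite energy_shift //.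
  have -> : energy setT (fun t => - r t)%R = energy setT r.
    by apply: eq_integral => t _; rewrite nsqN.
  apply: (@le_trans _ _ (2%:E * (eps / 16)%:E + 2%:E * (eps / 16)%:E)).
    by apply: leeD; rewrite lee_wpmul2l.
  by rewrite -!EFinM -EFinD lee_fin; lra.
apply: (@le_trans _ _ (2%:E * (eps / 4)%:E + 2%:E * (eps / 4)%:E)).
  by apply: leeD; rewrite lee_wpmul2l // dP.
by rewrite -!EFinM -EFinD lee_fin; lra.
Qed.

End translation_continuity.

(** * First-order relations over an irrational rotation *)

Section fiber.
Context (R : realType).
Notation mu := (@lebesgue_measure R).
Notation RR := (measurableTypeR R).
Notation I01 := ([set` `[(0:R), (1:R)[] : set RR).

Lemma quasi_energy (f : RR -> R[i]) (z : R[i]) (a : R) : cmeas f -> normc z = 1 ->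
  {ae mu, forall x, f (x + 1) = z * f x} ->
  energy I01 (fun x => f (x + a)) = energy I01 f.
Proof.
move=> mf z1 per; apply: (@periodic_integral _ (fun x => (nsq (f x))%:E)).
- exact: cmeas_ensq.
- by move=> x; rewrite lee_fin nsq_ge0.
- by apply: ae_imp per => x ->; rewrite nsqM nsqE z1 expr1n mul1r.
Qed.

Lemma mI01 : measurable I01. Proof. exact: measurable_itv. Qed.

(** f is only locally square integrable, but on [0, 1[ and for 0 <= h < 1 its
    translates see only its restriction to [0, 2[, to which [L2_translation]
    applies. *)
Lemma quasi_translation (f : RR -> R[i]) (z : R[i]) : cmeas f -> normc z = 1 ->
  {ae mu, forall x, f (x + 1) = z * f x} -> (energy I01 f < +oo)%E ->
  forall eps : R, (0 < eps)%R -> exists2 d : R, (0 < d)%R &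
    forall h : R, 0 <= h -> h < d -> (energy I01 (fun t => f (t + h) - f t)%R <= eps%:E)%E.
Proof.
move=> mf z1 per fin eps eps0.
pose J := [set` `[(0:R), (2:R)[] : set RR.
have mJ : measurable J by exact: measurable_itv.
pose g t := (cutoff J f t)%R.
have mg : cmeas g by exact: cmeas_cutoff.
have fing : (energy setT g < +oo)%E.
  have -> : energy setT g = energy J f.
    rewrite /energy [RHS]integral_mkcond; apply: eq_integral => t _.
    by rewrite patchE /g cutoffE; case: ifP => // _; rewrite nsq0.
  have -> : J = I01 `|` [set` `[(1:R), (2:R)[].
    apply/seteqP; split => x /=; rewrite !in_itv /=.
      rewrite /J /= in_itv /= => /andP[h1 h2].
      by case: (ltP x 1) => h; [left|right]; apply/andP; split.
    by rewrite /J /= in_itv /=; case=> /andP[h1 h2]; apply/andP; split; lra.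
  rewrite /energy ge0_integral_setU //.
  - have -> : (\int[mu]_(x in [set` `[1%R, 2%R[]) (nsq (f x))%:E = energy I01 f)%E.
      rewrite -(quasi_energy 1 mf z1 per) /energy -(@integral_shift _ 1) //.
      - congr (integral _ _ _); apply/seteqP; split => x /=; rewrite !in_itv /=; lra.
      - exact: cmeas_ensq.
      - by move=> x; rewrite lee_fin nsq_ge0.
    by rewrite lte_add_pinfty.
  - by apply: measurable_funTS; exact: cmeas_ensq.
  - by move=> x _; rewrite lee_fin nsq_ge0.
  - rewrite disj_set2E; apply/eqP; rewrite -subset0 => x /= []; rewrite !in_itv /=.
    by move=> /andP[_ xc] /andP[cx _]; move: (lt_le_trans xc cx); rewrite ltxx.
have [d d0 dP] := L2_translation mg fing eps0.
exists (Num.min d 1); first by rewrite lt_min d0 ltr01.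
move=> h h0; rewrite lt_min => /andP[hd h1].
have hd' : `|h| < d by rewrite ger0_norm.
apply: le_trans (dP h hd').
apply: (@le_trans _ _ (energy I01 (fun t => g (t + h) - g t))).
  rewrite le_eqVlt; apply/orP; left; apply/eqP; apply: eq_energy => t; rewrite /= in_itv /= => /andP[t0 t1].
  by rewrite /g !cutoffE !mem_set // /J /= in_itv /=; apply/andP; split; lra.
apply: energy_sub => //.
by apply: cmeasB => //; exact: cmeas_shift.
Qed.

Lemma pow_half (x : R) : 0 <= x -> x < 1 -> exists N : nat, forall q, (N < q)%N -> x ^+ q < 2^-1.
Proof.
move=> x0 x1.
have x1' : `|x| < 1 by rewrite ger0_norm.
have h2 : 0 < 2^-1 :> R by rewrite invr_gt0.
have /cvgrPdist_lt /(_ _ h2) [N _ NP] := cvg_expr x1'.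
exists N => q /ltnW Nq; have := NP q Nq.
by rewrite sub0r normrN ger0_norm // exprn_ge0.
Qed.

Lemma first_return_small (alpha : R) (eps : R) : 0 < eps -> exists q, first_return (e1 alpha) eps q.
Proof.
move=> eps0; apply: first_return_ex.
have [d d0 dP] := e1_near1 eps0.
have [n [k [_ n0 h]]] := dirichlet alpha 0 d0.
exists n => //; have := dP _ h.
by rewrite e1B e1_int divr1 mulr_natl e1MnE.
Qed.

Section vanishing.
Variables (alpha : R) (H : RR -> R[i]) (z c3 c : R[i]) (k : nat) (rs : seq R[i]).
Hypothesis nr : nonroot (e1 alpha).
Hypothesis mH : cmeas H.
Hypothesis finH : (energy I01 H < +oo)%E.
Hypothesis z1 : normc z = 1.
Hypothesis per : {ae mu, forall x, H (x + 1) = z * H x}.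
Hypothesis c30 : c3 != 0.
Hypothesis coc : {ae mu, forall x, c3 * H (x - alpha) = cocycle c k rs x * H x}.
Hypothesis rs1 : all (fun r => normc r != 1) rs.

Lemma cocycle_iter q : {ae mu, forall x,
  c3 ^+ q * H (x - q%:R * alpha) = (\prod_(j < q) cocycle c k rs (x - j%:R * alpha)) * H x}.
Proof.
elim: q => [|q IH].
  by apply: aeW => x; rewrite big_ord0 mul0r subr0 expr0.
apply: ae_imp2 IH (ae_shift (- (q%:R * alpha)) coc) => x h1 h2.
rewrite big_ord_recr /= mulrAC -h1 exprSr -mulrA.
have -> : x - q.+1%:R * alpha = x - q%:R * alpha - alpha by rewrite -natr1; ring.
by rewrite h2; ring.
Qed.

(** The iterated relation at a close return: the rotation by q alpha is almost
    the identity and the cocycle is almost a monomial. *)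
Lemma renormalized (N : nat) : exists q (K : R[i]),
  [/\ (N < q)%N, normc K = mahler c rs ^+ q &
   {ae mu, forall x, exists2 err, normc err <= 2^-1 &
     c3 ^+ q * H (x - q%:R * alpha) = K * e1 (winding k rs * q%:R * x) * (1 + err) * H x}].
Proof.
have h2 : 0 < 2^-1 :> R by rewrite invr_gt0.
have [ea ea0 Ha] := prod_cocycle nr c k rs1 h2.
have [eb eb0 Hb] := first_return_large N nr.
have m0 : 0 < Num.min ea eb by rewrite lt_min ea0.
have [q fr] := first_return_small alpha m0.
have ha : Num.min ea eb <= ea by rewrite ge_min lexx.
have [K K1 KP] := Ha _ q ha fr.
exists q, K; split => //.
  by apply: (Hb (Num.min ea eb)) => //; rewrite ge_min lexx orbT.
apply: ae_imp (cocycle_iter q) => x ->.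
by have [err e1' ->] := KP x; exists err.
Qed.

Lemma nsq_1err (err : R[i]) : normc err <= 2^-1 ->
  4^-1 <= nsq (1 + err) <= 9 / 4.
Proof.
move=> he; rewrite nsqE.
have h1 := le_normcD 1 err; rewrite normc1 in h1.
have h2 : 1 <= normc (1 + err) + normc err.
  by have := le_normcB (1 + err) err; rewrite addrK normc1.
have h3 : 2^-1 <= normc (1 + err) <= 3/2 by apply/andP; split; lra.
by move/andP: h3 => [h3 h4]; apply/andP; split; nra.
Qed.

(** Translations preserve the energy of H over a period, so the renormalized
    relation compares |c3|^(2q) with the 2q-th power of the Mahler measure, up
    to bounded factors, for arbitrarily large q. *)
Lemma fiber_norm : energy I01 H != 0%E -> mahler c rs = normc c3.
Proof.
move=> E0.
have [i iE] : exists i : R, energy I01 H = i%:E.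
  exists (fine (energy I01 H)); rewrite fineK // ge0_fin_numE //; exact: energy_ge0.
have i0 : 0 < i.
  by rewrite lt_neqAle eq_sym -eqe -iE E0 /= -lee_fin -iE energy_ge0.
have c0 : 0 < normc c3 by rewrite normc_gt0.
set M := mahler c rs.
have M0 : 0 <= M.
  rewrite mulr_ge0 ?normc_ge0 // prodr_ge0 // => r _.
  by rewrite le_max ler01.
have key N : exists2 q, (N < q)%N & 
   (normc c3 ^+ q) ^+ 2 <= 9/4 * (M ^+ q) ^+ 2 /\ 4^-1 * (M ^+ q) ^+ 2 <= (normc c3 ^+ q) ^+ 2.
  have [q [K [Nq K1 KP]]] := renormalized N.
  exists q => //.
  have mHs : cmeas (fun x : RR => c3 ^+ q * H (x - q%:R * alpha)).
    by apply: cmeasZ; exact: (cmeas_shift _ mH).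
  have E1 : energy I01 (fun x => c3 ^+ q * H (x - q%:R * alpha)) = (((normc c3 ^+ q) ^+ 2) * i)%:E.
    rewrite EFinM -iE -(quasi_energy (- (q%:R * alpha)) mH z1 per).
    rewrite /energy -ge0_integralZl_EFin //.
    - by apply: eq_integral => x _; rewrite nsqM nsqE normcX EFinM.
    - by move=> x _; rewrite lee_fin nsq_ge0.
    - by apply: measurable_funTS; apply: cmeas_ensq; exact: (cmeas_shift _ mH).
    - by rewrite exprn_ge0 // exprn_ge0 // normc_ge0.
  have nz x err : nsq (K * e1 (winding k rs * q%:R * x) * (1 + err) * H x) =
    (M ^+ q) ^+ 2 * nsq (1 + err) * nsq (H x).
    by rewrite !nsqM nsq_e1 mulr1 [nsq K]nsqE K1.
  split.
    have := @le_energy_ae _ I01 _ H (9/4 * (M ^+ q) ^+ 2) mI01 mHs mH.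
    rewrite E1 iE -EFinM lee_fin ler_pM2r //; apply.
      by rewrite mulr_ge0 // sqr_ge0.
    apply: ae_imp KP => x [err he ->] _; rewrite nz.
    rewrite ler_wpM2r ?nsq_ge0 // mulrC ler_wpM2r ?sqr_ge0 //.
    by have /andP[] := nsq_1err he.
  have [->|Mq0] := eqVneq (M ^+ q) 0.
    by rewrite expr0n /= mulr0 sqr_ge0.
  have Mq : 0 < M ^+ q by rewrite lt_neqAle eq_sym Mq0 exprn_ge0.
  have := @le_energy_ae _ I01 H _ (4 * ((M ^+ q) ^+ 2)^-1) mI01 mH mHs.
  rewrite E1 iE -EFinM lee_fin => hh.
  have : i <= 4 * (M ^+ q ^+ 2)^-1 * (normc c3 ^+ q ^+ 2 * i).
    apply: hh; first by rewrite mulr_ge0 // invr_ge0 sqr_ge0.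
    apply: ae_imp KP => x [err he ->] _; rewrite nz.
    have /andP[h1 _] := nsq_1err he.
    rewrite (_ : _ * _ = 4 * nsq (1 + err) * nsq (H x)); last by field.
    rewrite -[leLHS]mul1r ler_wpM2r ?nsq_ge0 //; lra.
  rewrite [leRHS](_ : _ = i * (4 * (M ^+ q ^+ 2)^-1 * (normc c3 ^+ q ^+ 2))); last by ring.
  rewrite -[leLHS]mulr1 ler_pM2l // mulrAC.
  have M2 : 0 < M ^+ q ^+ 2 by exact: exprn_gt0.
  rewrite ler_pdivlMr //.
  set u := M ^+ q ^+ 2; set v := normc c3 ^+ q ^+ 2; lra.
apply/eqP; rewrite eq_le; apply/andP; split; rewrite leNgt; apply/negP => hlt.
- have Mp : 0 < M by exact: lt_trans hlt.
  have x1 : normc c3 / M < 1 by rewrite ltr_pdivrMr // mul1r.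
  have x0 : 0 <= normc c3 / M by rewrite divr_ge0 ?normc_ge0.
  have [N /= NP] := pow_half x0 x1; have [q /NP hq [_ h]] := key N.
  move: hq; rewrite expr_div_n ltr_pdivrMr ?exprn_gt0 // => hq.
  have := exprn_gt0 q c0; have := exprn_gt0 q Mp.
  by move: hq h; set u := _ ^+ q; set v := _ ^+ q; nra.
have x1 : M / normc c3 < 1 by rewrite ltr_pdivrMr // mul1r.
have x0 : 0 <= M / normc c3 by rewrite divr_ge0 ?normc_ge0.
have [N /= NP] := pow_half x0 x1; have [q /NP hq [h _]] := key N.
move: hq; rewrite expr_div_n ltr_pdivrMr ?exprn_gt0 // => hq.
have := exprn_gt0 q c0; have := exprn_ge0 q M0.
by move: hq h; set u := _ ^+ q; set v := _ ^+ q; nra.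
Qed.

(** Write the renormalized relation at x and at x + 1/(2q). The unimodular
    factors [u] are opposite while the values of H are nearly equal in L2,
    whence 2 u H is bounded by the increments G of H and by the errors. *)
Lemma fiber_winding : mahler c rs = normc c3 -> winding k rs ^+ 2 = 1 ->
  energy I01 H = 0%E.
Proof.
move=> Mc w2; apply/eqP; apply/negPn/negP => E0.
have [i iE] : exists i : R, energy I01 H = i%:E.
  exists (fine (energy I01 H)); rewrite fineK // ge0_fin_numE //; exact: energy_ge0.
have i0 : 0 < i.
  by rewrite lt_neqAle eq_sym -eqe -iE E0 /= -lee_fin -iE energy_ge0.
have i8 : 0 < i / 16 by rewrite divr_gt0.
have [d d0 dP] := quasi_translation mH z1 per finH i8.
(* A return time beyond 1/d makes 1/(2q) an admissible displacement. *)
pose N := Num.truncn d^-1.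
have [q [K [Nq K1 KP]]] := renormalized N.
have q0 : 0 < q%:R :> R by rewrite ltr0n (leq_ltn_trans _ Nq).
pose h : R := (2 * q%:R)^-1.
have h0 : 0 <= h by rewrite invr_ge0 mulr_ge0 // ltW.
have hd : h < d.
  rewrite /h invf_plt ?posrE ?mulr_gt0 //.
  apply: (@lt_le_trans _ _ q%:R); last by rewrite -[leLHS]mul1r ler_pM2r // ler1n.
  rewrite (lt_le_trans (truncnS_gt _)) // ler_nat //.
have Dh := dP h h0 hd.
pose G x := H (x + h) - H x.
have mHs a : cmeas (fun x : RR => H (x + a)) by exact: (cmeas_shift _ mH).
have mG : cmeas G by exact: (cmeasB (mHs h) mH).
have perG : {ae mu, forall x, G (x + 1) = z * G x}.
  apply: ae_imp2 per (ae_shift h per) => x h1 h2.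
  by rewrite /G mulrBr -h1 -h2 addrAC.
pose u x := K / c3 ^+ q * e1 (winding k rs * q%:R * x).
have u1 x : nsq (u x) = 1.
  rewrite /u nsqM nsq_e1 mulr1 nsqE normcM K1 Mc normcV normcX divff ?expr1n //.
  by rewrite expf_neq0 // normc_eq0.
have uh x : u (x + h) = - u x.
  have E : winding k rs * q%:R * (x + h) = winding k rs * q%:R * x + winding k rs / 2.
    by rewrite mulrDr /h; congr (_ + _); field; rewrite gt_eqF.
  rewrite /u E e1D mulrA.
  suff -> : e1 (winding k rs / 2) = -1 by rewrite mulrN1.
  have /orP[/eqP ->|/eqP ->] : (winding k rs == 1) || (winding k rs == -1).
    by rewrite -sqrf_eq1 w2.
    by rewrite mul1r e1_half.
  by rewrite mulN1r e1N e1_half invrN1.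
have rel : {ae mu, forall x, exists2 err, normc err <= 2^-1 &
     H (x - q%:R * alpha) = u x * (1 + err) * H x}.
  apply: ae_imp KP => x [err he E]; exists err => //.
  have := expf_neq0 q c30; move: E; rewrite /u; set C := c3 ^+ q => E C0.
  by apply: (mulfI C0); rewrite E; field.
clearbody u.
(* Adding the two relations cancels everything except increments and errors;
   with |err| <= 1/2 the errors contribute half of the energy of H at most. *)
have main : {ae mu, forall x, nsq (H x) <= 2 * (nsq (G (x - q%:R * alpha)) + nsq (G x)) +
     4^-1 * (nsq (H x) + nsq (H (x + h)))}.
  apply: ae_imp2 rel (ae_shift h rel) => x [a ha Ea] [b hb Eb].
  have E : 2 * (u x * H x) = - G (x - q%:R * alpha) - u x * G x - u x * a * H x - u x * b * H (x + h).
    rewrite /G (_ : x - q%:R * alpha + h = x + h - q%:R * alpha); last by ring.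
    by rewrite Eb Ea uh; ring.
  have n2 : nsq (2 * (u x * H x)) = 4 * nsq (H x).
    by rewrite !nsqM u1 mul1r; congr (_ * _); rewrite /nsq /=; ring.
  have na (e y : R[i]) : normc e <= 2^-1 -> nsq (u x * e * y) <= 4^-1 * nsq y.
    move=> he; rewrite !nsqM u1 mul1r ler_wpM2r ?nsq_ge0 // nsqE.
    have := normc_ge0 e; nra.
  have nb y : nsq (u x * y) = nsq y by rewrite nsqM u1 mul1r.
  have := nsqB_le (- G (x - q%:R * alpha) - u x * G x - u x * a * H x) (u x * b * H (x + h)).
  rewrite -E n2.
  have := nsqB_le (- G (x - q%:R * alpha) - u x * G x) (u x * a * H x).
  have := nsqB_le (- G (x - q%:R * alpha)) (u x * G x).
  rewrite nsqN nb.
  have := na _ (H x) ha; have := na _ (H (x + h)) hb.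
  have := nsq_ge0 (H (x + h)); have := nsq_ge0 (H x).
  set p1 := nsq (H x); set p2 := nsq (H (x + h)); lra.
have mE (f : RR -> R[i]) : cmeas f -> measurable_fun I01 (fun t : RR => (nsq (f t))%:E).
  by move=> mf; apply: measurable_funTS; exact: cmeas_ensq.
have nn (f : RR -> R[i]) (t : RR) : (0 <= (nsq (f t))%:E)%E by rewrite lee_fin nsq_ge0.
have mS (f g : RR -> R[i]) : cmeas f -> cmeas g ->
    measurable_fun I01 (fun t : RR => (nsq (f t))%:E + (nsq (g t))%:E)%E.
  by move=> mf mg; apply: emeasurable_funD; exact: mE.
have nnS (f g : RR -> R[i]) (t : RR) : (0 <= (nsq (f t))%:E + (nsq (g t))%:E)%E.
  by rewrite adde_ge0.
have q4 : (0 <= (4^-1)%:E :> \bar R)%E by rewrite lee_fin invr_ge0.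
have mGs : cmeas (fun x : RR => G (x - q%:R * alpha)) by exact: (cmeas_shift _ mG).
have : (energy I01 H <= \int[mu]_(x in I01) (2%:E * ((nsq (G (x - q%:R * alpha)))%:E + (nsq (G x))%:E)
   + 4^-1%:E * ((nsq (H x))%:E + (nsq (H (x + h)))%:E)))%E.
  apply: ae_ge0_le_integral => //.
  - exact: mE.
  - by move=> x _; apply: adde_ge0; apply: mule_ge0 => //; rewrite -EFinD lee_fin addr_ge0 ?nsq_ge0.
  - by apply: emeasurable_funD; apply: emeasurable_funM => //; exact: mS.
  - by apply: ae_imp main => x + _; rewrite -lee_fin.
rewrite ge0_integralD //; last 4 first.
- by move=> x _; apply: mule_ge0 => //; rewrite -EFinD lee_fin addr_ge0 ?nsq_ge0.
- by apply: emeasurable_funM => //; exact: mS.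
- by move=> x _; apply: mule_ge0 => //; rewrite -EFinD lee_fin addr_ge0 ?nsq_ge0.
- by apply: emeasurable_funM => //; exact: mS.
have Zl (f g : RR -> R[i]) (r : R) : 0 <= r -> cmeas f -> cmeas g ->
    (\int[mu]_(x in I01) (r%:E * ((nsq (f x))%:E + (nsq (g x))%:E)) =
     r%:E * (energy I01 f + energy I01 g))%E.
  move=> r0 mf mg; rewrite ge0_integralZl_EFin //; try exact: mS.
  by rewrite ge0_integralD //; exact: mE.
rewrite (Zl (fun x => G (x - q%:R * alpha))) // (Zl H (fun x => H (x + h))) ?invr_ge0 //.
rewrite (quasi_energy (- (q%:R * alpha)) mG z1 perG) (quasi_energy h mH z1 per) iE.
have [D DE] : exists D : R, energy I01 G = D%:E.
  exists (fine (energy I01 G)); rewrite fineK // ge0_fin_numE ?energy_ge0 //.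
  by rewrite (le_lt_trans Dh) // ltry.
(* The energy i of H satisfies i <= 4 D + i / 2 with D <= i / 16. *)
move: Dh; rewrite -/(energy I01 G) -[energy _ _]/(energy I01 G) DE lee_fin => Dh.
rewrite -[leRHS]/((2 * (D + D) + 4^-1 * (i + i))%:E) lee_fin; lra.
Qed.

(** A nonzero H forces equality of norms; then a winding number 1 or -1 forces
    H = 0. *)
Lemma fiber_vanishing : (mahler c rs != normc c3) || (winding k rs ^+ 2 == 1) ->
  energy I01 H = 0%E.
Proof.
move=> hyp; apply/eqP; apply/negPn/negP => E0.
have Mc := fiber_norm E0.
move: hyp; rewrite Mc eqxx /= => /eqP w2.
by move: E0; rewrite fiber_winding // eqxx.
Qed.

End vanishing.

End fiber.

(** * Truncated Zak transform *)

Section parseval.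
Context (R : realType).
Notation mu := (@lebesgue_measure R).
Notation RR := (measurableTypeR R).
Notation I01 := ([set` `[(0:R), (1:R)[] : set RR).

Lemma nsqC (z : R[i]) : ((nsq z)%:C)%C = z * z^*%C.
Proof. by case: z => a b; rewrite /nsq /=; simpc; congr (_ +i* _); ring. Qed.

(** Orthogonality of the characters of the cyclic group of order M. *)
Lemma e1_unity_sum (M i j : nat) : (i < M)%N -> (j < M)%N ->
  \sum_(l < M) (e1 (- (i%:R / M%:R * l%:R)) * (e1 (- (j%:R / M%:R * l%:R)))^*%C) =
  if i == j then M%:R else 0 :> R[i].
Proof.
move=> iM jM; have M0 : (M%:R : R) != 0 by rewrite pnatr_eq0 -lt0n (leq_ltn_trans _ iM).
pose v : R[i] := e1 ((j%:R - i%:R) / M%:R).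
transitivity (\sum_(l < M) v ^+ l).
  apply: eq_bigr => l _; rewrite e1_conj opprK -e1D -e1MnE -mulr_natr; congr e1.
  by field.
case: eqVneq => ij.
  rewrite /v ij subrr mul0r e10; under eq_bigr do rewrite expr1n.
  by rewrite sumr_const card_ord.
have vM : v ^+ M = 1.
  rewrite -e1MnE -[(_ *+ M)]mulr_natr divfK // e1B !e1_nat divr1 //.
have v1 : v - 1 != 0.
  rewrite subr_eq0; apply/eqP => /e1_eq1 [k /eqP].
  rewrite -subr_eq0 => /eqP E.
  have E2 : (j%:Z - i%:Z = k * M%:Z)%R.
    apply: (@intr_inj R); rewrite intrB intrM -!pmulrn.
    have := congr1 (fun y => y * M%:R + k%:~R * M%:R) E.
    by rewrite mul0r add0r mulrBl subrK divfK // => ->.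
  have [k0|k0|k0] := ltgtP k 0; last 1 first.
  - by move: ij E2; rewrite k0 mul0r => /eqP ij /subr0_eq [] ji; apply: ij.
  - have : (k * M%:Z <= - 1 * M%:Z)%R by apply: ler_wpM2r => //; lia.
    lia.
  - have : (1 * M%:Z <= k * M%:Z)%R by apply: ler_wpM2r => //; lia.
    lia.
apply: (mulfI v1); rewrite mulr0 -subrX1 vM subrr //.
Qed.

Lemma nsq_e1M (y : R) (w : R[i]) : nsq (e1 y * w) = nsq w.
Proof. by rewrite nsqM nsq_e1 mul1r. Qed.

(** The shift s allows symmetric ranges of frequencies with indices in nat; it
    changes the sum by a unimodular factor. *)
Definition trigsum (n : nat) (a : nat -> R[i]) (s xi : R) : R[i] :=
  \sum_(i < n) a i * e1 (- ((i%:R - s) * xi)).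

Lemma discrete_parseval n a s xi :
  \sum_(l < n) nsq (trigsum n a s (xi + l%:R / n%:R)) = n%:R * \sum_(i < n) nsq (a i).
Proof.
have [->|n0] := eqVneq n 0%N; first by rewrite !big_ord0 mul0r.
have nR : (n%:R : R) != 0 by rewrite pnatr_eq0.
pose b (i : nat) := a i * e1 (- (i%:R * xi)).
have E l : nsq (trigsum n a s (xi + l%:R / n%:R)) =
   nsq (\sum_(i < n) b i * e1 (- (i%:R / n%:R * l%:R))).
  rewrite -[RHS](nsq_e1M (s * (xi + l%:R / n%:R))) mulr_sumr; congr nsq.
  apply: eq_bigr => i _; rewrite /b -mulrA -e1D mulrCA -e1D; congr (_ * e1 _).
  by field.
under eq_bigr do rewrite E.
apply: complexI; rewrite rmorph_sum rmorphM rmorph_nat rmorph_sum /=.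
under eq_bigr do rewrite nsqC rmorph_sum mulr_suml.
under eq_bigr do under eq_bigr do rewrite mulr_sumr.
rewrite exchange_big /=; rewrite mulr_sumr; apply: eq_bigr => i _.
rewrite exchange_big /= (bigD1 i) //= [X in _ + X]big1 ?addr0; last first.
  move=> j ji.
  transitivity (\sum_(l < n) (b i * (b j)^*%C) * (e1 (- (i%:R / n%:R * l%:R)) * (e1 (- (j%:R / n%:R * l%:R)))^*%C)).
    by apply: eq_bigr => l _; rewrite rmorphM /=; ring.
  have /negbTE ij : (i : nat) != j by rewrite eq_sym.
  by rewrite -mulr_sumr e1_unity_sum // ij mulr0.
transitivity (\sum_(l < n) (b i * (b i)^*%C) * (e1 (- (i%:R / n%:R * l%:R)) * (e1 (- (i%:R / n%:R * l%:R)))^*%C)).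
  by apply: eq_bigr => l _; rewrite rmorphM /=; ring.
rewrite -mulr_sumr e1_unity_sum // eqxx mulrC; congr (_ * _).
by rewrite -nsqC /b nsqM nsq_e1 mulr1.
Qed.

Lemma muI01 : mu I01 = 1%E.
Proof. by rewrite lebesgue_measure_itv /= lte_fin ltr01 sube0. Qed.

(** Averaging over translations by l / n turns the continuous identity into the
    discrete one, which only needs finite orthogonality. *)
Lemma parseval n a (s : R) :
  (\int[mu]_(xi in I01) (nsq (trigsum n a s xi))%:E = (\sum_(i < n) nsq (a i))%:E)%E.
Proof.
have [->|n0] := eqVneq n 0%N.
  rewrite big_ord0 -[RHS](@integral0 _ _ _ mu I01); apply: eq_integral => xi _.
  by rewrite /trigsum big_ord0 nsq0.
have nR : 0 < n%:R :> R by rewrite ltr0n lt0n.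
have mT : cmeas (fun xi : RR => trigsum n a s xi).
  apply: cmeas_sum => i; apply: cmeasZ; apply: cmeas_e1.
  by apply: measurable_funN; exact: measurable_funM.
have mTs (c : R) : measurable_fun I01 (fun xi : RR => (nsq (trigsum n a s (xi + c)))%:E).
  by apply: measurable_funTS; apply: cmeas_ensq; exact: (cmeas_shift c mT).
have nn (x : RR) : (0 <= (nsq (trigsum n a s x))%:E)%E by rewrite lee_fin nsq_ge0.
have sh l : (\int[mu]_(xi in I01) (nsq (trigsum n a s (xi + l%:R / n%:R)))%:E =
   \int[mu]_(xi in I01) (nsq (trigsum n a s xi))%:E)%E.
  apply: (@periodic_integral _ (fun xi => (nsq (trigsum n a s xi))%:E)) => //.
    exact: cmeas_ensq.
  apply: aeW => x.
  congr EFin; rewrite -[RHS](nsq_e1M s); congr nsq.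
  rewrite /trigsum mulr_sumr; apply: eq_bigr => i _; rewrite mulrCA; congr (_ * _).
  have -> : - ((i%:R - s) * (x + 1)) = s + - ((i%:R - s) * x) - i%:R by ring.
  by rewrite e1B e1_nat divr1 e1D.
have : (n%:R%:E * \int[mu]_(xi in I01) (nsq (trigsum n a s xi))%:E =
   n%:R%:E * (\sum_(i < n) nsq (a i))%:E)%E.
  transitivity (\sum_(l < n) \int[mu]_(xi in I01) (nsq (trigsum n a s (xi + l%:R / n%:R)))%:E)%E.
    under eq_bigr do rewrite sh.
    by rewrite sumr_const card_ord mule_natl.
  rewrite -ge0_integral_sum //.
  under eq_integral do rewrite sumEFin discrete_parseval.
  rewrite integral_cst // [X in (_ * X)%E]muI01 mule1.
  by rewrite EFinM.
move=> /(congr1 (fun y => ((n%:R)^-1)%:E * y)%E).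
by rewrite !muleA -EFinM mulVf ?gt_eqF // !mul1e.
Qed.

End parseval.

Section zak.
Context (R : realType).
Notation mu := (@lebesgue_measure R).
Notation RR := (measurableTypeR R).
Notation I01 := ([set` `[(0:R), (1:R)[] : set RR).

(** The truncated Zak transform; n = i - N runs through [-N, N[. *)
Definition zak (N : nat) (f : R -> R[i]) (x xi : R) : R[i] :=
  trigsum (2 * N) (fun i => f (x + (i%:R - N%:R))) N%:R xi.

Lemma zakE N f x xi : zak N f x xi =
  \sum_(i < 2 * N) f (x + (i%:R - N%:R)) * e1 (- ((i%:R - N%:R) * xi)).
Proof. by []. Qed.

Lemma zakS N f x xi : zak N.+1 f x xi =
  f (x - N.+1%:R) * e1 (N.+1%:R * xi) + zak N f x xi + f (x + N%:R) * e1 (- (N%:R * xi)).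
Proof.
rewrite !zakE (_ : (2 * N.+1 = (2 * N).+2)%N); last by rewrite !mul2n doubleS.
rewrite big_ord_recl big_ord_recr /= -addrA; congr (_ * e1 _ + (_ + _ * e1 _)).
- by congr f; rewrite sub0r.
- by rewrite sub0r mulNr opprK.
- apply: eq_bigr => i _; rewrite /bump /= add1n; congr (f _ * e1 (- (_ * _)));
    rewrite -!natr1; ring.
- by congr f; rewrite /bump /= add1n mul2n -addnn -!natr1 natrD; ring.
- by rewrite /bump /= add1n mul2n -addnn -!natr1 natrD; ring.
Qed.

(** Translating by 1 reindexes the sum, up to the two boundary terms. *)
Lemma zak_shift N f x xi : zak N f (x + 1) xi =
  e1 xi * (zak N f x xi - f (x - N%:R) * e1 (N%:R * xi) + f (x + N%:R) * e1 (- (N%:R * xi))).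
Proof.
elim: N => [|N IH].
  by rewrite !zakE muln0 !big_ord0 mulr0n !mul0r oppr0 !addr0 e10 mulr1 sub0r addrC subrr mulr0.
rewrite !zakS IH.
have -> : x + 1 - N.+1%:R = x - N%:R by rewrite -natr1; ring.
have -> : x + 1 + N%:R = x + N.+1%:R by rewrite -natr1; ring.
have -> : N.+1%:R * xi = N%:R * xi + xi by rewrite -natr1; ring.
rewrite opprD !e1D !e1N; have := e1_neq0 xi; have := e1_neq0 (N%:R * xi) => h1 h2.
by field; rewrite h1 h2.
Qed.

(** The coefficients are 1-periodic, hence constant along x + Z. *)
Lemma zak_linear N (c3 : R[i]) (A B : R -> R[i]) (alpha x xi : R) (f : R -> R[i]) :
  (forall m : int, c3 * f (x + m%:~R - alpha) = A x * f (x + m%:~R) + B x * f (x + m%:~R - 1)) ->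
  c3 * zak N f (x - alpha) xi = A x * zak N f x xi + B x * zak N f (x - 1) xi.
Proof.
move=> E; rewrite !zakE !mulr_sumr -big_split /=; apply: eq_bigr => i _.
have := E ((i : nat)%:Z - N%:Z); rewrite intrB -!pmulrn => E'.
rewrite !mulrA -mulrDl; congr (_ * _).
rewrite (_ : x - alpha + _ = x + (i%:R - N%:R) - alpha); last by ring.
by rewrite E'; congr (_ + _ * f _); ring.
Qed.

Lemma zakD N f g x xi : zak N (fun t => f t - g t) x xi = zak N f x xi - zak N g x xi.
Proof. by rewrite !zakE -sumrB; apply: eq_bigr => i _; rewrite mulrBl. Qed.

Definition window (N : nat) : set RR := [set` `[(- N%:R : R), (N%:R : R)[].

Lemma mwindow N : measurable (window N). Proof. exact: measurable_itv. Qed.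

(** For x in [0, 1[ the truncation at N sees exactly the values of f on [-N, N[. *)
Lemma zak_window N L f x xi : I01 x -> (N <= L)%N ->
  zak L (cutoff (window N) f) x xi = zak N f x xi.
Proof.
rewrite /= in_itv /= => /andP[x0 x1].
elim: L => [|L IH].
  by rewrite leqn0 => /eqP ->; rewrite !zakE muln0 !big_ord0.
rewrite leq_eqVlt => /predU1P[->|].
  rewrite !zakE; apply: eq_bigr => i _; congr (_ * _).
  rewrite cutoffE ifT // inE /window /= in_itv /=.
  have i0 : 0 <= i%:R :> R by [].
  have i1 : i.+1%:R <= (2 * L.+1)%:R :> R by rewrite ler_nat.
  by move: i1; rewrite natrM -natr1 => i1; apply/andP; split; lra.
rewrite ltnS => NL; rewrite zakS IH //.
have NL' : N%:R <= L%:R :> R by rewrite ler_nat.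
rewrite !cutoffE !ifF ?mul0r ?add0r ?addr0 //; apply/negbTE;
  rewrite notin_setE /window /= in_itv /= => /andP[h1 h2].
  by lra.
by move: h1; rewrite -natr1; lra.
Qed.

Lemma cmeas_zak N (f : RR -> R[i]) (xi : R) : cmeas f -> cmeas (fun x : RR => zak N f x xi).
Proof.
move=> mf; apply: cmeas_sum => i; apply: cmeasM; last exact: cmeas_cst.
exact: (cmeas_shift _ mf).
Qed.

Lemma cmeas_zak2 N (f : RR -> R[i]) : cmeas f ->
  cmeas (fun p : RR * RR => zak N f p.1 p.2).
Proof.
move=> mf; apply: cmeas_sum => i; apply: cmeasM.
  by apply: (cmeas_comp (cmeas_shift _ mf)); exact: measurable_fst.
apply: cmeas_e1; apply: measurable_funN; exact: measurable_funM.
Qed.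

(** The intervals [i - N, i - N + 1[ tile [-N, N[. *)
Lemma energy_cells N (f : RR -> R[i]) : cmeas f ->
  (\int[mu]_(x in I01) (\sum_(i < 2 * N) nsq (f (x + (i%:R - N%:R))))%:E = energy (window N) f)%E.
Proof.
move=> mf.
have mE D : measurable_fun D (fun t : RR => (nsq (f t))%:E).
  by apply: measurable_funTS; exact: cmeas_ensq.
have mS (a : R) : measurable_fun I01 (fun t : RR => (nsq (f (t + a)))%:E).
  by apply: measurable_funTS; apply: cmeas_ensq; exact: (cmeas_shift a mf).
have nn (x : RR) : (0 <= (nsq (f x))%:E)%E by rewrite lee_fin nsq_ge0.
under eq_integral do rewrite -sumEFin.
rewrite ge0_integral_sum //.
pose cell (a b : R) : \bar R := (\int[mu]_(x in [set` `[a, b[]) (nsq (f x))%:E)%E.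
have cellD (a b c : R) : a <= b -> b <= c -> (cell a c = cell a b + cell b c)%E.
  move=> ab bc; rewrite /cell -ge0_integral_setU //.
  - congr (integral _ _ _); apply/seteqP; split => x /=; rewrite !in_itv /=.
      by move=> /andP[h1 h2]; case: (ltP x b) => h; [left|right]; apply/andP; split.
    by case=> /andP[h1 h2]; apply/andP; split => //; lra.
  - rewrite disj_set2E; apply/eqP; rewrite -subset0 => x /= []; rewrite !in_itv /=.
    by move=> /andP[_ xc] /andP[cx _]; move: (lt_le_trans xc cx); rewrite ltxx.
have cell1 (a : R) : (\int[mu]_(x in I01) (nsq (f (x + a)))%:E = cell a (a + 1)%R)%E.
  rewrite /cell -(@integral_shift _ a [set` `[a, (a + 1)[] (fun x => (nsq (f x))%:E)) //.
  congr (integral _ _ _); apply/seteqP; split => x /=; rewrite !in_itv /= => /andP[h1 h2];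
    by apply/andP; split; lra.
under eq_bigr do rewrite cell1.
suff H m : (\sum_(i < m) cell (i%:R - N%:R)%R (i%:R - N%:R + 1)%R = cell (- N%:R)%R (m%:R - N%:R)%R)%E.
  by rewrite H /energy /window /cell mul2n -addnn natrD addrK.
elim: m => [|m IH].
  rewrite big_ord0 sub0r /cell set_itv_ge ?integral_set0 //.
  by rewrite bnd_simp -leNgt.
rewrite big_ord_recr /= IH -cellD.
- by congr (cell _ _); rewrite -natr1; ring.
- by rewrite lerBrDr addNr.
- by rewrite lerDl.
Qed.

Lemma window_tail (f : RR -> R[i]) : cmeas f -> (energy setT f < +oo)%E ->
  forall eps : R, 0 < eps -> exists n0 : nat, forall n, (n0 <= n)%N ->
  (energy setT (cutoff (~` (window n)) f) <= eps%:E)%E.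
Proof.
move=> mf fin eps e0.
have mB n : measurable (~` (window n) : set RR) by apply: measurableC; exact: mwindow.
have Bv (t : RR) : \forall n \near \oo, ~ (~` (window n)) t.
  have : \forall n \near \oo, (`|t| + 1 <= n%:R :> R)%R by exact: nbhs_infty_ger.
  apply: filterS => n hn; apply; rewrite /window /= in_itv /=.
  have := ler_norm t; have := ler_norm (- t); rewrite normrN => h1 h2.
  by apply/andP; split; lra.
have lim := dom_energy mf fin mB Bv.
have /fine_cvgP [hfin /cvgrPdist_lt /(_ _ e0) hl] := lim.
have [n0 _ n0P] := filterI hfin hl.
exists n0 => n /n0P [h1 h2].
rewrite -(fineK h1) lee_fin.
by move: h2; rewrite /= sub0r normrN => /ltW; apply: le_trans; exact: ler_norm.
Qed.

End zak.

(** * Convergence of truncations along a sparse schedule *)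

Section complex_limits.
Context (R : realType).
Implicit Types (z w : nat -> R[i]) (l : R[i]).

Definition ccvg z l := forall eps : R, 0 < eps -> exists K : nat, forall k, (K <= k)%N -> nsq (z k - l) <= eps.

Lemma ccvgD z w l m : ccvg z l -> ccvg w m -> ccvg (fun k => z k + w k) (l + m).
Proof.
move=> hz hw eps e0; have e4 : 0 < eps / 4 by rewrite divr_gt0.
have [K1 H1] := hz _ e4; have [K2 H2] := hw _ e4.
exists (maxn K1 K2) => k; rewrite geq_max => /andP[/H1 h1 /H2 h2].
rewrite (_ : _ - _ = (z k - l) + (w k - m)); last by ring.
by rewrite (le_trans (nsqD_le _ _)) //; lra.
Qed.

Lemma ccvgZ c z l : ccvg z l -> ccvg (fun k => c * z k) (c * l).
Proof.
move=> hz eps e0.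
have c0 : 0 < nsq c + 1 by rewrite ltr_wpDl // nsq_ge0.
have [K H] := hz _ (divr_gt0 e0 c0); exists K => k /H h.
rewrite -mulrBr nsqM; move: h; rewrite ler_pdivlMr //.
have := nsq_ge0 (z k - l); nra.
Qed.

Lemma ccvgN z l : ccvg z l -> ccvg (fun k => - z k) (- l).
Proof. by move=> /(ccvgZ (-1)) h eps /h [K H]; exists K => k /H; rewrite !mulN1r. Qed.

Lemma ccvg_unit0 (u : nat -> R[i]) z : (forall k, nsq (u k) = 1) -> ccvg z 0 -> ccvg (fun k => z k * u k) 0.
Proof.
by move=> u1 hz eps /hz [K H]; exists K => k /H; rewrite !subr0 nsqM u1 mulr1.
Qed.

Lemma ccvg_ext z w l : (forall k, z k = w k) -> ccvg z l -> ccvg w l.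
Proof. by move=> zw hz eps /hz [K H]; exists K => k /H; rewrite zw. Qed.

(** Cauchy-Schwarz with weights 2^(-j), by induction on m. *)
Lemma dyadic_tail z k m :
  nsq (z (k + m)%N - z k) <=
  2 / 2 ^+ k * \sum_(j < m) 2 ^+ (k + j) * nsq (z (k + j).+1 - z (k + j)%N).
Proof.
elim: m k => [|m IH] k; first by rewrite addn0 subrr nsq0 big_ord0 mulr0.
rewrite big_ord_recl /= addn0.
have -> : z (k + m.+1)%N - z k = (z k.+1 - z k) + (z (k.+1 + m)%N - z k.+1).
  by rewrite addnS addSn; ring.
apply: (le_trans (nsqD_le _ _)).
have k0 : (2 ^+ k : R) != 0 by rewrite expf_neq0.
rewrite [leRHS]mulrDr [X in _ <= X + _](_ : _ = 2 * nsq (z k.+1 - z k)); last by field.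
apply: lerD => //.
have := IH k.+1; rewrite exprS => h.
have -> : \sum_(i < m) 2 ^+ (k + bump 0 i) * nsq (z (k + bump 0 i).+1 - z (k + bump 0 i)%N) =
  \sum_(j < m) 2 ^+ (k.+1 + j) * nsq (z (k.+1 + j).+1 - z (k.+1 + j)%N).
  by apply: eq_bigr => i _; rewrite /bump /= add1n addnS addSn.
apply: (le_trans (ler_wpM2l _ h)) => //.
by rewrite mulrA le_eqVlt; apply/orP; left; apply/eqP; congr (_ * _); field.
Qed.

(** Upper limits of the coordinates: a formula for the limit that is measurable
    in parameters without assuming convergence. *)
Definition clim z : R[i] :=
  (fine (limn_esup (fun k => (complex.Re (z k))%:E))) +i*
  (fine (limn_esup (fun k => (complex.Im (z k))%:E))).

Lemma ReB (w v : R[i]) : complex.Re (w - v) = complex.Re w - complex.Re v.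
Proof. by case: w v => ? ? []. Qed.

Lemma ImB (w v : R[i]) : complex.Im (w - v) = complex.Im w - complex.Im v.
Proof. by case: w v => ? ? []. Qed.

Lemma limn_esup_cvg (u : nat -> R) (a : R) : u @ \oo --> a -> fine (limn_esup (fun k => (u k)%:E)) = a.
Proof.
move=> ua.
have : (EFin \o u) @ \oo --> a%:E by apply/fine_cvgP; split => //; exact: nearW.
move=> ua'; rewrite limn_esup_lim.
by have /cvg_lim -> // := @cvg_esups _ _ _ ua'.
Qed.

Lemma ccvg_clim z l : ccvg z l -> clim z = l.
Proof.
move=> hz.
have aux (p : R[i] -> R) : (forall v1, p v1 ^+ 2 <= nsq v1) -> (forall v1 v2, p (v1 - v2) = p v1 - p v2) ->
    (fun k => p (z k)) @ \oo --> p l.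
  move=> p2 pB; apply/cvgrPdist_lt => eps e0.
  have e20 : 0 < eps ^+ 2 / 2 by rewrite divr_gt0 // exprn_gt0.
  have [K H] := hz _ e20; exists K => // k /= /H h.
  rewrite -pB; have := p2 (l - z k); rewrite -opprB nsqN => h2.
  have h3 : p (- (z k - l)) ^+ 2 < eps ^+ 2 by have := exprn_gt0 2 e0; lra.
  by rewrite ltr_norml; move: h3; set y := p _ => h3; apply/andP; split; nra.
case: l hz aux => a b hz aux; rewrite /clim; congr (_ +i* _); apply: limn_esup_cvg.
  by apply: (aux (@complex.Re R)) => [w|[? ?] [? ?]] //; exact: Re2_le.
by apply: (aux (@complex.Im R)) => [w|[? ?] [? ?]] //; exact: Im2_le.
Qed.

Lemma cauchy_real (u : nat -> R) (b : nat -> R) : b @ \oo --> 0 ->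
  (forall k m, `|u (k + m)%N - u k| <= b k) -> exists a : R, u @ \oo --> a.
Proof.
move=> b0 ub; suff : cvg (u @ \oo) by move=> h; exists (lim (u @ \oo)).
apply/cauchy_cvgP; apply: cauchy_exP => eps e0.
have /cvgrPdist_lt /(_ _ e0) [K _ /(_ K (leqnn K))] := b0.
rewrite /= sub0r normrN => hb; exists (u K); exists K => // k /= Kk.
rewrite /ball /= distrC -(subnKC Kk) (le_lt_trans (ub _ _)) //.
exact: le_lt_trans (ler_norm _) hb.
Qed.

(** By [dyadic_tail] both coordinates are Cauchy sequences, and its bound passes
    to the limit. *)
Lemma dyadic_cvg z (S : R) :
  (forall n, \sum_(k < n) 2 ^+ k * nsq (z k.+1 - z k) <= S) ->
  ccvg z (clim z) /\ forall k, nsq (z k - clim z) <= 2 / 2 ^+ k * S.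
Proof.
move=> hS.
have S0 : 0 <= S by have := hS 0%N; rewrite big_ord0.
have tail k m : nsq (z (k + m)%N - z k) <= 2 / 2 ^+ k * S.
  apply: (le_trans (dyadic_tail z k m)); apply: ler_wpM2l; first by rewrite divr_ge0 // exprn_ge0.
  apply: le_trans (hS (k + m)%N); rewrite big_split_ord /= lerDr.
  by apply: sumr_ge0 => i _; rewrite mulr_ge0 ?exprn_ge0 ?nsq_ge0.
pose bb k : R := 2 / 2 ^+ k * S.
have bb0 : bb @ \oo --> 0.
  have -> : bb = (fun k => (2 * S) * (2^-1) ^+ k).
    by apply/funext => k; rewrite /bb exprVn; ring.
  rewrite -[X in _ --> X](mulr0 (2 * S)); apply: cvgMl_tmp.
  by apply: cvg_expr; rewrite ger0_norm ?invr_ge0 // invf_lt1 // ltr1n.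
have sb0 : (fun k => Num.sqrt (bb k)) @ \oo --> 0.
  by rewrite -sqrtr0; apply: continuous_cvg => //; exact: sqrt_continuous.
have aux (p : R[i] -> R) : (forall v1, p v1 ^+ 2 <= nsq v1) -> (forall v1 v2, p (v1 - v2) = p v1 - p v2) ->
    exists a : R, (fun k => p (z k)) @ \oo --> a.
  move=> p2 pB; apply: (cauchy_real sb0) => k m; rewrite -pB.
  rewrite -(sqrtr_sqr (p _)) ler_wsqrtr // (le_trans (p2 _)) //; exact: tail.
have [a ha] := aux (@complex.Re R) (@Re2_le R) ReB.
have [b hb] := aux (@complex.Im R) (@Im2_le R) ImB.
have cl : clim z = a +i* b by rewrite /clim (limn_esup_cvg ha) (limn_esup_cvg hb).
have bound k : nsq (z k - clim z) <= bb k.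
  have lim1 : (fun m => nsq (z m - z k)) @ \oo --> nsq (clim z - z k).
    rewrite cl.
    have -> : (fun m => nsq (z m - z k)) = (fun m => (complex.Re (z m) - complex.Re (z k)) ^+ 2 + (complex.Im (z m) - complex.Im (z k)) ^+ 2).
      by apply/funext => m; rewrite /nsq; case: (z m) (z k) => ? ? [].
    have -> : nsq ((a +i* b) - z k) = (a - complex.Re (z k)) ^+ 2 + (b - complex.Im (z k)) ^+ 2.
      by rewrite /nsq; case: (z k).
    by apply: cvgD; apply: cvgM; apply: cvgB => //; exact: cvg_cst.
  rewrite -nsqN opprB -(cvg_lim (@Rhausdorff R) lim1).
  apply: limr_le; first by apply/cvg_ex; eexists; exact: lim1.
  by exists k => // m /= km; rewrite -(subnKC km); exact: tail.
split=> // eps e0.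
have /cvgrPdist_lt /(_ _ e0) [K _ KP] := bb0.
exists K => k /KP; rewrite sub0r normrN => h.
by rewrite (le_trans (bound k)) // (le_trans (ler_norm _)) // ltW.
Qed.

End complex_limits.

(** * Almost everywhere statements modulo integer translations *)

Section ae_tools.
Context (R : realType).
Notation mu := (@lebesgue_measure R).
Notation RR := (measurableTypeR R).
Notation I01 := ([set` `[(0:R), (1:R)[] : set RR).

Lemma ae_foralln_R (P : nat -> R -> Prop) : (forall n, {ae mu, forall x, P n x}) ->
  {ae mu, forall x, forall n, P n x}.
Proof. exact: (@ae_foralln _ RR R mu P). Qed.

Lemma ae_forall_int (P : int -> R -> Prop) : (forall m, {ae mu, forall x, P m x}) ->
  {ae mu, forall x, forall m, P m x}.
Proof.
move=> H; apply: ae_imp2 (ae_foralln_R (fun n => H (Posz n))) (ae_foralln_R (fun n => H (Negz n))).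
by move=> x h1 h2 [n|n].
Qed.

Definition frac (x : R) : R := x - (Num.floor x)%:~R.

Lemma frac_I01 x : I01 (frac x).
Proof.
rewrite /= in_itv /= subr_ge0 floor_le /=.
by rewrite ltrBlDl; have := floorD1_gt x; rewrite intrD.
Qed.

(** It suffices to treat each of the countably many integer translates. *)
Lemma ae_frac (P : R -> Prop) : {ae mu, forall x, I01 x -> P x} ->
  {ae mu, forall x, P (frac x)}.
Proof.
move=> H.
have H2 : {ae mu, forall x, forall m : int, I01 (x - m%:~R) -> P (x - m%:~R)}.
  by apply: ae_forall_int => m; exact: (ae_shift (- m%:~R) H).
by apply: ae_imp H2 => x /(_ (Num.floor x)); apply; exact: frac_I01.
Qed.

Definition vanishing_at (f : R -> R[i]) (x : R) : Prop :=
  forall eps : R, 0 < eps -> exists K : nat, forall m : int, (K <= `|m|)%N -> nsq (f (x + m%:~R)) <= eps.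

Lemma vanishing_at_shift f x (m : int) : vanishing_at f x -> vanishing_at f (x + m%:~R).
Proof.
move=> H eps /H [K HK]; exists (K + `|m|)%N => p pK.
rewrite -addrA -intrD; apply: HK; lia.
Qed.

Lemma series_terms (u : nat -> R) : (forall n, 0 <= u n) -> (\sum_(n <oo) (u n)%:E < +oo)%E ->
  u @ \oo --> 0.
Proof.
by move=> u0 fin; apply: cvg_series_cvg_0; exact: nnseries_is_cvg.
Qed.

Lemma nneseries_le (u : nat -> \bar R) (M : \bar R) : (forall n, 0 <= u n)%E ->
  (forall n, \sum_(k < n) u k <= M)%E -> (\sum_(n <oo) u n <= M)%E.
Proof.
move=> u0 uM; apply: lime_le; first by apply: is_cvg_nneseries => n _ _.
by apply: nearW => n; rewrite big_mkord.
Qed.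

Lemma ae_finite (D : set RR) (F : RR -> \bar R) : measurable D -> measurable_fun D F ->
  (forall x, 0 <= F x)%E -> (\int[mu]_(x in D) F x < +oo)%E ->
  {ae mu, forall x, D x -> (F x < +oo)%E}.
Proof.
move=> mD mF F0 fin.
have iF : mu.-integrable D F.
  apply/integrableP; split => //.
  by rewrite (eq_integral F) // => x _; rewrite gee0_abs.
have := integrable_ae mD iF; apply: ae_imp => x H /H.
by rewrite ge0_fin_numE.
Qed.

Lemma cells_sum (f : R -> R[i]) x N :
  \sum_(n < N) (nsq (f (x + n%:R)) + nsq (f (x - n.+1%:R))) =
  \sum_(i < 2 * N) nsq (f (x + (i%:R - N%:R))).
Proof.
elim: N => [|N IH]; first by rewrite muln0 !big_ord0.
rewrite big_ord_recr /= IH (_ : (2 * N.+1 = (2 * N).+2)%N); last by rewrite !mul2n doubleS.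
rewrite [in RHS]big_ord_recl [in RHS]big_ord_recr /= addrA addrC; congr (_ + (_ + _)).
- by congr (nsq (f _)); rewrite sub0r.
- apply: eq_bigr => i _; rewrite /bump /= add1n; congr (nsq (f _));
    rewrite -!natr1; ring.
- by congr (nsq (f _)); rewrite /bump /= add1n mul2n -addnn -!natr1 natrD; ring.
Qed.

(** The sum over n of |f(x+n)|^2 has integral over [0, 1[ the energy of f, hence
    it is finite almost everywhere, and its terms tend to 0. *)
Lemma ae_vanishing (f : RR -> R[i]) : cmeas f -> (energy setT f < +oo)%E ->
  {ae mu, forall x, vanishing_at f x}.
Proof.
move=> mf fin.
pose T (n : nat) (x : R) := nsq (f (x + n%:R)) + nsq (f (x - n.+1%:R)).
have T0 n x : 0 <= T n x by rewrite addr_ge0 ?nsq_ge0.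
have mT n D : measurable_fun (D : set RR) (fun x : RR => (T n x)%:E).
  apply: measurable_funTS; apply/measurable_EFinP; apply: measurable_funD;
    apply: cmeas_nsq; exact: (cmeas_shift _ mf).
have mI : measurable I01 by exact: measurable_itv.
have finS : {ae mu, forall x, I01 x -> (\sum_(n <oo) (T n x)%:E < +oo)%E}.
  apply: ae_finite => //.
  - by apply: ge0_emeasurable_sum => // n x _ _; rewrite lee_fin.
  - by move=> x; apply: nneseries_ge0 => n _ _; rewrite lee_fin.
  - rewrite integral_nneseries //; last by move=> n x _; rewrite lee_fin.
    apply: le_lt_trans fin; apply: nneseries_le.
      by move=> n; apply: integral_ge0 => x _; rewrite lee_fin.
    move=> N; rewrite -ge0_integral_sum //; last by move=> n x _; rewrite lee_fin.
    under eq_integral do rewrite sumEFin cells_sum.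
    by rewrite energy_cells //; apply: energy_sub => //; exact: mwindow.
have van0 : {ae mu, forall x, I01 x -> vanishing_at f x}.
  apply: ae_imp finS => x H /H fx eps e0.
  have /cvgrPdist_lt /(_ _ e0) [K _ KP] := series_terms (fun n => T0 n x) fx.
  have Tle n : (K <= n)%N -> T n x <= eps.
    by move=> /KP; rewrite sub0r normrN => /ltW; apply: le_trans; exact: ler_norm.
  exists K.+1 => -[m|m] /= Km.
    have := Tle m (ltnW Km); rewrite /T; have := nsq_ge0 (f (x - m.+1%:R)).
    by rewrite -[m%:R]/(m%:~R); lra.
  have Km' : (K <= m)%N by lia.
  have := Tle m Km'; rewrite /T; have := nsq_ge0 (f (x + m%:R)).
  by rewrite NegzE mulrNz -[m.+1%:R]/(m.+1%:~R); lra.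
apply: ae_imp (ae_frac van0) => x H.
by rewrite -(subrK ((Num.floor x)%:~R) x); exact: vanishing_at_shift.
Qed.

Lemma tonelli_I01 (F : RR * RR -> \bar R) : measurable_fun setT F -> (forall p, 0 <= F p)%E ->
  (\int[mu]_(x in I01) \int[mu]_(y in I01) F (x, y) =
   \int[mu]_(y in I01) \int[mu]_(x in I01) F (x, y))%E.
Proof.
move=> mF F0.
have mI : measurable I01 by exact: measurable_itv.
pose F' := F \_ (I01 `*` I01).
have mF' : measurable_fun setT F'.
  apply/(measurable_restrictT _ _).1; first exact: measurableX.
  exact: measurable_funTS.
have F'0 p : (0 <= F' p)%E by rewrite /F' patchE; case: ifP.
have E1 : (\int[mu]_(x in I01) \int[mu]_(y in I01) F (x, y) = \int[mu]_x \int[mu]_y F' (x, y))%E.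
  rewrite integral_mkcond; apply: eq_integral => x _; rewrite patchE.
  case: ifPn => xI.
    rewrite integral_mkcond; apply: eq_integral => y _; rewrite /F' !patchE.
    by rewrite in_setX /= xI.
  rewrite -[LHS](@integral0 _ _ _ mu setT); apply: eq_integral => y _; rewrite /F' patchE.
  by rewrite in_setX /= (negbTE xI).
have E2 : (\int[mu]_(y in I01) \int[mu]_(x in I01) F (x, y) = \int[mu]_y \int[mu]_x F' (x, y))%E.
  rewrite integral_mkcond; apply: eq_integral => y _; rewrite patchE.
  case: ifPn => yI.
    rewrite integral_mkcond; apply: eq_integral => x _; rewrite /F' !patchE.
    by rewrite in_setX /= yI andbT.
  rewrite -[LHS](@integral0 _ _ _ mu setT); apply: eq_integral => x _; rewrite /F' patchE.
  by rewrite in_setX /= (negbTE yI) andbF.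
by rewrite E1 E2; apply: (fubini_tonelli F').
Qed.

(** This and the next lemma give the measurability in one variable of the
    integral over the other one, as part of Tonelli's theorem on [0, 1[. *)
Lemma measurable_slice_I01 (F : RR * RR -> \bar R) : measurable_fun setT F -> (forall p, 0 <= F p)%E ->
  measurable_fun setT (fun y : RR => \int[mu]_(x in I01) F (x, y))%E.
Proof.
move=> mF F0.
have mI : measurable I01 by exact: measurable_itv.
pose F' := F \_ (I01 `*` setT).
have mF' : measurable_fun setT F'.
  apply/(measurable_restrictT _ _).1; first exact: measurableX.
  exact: measurable_funTS.
have F'0 p : (0 <= F' p)%E by rewrite /F' patchE; case: ifP.
rewrite (_ : (fun y => _) = (fun y => \int[mu]_x F' (x, y))%E).
  exact: (measurable_fun_fubini_tonelli_G F').
apply/funext => y; rewrite integral_mkcond; apply: eq_integral => x _; rewrite /F' !patchE.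
by rewrite in_setX /= in_setT andbT.
Qed.

Lemma measurable_slice_I01l (F : RR * RR -> \bar R) : measurable_fun setT F -> (forall p, 0 <= F p)%E ->
  measurable_fun setT (fun x : RR => \int[mu]_(y in I01) F (x, y))%E.
Proof.
move=> mF F0.
apply: (@measurable_slice_I01 (fun p => F (p.2, p.1))) => //.
apply: (measurableT_comp mF).
exact: (measurable_swap).
Qed.

Lemma measurable_section (F : RR * RR -> \bar R) (D : set RR) x : measurable_fun setT F ->
  measurable_fun D (fun y : RR => F (x, y)).
Proof.
move=> mF; apply: measurable_funTS; apply: (measurableT_comp mF); exact: pair1_measurable.
Qed.

Lemma measurable_sectionl (F : RR * RR -> \bar R) (D : set RR) y : measurable_fun setT F ->
  measurable_fun D (fun x : RR => F (x, y)).
Proof.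
move=> mF; apply: measurable_funTS; apply: (measurableT_comp mF); exact: pair2_measurable.
Qed.

End ae_tools.

(** * From the fibers back to the line *)

Section zak_theorem.
Context (R : realType).
Notation mu := (@lebesgue_measure R).
Notation RR := (measurableTypeR R).
Notation I01 := ([set` `[(0:R), (1:R)[] : set RR).
Variables (h : RR -> R[i]) (c3 : R[i]) (A B : R -> R[i]) (alpha : R).
Hypothesis mh : cmeas h.
Hypothesis finh : (energy setT h < +oo)%E.
Hypothesis Aper : forall (x : R) (m : int), A (x + m%:~R) = A x.
Hypothesis Bper : forall (x : R) (m : int), B (x + m%:~R) = B x.
Hypothesis eqn : {ae mu, forall t, c3 * h (t - alpha) = A t * h t + B t * h (t - 1)}.
Hypothesis fiber0 : {ae mu, forall xi, forall H : RR -> R[i], cmeas H ->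
  (energy I01 H < +oo)%E -> {ae mu, forall x, H (x + 1) = e1 xi * H x} ->
  {ae mu, forall x, c3 * H (x - alpha) = (A x + B x * e1 (- xi)) * H x} ->
  energy I01 H = 0%E}.

(** The truncation radii are spaced so that the tails decay like 4^(-k), which
    leaves summability even after multiplication by the weights 2^k. Starting
    from radius 0 makes the first truncation vanish. *)
Lemma window_schedule : exists N : nat -> nat,
  [/\ N 0%N = 0%N, forall k, (N k <= N k.+1)%N, forall k, (k <= N k)%N &
   forall k, (energy setT (cutoff (~` (window (N k.+1))) h) <=
    ((4^-1 ^+ k.+1)%R)%:E)%E].
Proof.
have p4 : 0 < 4^-1 :> R by rewrite invr_gt0.
have ex k := window_tail mh finh (exprn_gt0 k p4).
pose n0 k := projT1 (cid (ex k)).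
have n0P k := projT2 (cid (ex k)).
pose N := fix N k := if k is k'.+1 then maxn (N k').+1 (n0 k'.+1) else 0%N.
exists N; split => //.
- by move=> k /=; rewrite (leq_trans (leqnSn _)) // leq_maxl.
- elim=> [|k IH] //=; by rewrite (leq_trans _ (leq_maxl _ _)).
- by move=> k; apply: n0P; rewrite /= leq_maxr.
Qed.

Section with_schedule.
Variable N : nat -> nat.
Hypothesis N0 : N 0%N = 0%N.
Hypothesis Nmono : forall k, (N k <= N k.+1)%N.
Hypothesis Nge : forall k, (k <= N k)%N.
Hypothesis Ntail : forall k, (energy setT (cutoff (~` (window (N k.+1))) h) <=
    ((4^-1 ^+ k.+1)%R)%:E)%E.

Definition zk k x xi := zak (N k) h x xi.
Definition dyadic_term k (p : RR * RR) : \bar R :=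
  (2 ^+ k * nsq (zk k.+1 p.1 p.2 - zk k p.1 p.2))%:E.
(** The square function of the truncations; its finiteness at (x, xi) gives
    convergence of the Zak transform there. *)
Definition dyadic_total (p : RR * RR) : \bar R := (\sum_(k <oo) dyadic_term k p)%E.

Let mI : measurable I01. Proof. exact: measurable_itv. Qed.

Lemma dyadic_term_ge0 k p : (0 <= dyadic_term k p)%E.
Proof. by rewrite lee_fin mulr_ge0 ?exprn_ge0 ?nsq_ge0. Qed.

Lemma m_dyadic_term k : measurable_fun setT (dyadic_term k).
Proof.
apply/measurable_EFinP; apply: measurable_funM => //; apply: cmeas_nsq.
by apply: cmeasB; exact: cmeas_zak2.
Qed.

Lemma dyadic_total_ge0 p : (0 <= dyadic_total p)%E.
Proof. by apply: nneseries_ge0 => k _ _; exact: dyadic_term_ge0. Qed.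

Lemma m_dyadic_total : measurable_fun setT dyadic_total.
Proof.
apply: ge0_emeasurable_sum => [k p _ _|k _]; first exact: dyadic_term_ge0.
exact: m_dyadic_term.
Qed.

(** Parseval in xi, then the tiling of the window in x. *)
Lemma zak_square n (f : RR -> R[i]) : cmeas f ->
  (\int[mu]_(x in I01) \int[mu]_(xi in I01) (nsq (zak n f x xi))%:E = energy (window n) f)%E.
Proof.
move=> mf; rewrite -energy_cells //; apply: eq_integral => x _.
by rewrite /zak parseval.
Qed.

(** The difference of two truncations is a truncation of the tail of h beyond
    the smaller radius. *)
Lemma dyadic_term_int k : (\int[mu]_(x in I01) \int[mu]_(xi in I01) dyadic_term k (x, xi) <=
   ((Num.max (fine (energy setT h)) 1 * 2^-1 ^+ k)%R)%:E)%E.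
Proof.
pose r t := cutoff (~` (window (N k))) h t.
have mr : cmeas r by apply: cmeas_cutoff => //; apply: measurableC; exact: mwindow.
have rle t : nsq (r t) <= 1 * nsq (h t).
  by rewrite mul1r /r cutoffE; case: ifP => // _; rewrite nsq0 nsq_ge0.
have rT : (0 < k)%N -> (energy setT r <= ((4^-1 ^+ k)%R)%:E)%E.
  by move=> k0; have := Ntail k.-1; rewrite prednK.
pose F (p : RR * RR) := (nsq (zak (N k.+1) r p.1 p.2))%:E.
have mF : measurable_fun setT F by apply: cmeas_ensq; exact: cmeas_zak2.
have F0 p : (0 <= F p)%E by rewrite lee_fin nsq_ge0.
have -> : (\int[mu]_(x in I01) \int[mu]_(xi in I01) dyadic_term k (x, xi) =
   (2 ^+ k)%:E * energy (window (N k.+1)) r)%E.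
  rewrite -zak_square //.
  rewrite -[X in (_ * X)%E]/(\int[mu]_(x in I01) \int[mu]_(xi in I01) F (x, xi))%E.
  have HZ (G : RR -> \bar R) : measurable_fun I01 G -> (forall x, 0 <= G x)%E ->
      ((2 ^+ k)%:E * \int[mu]_(x in I01) G x = \int[mu]_(x in I01) ((2 ^+ k)%:E * G x))%E.
    by move=> mG G0; rewrite ge0_integralZl_EFin ?exprn_ge0.
  rewrite HZ; first last.
  - by move=> x; apply: integral_ge0 => xi _; exact: F0.
  - by apply: measurable_funTS; exact: measurable_slice_I01l.
  apply: eq_integral => x xI.
  rewrite HZ //; last exact: measurable_section.
  apply: eq_integral => xi _; rewrite /dyadic_term /= EFinM; congr (_ * (nsq _)%:E)%E.
  rewrite /zk -(zak_window h xi (set_mem xI) (Nmono k)) -zakD /zak /trigsum.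
  apply: eq_bigr => i _; congr (_ * _); rewrite /r !cutoffE in_setC.
  by case: ifP => _ /=; rewrite ?subrr ?subr0.
clear F mF F0.
have h1 : (energy (window (N k.+1)) r <= energy setT r)%E.
  by apply: energy_sub => //; exact: mwindow.
have k20 : (0 <= (2 ^+ k : R)%:E :> \bar R)%E by rewrite lee_fin exprn_ge0.
apply: (le_trans (lee_wpmul2l k20 h1)).
case: (posnP k) => [->|k0].
  rewrite expr0 mul1e mulr1.
  apply: (@le_trans _ _ (energy setT h)).
    by rewrite -[leRHS]mul1e; exact: le_energy.
  rewrite -[leLHS]fineK ?ge0_fin_numE ?energy_ge0 // lee_fin le_max lexx //.
apply: (le_trans (lee_wpmul2l k20 (rT k0))).
rewrite -EFinM lee_fin -exprMn (_ : 2 * 4^-1 = 2^-1); last by field.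
by rewrite -[leLHS]mul1r ler_wpM2r ?exprn_ge0 // le_max lexx orbT.
Qed.

Lemma dyadic_total_int : (\int[mu]_(x in I01) \int[mu]_(xi in I01) dyadic_total (x, xi) < +oo)%E.
Proof.
set C := Num.max (fine (energy setT h)) 1.
have C0 : 0 <= C by rewrite le_max ler01 orbT.
have mxi k (x : RR) : measurable_fun I01 (fun xi : RR => dyadic_term k (x, xi)).
  apply: measurable_funTS; apply: (measurableT_comp (m_dyadic_term k)).
  exact: pair1_measurable.
apply: (@le_lt_trans _ _ (2 * C)%:E); last by rewrite ltry.
have -> : (\int[mu]_(x in I01) \int[mu]_(xi in I01) dyadic_total (x, xi) =
   \sum_(k <oo) \int[mu]_(x in I01) \int[mu]_(xi in I01) dyadic_term k (x, xi))%E.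
  rewrite -integral_nneseries //.
  - apply: eq_integral => x _; rewrite -integral_nneseries // => k xi _.
    exact: dyadic_term_ge0.
  - move=> k; apply: measurable_funTS; apply: measurable_slice_I01l.
      exact: m_dyadic_term.
    exact: dyadic_term_ge0.
  - by move=> k x _; apply: integral_ge0 => xi _; exact: dyadic_term_ge0.
apply: nneseries_le.
  by move=> k; apply: integral_ge0 => x _; apply: integral_ge0 => xi _; exact: dyadic_term_ge0.
move=> n; apply: (@le_trans _ _ (\sum_(k < n) (C * 2^-1 ^+ k)%:E)%E).
  by apply: lee_sum => k _; exact: dyadic_term_int.
rewrite sumEFin lee_fin -mulr_sumr mulrC ler_wpM2r //.
rewrite (le_trans (geo_bound n _ _)) ?invr_ge0 ?invf_lt1 ?ltr1n //.
by rewrite (_ : 1 - 2^-1 = 2^-1) ?invrK //; field.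
Qed.

(** The Zak transform of h at fixed xi. *)
Definition fiber (xi x : R) := clim (fun k => zk k x xi).

Lemma ccvg_fiber x xi : (dyadic_total (x, xi) < +oo)%E ->
  ccvg (fun k => zk k x xi) (fiber xi x) /\
  forall k, nsq (zk k x xi - fiber xi x) <= 2 / 2 ^+ k * fine (dyadic_total (x, xi)).
Proof.
move=> fin; apply: dyadic_cvg => n; rewrite -lee_fin fineK ?ge0_fin_numE ?dyadic_total_ge0 //.
rewrite -sumEFin -(big_mkord xpredT (fun k => (2 ^+ k * nsq (zk k.+1 x xi - zk k x xi))%:E)).
rewrite -[leRHS]/(\sum_(0 <= k <oo) dyadic_term k (x, xi))%E.
apply: (@le_trans _ _ (\sum_(0 <= k < n) dyadic_term k (x, xi))%E); first by [].
by apply: nneseries_lim_ge => k _ _; exact: dyadic_term_ge0.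
Qed.

Lemma cmeas_fiber xi : cmeas (fiber xi : RR -> R[i]).
Proof.
split; apply: (measurableT_comp (fine_measurable measurableT)).
  apply: measurable_fun_limn_esup => k; apply/measurable_EFinP.
  by have [] := cmeas_zak (N k) xi mh.
apply: measurable_fun_limn_esup => k; apply/measurable_EFinP.
by have [] := cmeas_zak (N k) xi mh.
Qed.

(** The boundary terms of [zak_shift] vanish in the limit. *)
Lemma boundary_cvg x (u : nat -> R[i]) (s : int) : (forall k, nsq (u k) = 1) -> `|s|%N = 1%N ->
  vanishing_at h x -> ccvg (fun k => h (x + s%:~R * (N k)%:R) * u k) 0.
Proof.
move=> u1 s1 hx; apply: ccvg_unit0 => // eps /hx [K HK]; exists K => k Kk.
rewrite subr0 -[(N k)%:R]/((N k)%:~R) -intrM; apply: HK.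
by rewrite abszM s1 mul1n; exact: leq_trans Kk (Nge k).
Qed.

Lemma ccvg_next x xi l : vanishing_at h x -> ccvg (fun k => zk k x xi) l ->
  ccvg (fun k => zk k (x + 1) xi) (e1 xi * l).
Proof.
move=> hx cv.
have b1 := @boundary_cvg x (fun k => e1 ((N k)%:R * xi)) (-1) (fun k => nsq_e1 _) erefl hx.
have b2 := @boundary_cvg x (fun k => e1 (- ((N k)%:R * xi))) 1 (fun k => nsq_e1 _) erefl hx.
have := ccvgZ (e1 xi) (ccvgD (ccvgD cv (ccvgN b1)) b2).
rewrite oppr0 !addr0; apply: ccvg_ext => k.
by rewrite /zk zak_shift mulrN1z mulN1r mulr1z mul1r.
Qed.

Lemma ccvg_prev x xi l : vanishing_at h x -> ccvg (fun k => zk k x xi) l ->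
  ccvg (fun k => zk k (x - 1) xi) (e1 (- xi) * l).
Proof.
move=> hx cv; have hx1 : vanishing_at h (x - 1) by rewrite -mulrN1z; exact: vanishing_at_shift.
have b1 := @boundary_cvg (x - 1) (fun k => e1 ((N k)%:R * xi)) (-1) (fun k => nsq_e1 _) erefl hx1.
have b2 := @boundary_cvg (x - 1) (fun k => e1 (- ((N k)%:R * xi))) 1 (fun k => nsq_e1 _) erefl hx1.
have := ccvgD (ccvgD (ccvgZ (e1 (- xi)) cv) b1) (ccvgN b2).
rewrite oppr0 !addr0; apply: ccvg_ext => k.
rewrite /zk -[in zak (N k) h x xi](subrK 1 x) zak_shift mulrN1z mulN1r mulr1z mul1r.
by rewrite mulrA -e1D addNr e10 mul1r; ring.
Qed.

(** The square function is only known to be finite for x in [0, 1[; this carries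
    convergence over to the other cells. *)
Lemma ccvg_translate x xi (m : int) : vanishing_at h x -> (exists l, ccvg (fun k => zk k x xi) l) ->
  exists l, ccvg (fun k => zk k (x + m%:~R) xi) l.
Proof.
move=> hx cv; elim/int_rec: m => [|n [l IH]|n [l IH]]; first by rewrite addr0.
- exists (e1 xi * l); rewrite intS intrD (addrC 1%:~R) addrA mulr1z.
  exact: ccvg_next (vanishing_at_shift _ hx) IH.
- exists (e1 (- xi) * l); rewrite intS opprD intrD (addrC (- 1)%:~R) addrA mulrN1z.
  exact: ccvg_prev (vanishing_at_shift _ hx) IH.
Qed.

Lemma ae_good_fiber : {ae mu, forall xi, I01 xi ->
  (\int[mu]_(x in I01) dyadic_total (x, xi) < +oo)%E}.
Proof.
apply: ae_finite => //.
- apply: measurable_funTS; apply: measurable_slice_I01; first exact: m_dyadic_total.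
  exact: dyadic_total_ge0.
- by move=> xi; apply: integral_ge0 => x _; exact: dyadic_total_ge0.
- rewrite -tonelli_I01; first exact: dyadic_total_int.
    exact: m_dyadic_total.
  exact: dyadic_total_ge0.
Qed.

Section good_fiber.
Variable xi : R.
Hypothesis fin : (\int[mu]_(x in I01) dyadic_total (x, xi) < +oo)%E.

Let mG : measurable_fun I01 (fun x : RR => dyadic_total (x, xi)).
Proof. by apply: measurable_sectionl; exact: m_dyadic_total. Qed.

Lemma ae_dyadic_fin : {ae mu, forall x, I01 x -> (dyadic_total (x, xi) < +oo)%E}.
Proof. by apply: ae_finite => // x; exact: dyadic_total_ge0. Qed.

Lemma fiber_compare k (f : RR -> R[i]) : cmeas f ->
  {ae mu, forall x, I01 x -> (dyadic_total (x, xi) < +oo)%E ->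
     nsq (f x) <= 2 / 2 ^+ k * fine (dyadic_total (x, xi))} ->
  (energy I01 f <= (2 / 2 ^+ k)%:E * \int[mu]_(x in I01) dyadic_total (x, xi))%E.
Proof.
move=> mf H; have k0 : 0 <= 2 / 2 ^+ k :> R by rewrite divr_ge0 // exprn_ge0.
rewrite /energy -ge0_integralZl_EFin //; last by move=> x _; exact: dyadic_total_ge0.
apply: ae_ge0_le_integral => //.
- by move=> x _; rewrite lee_fin nsq_ge0.
- by apply: measurable_funTS; exact: cmeas_ensq.
- by move=> x _; rewrite mule_ge0 // ?lee_fin // dyadic_total_ge0.
- exact: measurable_funeM.
apply: ae_imp2 H ae_dyadic_fin => x h1 h2 xI.
have h2' := h2 xI; have := h1 xI h2'.
by rewrite -lee_fin EFinM fineK // ge0_fin_numE // dyadic_total_ge0.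
Qed.

(** Compare with the zeroth truncation, which vanishes. *)
Lemma fiber_energy_fin : (energy I01 (fiber xi) < +oo)%E.
Proof.
apply: (@le_lt_trans _ _ ((2 / 2 ^+ 0)%:E * \int[mu]_(x in I01) dyadic_total (x, xi))%E).
  apply: fiber_compare; first exact: cmeas_fiber.
  apply: aeW => x xI /ccvg_fiber [_ /(_ 0%N)].
  by rewrite {1}/zk N0 zakE muln0 big_ord0 sub0r nsqN.
by rewrite lte_mul_pinfty // lee_fin divr_ge0 // exprn_ge0.
Qed.

Lemma ae_fiber_cvg : {ae mu, forall x, ccvg (fun k => zk k x xi) (fiber xi x)}.
Proof.
have H : {ae mu, forall x, I01 x -> exists l, ccvg (fun k => zk k x xi) l}.
  by apply: ae_imp ae_dyadic_fin => x hx /hx /ccvg_fiber [? _]; exists (fiber xi x).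
apply: ae_imp2 (ae_frac H) (ae_vanishing mh finh) => x cv hx.
have [|l hl] := @ccvg_translate (frac x) xi (Num.floor x) _ cv.
  by rewrite /frac -mulrNz; exact: vanishing_at_shift.
by move: hl; rewrite /frac subrK => hl; rewrite /fiber (ccvg_clim hl).
Qed.

Lemma ae_fiber_quasi : {ae mu, forall x, fiber xi (x + 1) = e1 xi * fiber xi x}.
Proof.
apply: ae_imp2 ae_fiber_cvg (ae_vanishing mh finh) => x cv hx.
exact: ccvg_clim (ccvg_next hx cv).
Qed.

(** In the limit the relation of [zak_linear] becomes first order, because
    the translation by -1 acts as the multiplication by e(-xi). *)
Lemma ae_fiber_eqn : {ae mu, forall x,
  c3 * fiber xi (x - alpha) = (A x + B x * e1 (- xi)) * fiber xi x}.
Proof.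
have E : {ae mu, forall x, forall m : int, c3 * h (x + m%:~R - alpha) =
    A x * h (x + m%:~R) + B x * h (x + m%:~R - 1)}.
  by apply: ae_forall_int => m; apply: ae_imp (ae_shift m%:~R eqn) => x; rewrite Aper Bper.
have E2 := ae_imp2 (fun x => @conj _ _) (ae_shift (- alpha) ae_fiber_cvg) E.
have E3 := ae_imp2 (fun x => @conj _ _) ae_fiber_cvg (ae_vanishing mh finh).
apply: ae_imp2 E2 E3 => x [cva eqs] [cv hx].
have cvl := ccvgZ c3 cva.
have cvr := ccvgD (ccvgZ (A x) cv) (ccvgZ (B x) (ccvg_prev hx cv)).
rewrite mulrDl -mulrA -(ccvg_clim cvl) -(ccvg_clim cvr); congr clim.
by apply/funext => k; exact: zak_linear.
Qed.

Lemma fiber_energy_le k : energy I01 (fiber xi) = 0%E ->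
  (\int[mu]_(x in I01) (nsq (zk k x xi))%:E <= (2 / 2 ^+ k)%:E * \int[mu]_(x in I01) dyadic_total (x, xi))%E.
Proof.
move=> E0; apply: (@fiber_compare k (fun x : RR => zk k x xi)); first exact: cmeas_zak.
have z := energy_eq0 mI (cmeas_fiber xi) E0.
by apply: ae_imp z => x hx xI /ccvg_fiber [_ /(_ k)]; rewrite hx // subr0.
Qed.

End good_fiber.

(** When the limit vanishes in almost every fiber, the k-th truncation is
    bounded by the rate of convergence alone; integrate this over xi. *)
Lemma window_energy_le k : (energy (window (N k)) h <=
  (2 / 2 ^+ k)%:E * \int[mu]_(x in I01) \int[mu]_(xi in I01) dyadic_total (x, xi))%E.
Proof.
have k0 : 0 <= 2 / 2 ^+ k :> R by rewrite divr_ge0 // exprn_ge0.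
pose F (p : RR * RR) := (nsq (zak (N k) h p.1 p.2))%:E.
have mF : measurable_fun setT F by apply: cmeas_ensq; exact: cmeas_zak2.
have F0 p : (0 <= F p)%E by rewrite lee_fin nsq_ge0.
have mG := m_dyadic_total.
have mGs : measurable_fun I01 (fun xi : RR => \int[mu]_(x in I01) dyadic_total (x, xi))%E.
  by apply: measurable_funTS; apply: measurable_slice_I01 => //; exact: dyadic_total_ge0.
have Gs0 xi : (0 <= \int[mu]_(x in I01) dyadic_total (x, xi))%E.
  by apply: integral_ge0 => x _; exact: dyadic_total_ge0.
rewrite -zak_square // (tonelli_I01 mF F0) (tonelli_I01 mG dyadic_total_ge0).
rewrite -ge0_integralZl_EFin //.
apply: ae_ge0_le_integral => //.
- by move=> xi _; apply: integral_ge0 => x _; exact: F0.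
- by apply: measurable_funTS; exact: measurable_slice_I01.
- by move=> xi _; rewrite mule_ge0.
- exact: measurable_funeM.
apply: ae_imp2 fiber0 ae_good_fiber => xi H0 fin xiI; have {}fin := fin xiI.
apply: fiber_energy_le => //; apply: H0; first exact: cmeas_fiber.
- exact: fiber_energy_fin.
- exact: ae_fiber_quasi.
- exact: ae_fiber_eqn.
Qed.

Lemma schedule_vanishing : {ae mu, forall t, h t = 0}.
Proof.
have [C CE] : exists C : R, (\int[mu]_(x in I01) \int[mu]_(xi in I01) dyadic_total (x, xi))%E = C%:E.
  exists (fine (\int[mu]_(x in I01) \int[mu]_(xi in I01) dyadic_total (x, xi))%E).
  rewrite fineK // ge0_fin_numE; first exact: dyadic_total_int.
  by apply: integral_ge0 => x _; apply: integral_ge0 => xi _; exact: dyadic_total_ge0.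
have W n : energy (window n) h = 0%E.
  apply/eqP; rewrite eq_le energy_ge0 andbT; apply/lee_addgt0Pr => e e0; rewrite add0e.
  have lim : (fun k => (2 * C) * (2^-1 : R) ^+ k) @ \oo --> 0.
    rewrite -[X in _ --> X](mulr0 (2 * C)); apply: cvgMl_tmp.
    by apply: cvg_expr; rewrite ger0_norm ?invr_ge0 // invf_lt1 // ltr1n.
  have /cvgrPdist_lt /(_ _ e0) [K _ KP] := lim.
  have h1 : (energy (window n) h <= energy (window (N (maxn K n))) h)%E.
    apply: energy_sub => //; try exact: mwindow.
    have nN : n%:R <= (N (maxn K n))%:R :> R by rewrite ler_nat (leq_trans _ (Nge _)) // leq_maxr.
    by move=> t; rewrite /window /= !in_itv /= => /andP[h1 h2]; apply/andP; split; lra.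
  apply: (le_trans h1); apply: (le_trans (window_energy_le _)); rewrite CE -EFinM lee_fin.
  have := KP (maxn K n) (leq_maxl _ _); rewrite sub0r normrN => /ltW; apply: le_trans.
  by rewrite (le_trans _ (ler_norm _)) // exprVn -!mulrA (mulrC C).
have Z n : {ae mu, forall t, window n t -> h t = 0}.
  by apply: energy_eq0 => //; exact: mwindow.
apply: ae_imp (ae_foralln_R Z) => t; apply: contraPP => /eqP ht.
have [n nt] : exists n : nat, `|t| < n%:R.
  by exists (Num.truncn `|t|).+1; exact: truncnS_gt.
move=> /(_ n) H; move: ht; rewrite H ?eqxx // /window /= in_itv /=.
by move: nt; rewrite ltr_norml => /andP[/ltW -> ->].
Qed.

End with_schedule.

(** If on almost every fiber the relation has no nonzero solution, then h = 0:
    the energy of h in a fixed window is bounded by quantities that tend to 0. *)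
Theorem zak_vanishing : {ae mu, forall t, h t = 0}.
Proof.
have [N [N0 Nmono Nge Ntail]] := window_schedule.
exact: schedule_vanishing N0 Nmono Nge Ntail.
Qed.

End zak_theorem.

(** * The inner product of L2 *)

Section inner_product.
Context (R : realType).
Notation mu := (@lebesgue_measure R).
Notation RR := (measurableTypeR R).
Implicit Types (f g h : RR -> R[i]).

Definition square_int f := cmeas f /\ (energy setT f < +oo)%E.

Lemma square_intZ (c : R[i]) f : square_int f -> square_int (fun t => c * f t).
Proof.
move=> [mf ff]; split; first exact: cmeasZ.
apply: (@le_lt_trans _ _ ((nsq c)%:E * energy setT f)%E).
  by apply: le_energy => //; [exact: cmeasZ|exact: nsq_ge0|move=> t _; rewrite nsqM].
by rewrite lte_mul_pinfty // lee_fin nsq_ge0.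
Qed.

Lemma square_intD f g : square_int f -> square_int g -> square_int (fun t => f t + g t).
Proof.
move=> [mf ff] [mg fg]; split; first exact: cmeasD.
apply: (le_lt_trans (energyD_le _ _ _)) => //.
by rewrite lte_add_pinfty // lte_mul_pinfty // lee_fin.
Qed.

Lemma square_int_shift f (a : R) : square_int f -> square_int (fun t => f (t + a)).
Proof. by move=> [mf ff]; split; [exact: cmeas_shift|rewrite energy_shift]. Qed.

Lemma energy_unimodular f (u : R -> R[i]) D : (forall t, nsq (u t) = 1) ->
  energy D (fun t => u t * f t) = energy D f.
Proof. by move=> u1; apply: eq_integral => t _; rewrite nsqM u1 mul1r. Qed.

Lemma square_int_unimodular f (u : RR -> R[i]) : cmeas u -> (forall t, nsq (u t) = 1) ->
  square_int f -> square_int (fun t => u t * f t).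
Proof. by move=> mu1 u1 [mf ff]; split; [exact: cmeasM|rewrite energy_unimodular]. Qed.

Definition cintegrable f :=
  mu.-integrable setT (fun t => (complex.Re (f t))%:E) /\
  mu.-integrable setT (fun t => (complex.Im (f t))%:E).

Definition cint f : R[i] :=
  Rintegral mu setT (fun t => complex.Re (f t)) +i* Rintegral mu setT (fun t => complex.Im (f t)).

Lemma conjcD (z w : R[i]) : (z + w)^*%C = z^*%C + w^*%C.
Proof. by case: z w => a b [c d] /=; congr (_ +i* _); ring. Qed.

Lemma conjcM (z w : R[i]) : (z * w)^*%C = z^*%C * w^*%C.
Proof. by case: z w => a b [c d] /=; congr (_ +i* _); ring. Qed.

Lemma norm_Re_prod (z w : R[i]) : `|complex.Re (z * w^*%C)| <= nsq z + nsq w.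
Proof.
case: z w => a b [c d]; rewrite /nsq /= ler_norml.
have := sqr_ge0 (a - c); have := sqr_ge0 (a + c).
have := sqr_ge0 (b - d); have := sqr_ge0 (b + d) => *.
by apply/andP; split; nra.
Qed.

Lemma norm_Im_prod (z w : R[i]) : `|complex.Im (z * w^*%C)| <= nsq z + nsq w.
Proof.
case: z w => a b [c d]; rewrite /nsq /= ler_norml.
have := sqr_ge0 (a - d); have := sqr_ge0 (a + d).
have := sqr_ge0 (b - c); have := sqr_ge0 (b + c) => *.
by apply/andP; split; nra.
Qed.

Lemma cint_integrable f g : square_int f -> square_int g -> cintegrable (fun t => f t * (g t)^*%C).
Proof.
move=> [mf ff] [mg fg].
have mfg := cmeasM mf (cmeas_conj mg).
have iE k : cmeas k -> (energy setT k < +oo)%E -> mu.-integrable setT (fun t => (nsq (k t))%:E).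
  move=> mk fk; apply/integrableP; split; first exact: cmeas_ensq.
  have -> : (\int[mu]_x `|(nsq (k x))%:E| = energy setT k)%E.
    by apply: eq_integral => t _; rewrite gee0_abs // lee_fin nsq_ge0.
  exact: fk.
have iS : mu.-integrable setT (fun t => (nsq (f t) + nsq (g t))%:E).
  exact: (integrableD _ (iE f mf ff) (iE g mg fg)).
split.
  apply: (le_integrable _ _ _ iS) => //; first by apply/measurable_EFinP; case: mfg.
  move=> t _; rewrite lee_fin [leRHS]ger0_norm; last exact: addr_ge0 (nsq_ge0 _) (nsq_ge0 _).
  exact: norm_Re_prod.
apply: (le_integrable _ _ _ iS) => //; first by apply/measurable_EFinP; case: mfg.
move=> t _; rewrite lee_fin [leRHS]ger0_norm; last exact: addr_ge0 (nsq_ge0 _) (nsq_ge0 _).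
exact: norm_Im_prod.
Qed.

Lemma cintD f g : cintegrable f -> cintegrable g -> cint (fun t => f t + g t) = cint f + cint g.
Proof.
move=> [f1 f2] [g1 g2]; rewrite /cint.
have -> : (fun t => complex.Re (f t + g t)) = (fun t => complex.Re (f t) + complex.Re (g t)).
  by apply/funext => t; case: (f t) (g t) => ? ? [].
have -> : (fun t => complex.Im (f t + g t)) = (fun t => complex.Im (f t) + complex.Im (g t)).
  by apply/funext => t; case: (f t) (g t) => ? ? [].
by rewrite !RintegralD.
Qed.

Lemma cintZ (c : R[i]) f : cintegrable f -> cint (fun t => c * f t) = c * cint f.
Proof.
move=> [f1 f2]; case: c => a b; rewrite /cint.
have iZ (r : R) (p : RR -> R) : mu.-integrable setT (fun t => (p t)%:E) ->
    mu.-integrable setT (fun t => (r * p t)%:E).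
  by move=> /(integrableZl measurableT r).
have -> : (fun t => complex.Re ((a +i* b) * f t)) =
    (fun t => a * complex.Re (f t) - b * complex.Im (f t)).
  by apply/funext => t; case: (f t).
have -> : (fun t => complex.Im ((a +i* b) * f t)) =
    (fun t => a * complex.Im (f t) + b * complex.Re (f t)).
  by apply/funext => t; case: (f t).
have -> : Rintegral mu setT (fun t => a * complex.Re (f t) - b * complex.Im (f t)) =
    a * Rintegral mu setT (fun t => complex.Re (f t)) - b * Rintegral mu setT (fun t => complex.Im (f t)).
  by rewrite RintegralB ?RintegralZl //; exact: iZ.
by rewrite RintegralD ?RintegralZl //; exact: iZ.
Qed.

(** Positive and negative parts are treated by the translation invariance of the
    nonnegative integral. *)
Lemma integral_shift_real (p : RR -> \bar R) (a : R) : measurable_fun setT p ->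
  (\int[mu]_t p (t + a)%R = \int[mu]_t p t)%E.
Proof.
move=> mp; rewrite (@integralE _ RR R mu setT (fun t => p (t + a)%R)) (@integralE _ RR R mu setT p).
have H1 := @integral_shiftT R a (p ^\+)%E (measurable_funepos mp) (funepos_ge0 p).
have H2 := @integral_shiftT R a (p ^\-)%E (measurable_funeneg mp) (funeneg_ge0 p).
rewrite -H1 -H2; congr (_ - _)%E; apply: eq_integral => x _; by rewrite ?funeposE ?funenegE.
Qed.

Lemma cint_shift f (a : R) : cmeas f -> cint (fun t => f (t + a)) = cint f.
Proof.
move=> [m1 m2]; rewrite /cint; congr (_ +i* _); congr fine.
  by rewrite -(@integral_shift_real (fun t => (complex.Re (f t))%:E) a) //; exact/measurable_EFinP.
by rewrite -(@integral_shift_real (fun t => (complex.Im (f t))%:E) a) //; exact/measurable_EFinP.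
Qed.

Lemma cint_conj f : cintegrable f -> cint (fun t => (f t)^*%C) = (cint f)^*%C.
Proof.
move=> [f1 f2]; rewrite /cint /=; congr (_ +i* _).
  by congr fine; apply: eq_integral => t _; case: (f t).
have -> : (fun t => complex.Im (f t)^*%C) = (fun t => (-1) * complex.Im (f t)).
  by apply/funext => t; case: (f t) => ? ?; rewrite mulN1r.
by rewrite RintegralZl // mulN1r.
Qed.

Lemma cint_ae f g : cmeas f -> cmeas g -> {ae mu, forall t, f t = g t} -> cint f = cint g.
Proof.
move=> [f1 f2] [g1 g2] fg; rewrite /cint; congr (_ +i* _); congr fine;
  apply: ae_eq_integral => //; try exact/measurable_EFinP.
  by apply: ae_imp fg => t ->.
by apply: ae_imp fg => t ->.
Qed.

Definition ip f g := cint (fun t => f t * (g t)^*%C).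

Lemma ipDl f g h : square_int f -> square_int g -> square_int h ->
  ip (fun t => f t + g t) h = ip f h + ip g h.
Proof.
move=> Lf Lg Lh; rewrite /ip -cintD; try exact: cint_integrable.
by congr cint; apply/funext => t; rewrite mulrDl.
Qed.

Lemma ipZl c f h : square_int f -> square_int h -> ip (fun t => c * f t) h = c * ip f h.
Proof.
move=> Lf Lh; rewrite /ip -cintZ; last exact: cint_integrable.
by congr cint; apply/funext => t; rewrite mulrA.
Qed.

Lemma ip_conj f g : square_int f -> square_int g -> (ip f g)^*%C = ip g f.
Proof.
move=> Lf Lg; rewrite /ip -cint_conj; last exact: cint_integrable.
by congr cint; apply/funext => t; case: (f t) (g t) => a b [c d] /=; congr (_ +i* _); ring.
Qed.

Lemma ipDr f g h : square_int f -> square_int g -> square_int h ->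
  ip h (fun t => f t + g t) = ip h f + ip h g.
Proof.
move=> Lf Lg Lh; rewrite -ip_conj ?ipDl //; last exact: square_intD.
by rewrite conjcD !ip_conj.
Qed.

Lemma ipZr c f h : square_int f -> square_int h -> ip h (fun t => c * f t) = c^*%C * ip h f.
Proof.
move=> Lf Lh; rewrite -ip_conj ?ipZl //; last exact: square_intZ.
by rewrite conjcM !ip_conj.
Qed.

Lemma ip_shift f g (a : R) : square_int f -> square_int g ->
  ip (fun t => f (t + a)) (fun t => g (t + a)) = ip f g.
Proof.
move=> [mf _] [mg _]; rewrite /ip (@cint_shift (fun t => f t * (g t)^*%C)) //.
by apply: cmeasM => //; exact: cmeas_conj.
Qed.

Definition norm2 f : R := fine (energy setT f).

Lemma ip_self f : square_int f -> ip f f = ((norm2 f)%:C)%C.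
Proof.
move=> [mf ff]; rewrite /ip /cint /norm2 /energy /Rintegral; congr (_ +i* _).
  by congr fine; apply: eq_integral => t _; rewrite -nsqC.
under eq_integral do rewrite -nsqC /=.
by rewrite integral0.
Qed.

Lemma norm2_ge0 f : 0 <= norm2 f.
Proof. by rewrite fine_ge0 // energy_ge0. Qed.

Lemma norm2Z (c : R[i]) f : square_int f -> norm2 (fun t => c * f t) = nsq c * norm2 f.
Proof.
move=> [mf ff]; rewrite /norm2 /energy.
under eq_integral do rewrite nsqM EFinM.
rewrite ge0_integralZl_EFin ?nsq_ge0 //.
- by rewrite fineM // ge0_fin_numE // energy_ge0.
- by move=> t _; rewrite lee_fin nsq_ge0.
- exact: cmeas_ensq.
Qed.

Lemma norm2B f g : square_int f -> square_int g ->
  norm2 (fun t => f t - g t) = norm2 f - 2 * complex.Re (ip f g) + norm2 g.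
Proof.
move=> Lf Lg.
have LZ : square_int (fun t => -1 * g t) by exact: square_intZ.
have E : (fun t => f t - g t) = (fun t => f t + (-1) * g t).
  by apply/funext => t; rewrite mulN1r.
have LB : square_int (fun t => f t - g t) by rewrite E; exact: square_intD.
have : ip (fun t => f t - g t) (fun t => f t - g t) = ip f f - ip f g - (ip f g)^*%C + ip g g.
  rewrite E ipDl // ?ipDr // ?ipZl ?ipZr //; last exact: square_intD.
  rewrite ip_conj // rmorphN1; ring.
rewrite !ip_self // => /(congr1 (@complex.Re R)).
by case: (ip f g) => a b /= ->; ring.
Qed.

(** The norm of f - s <f, g> g is nonnegative for every real s. *)
Lemma cauchy_schwarz f g : square_int f -> square_int g ->
  nsq (ip f g) <= norm2 f * norm2 g.
Proof.
move=> Lf Lg; set n := nsq _.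
have quad (s : R) : 0 <= norm2 f - 2 * (s * n) + s ^+ 2 * n * norm2 g.
  pose l := (s%:C)%C * ip f g.
  have := norm2_ge0 (fun t => f t - l * g t).
  rewrite norm2B // ?ipZr //; last exact: square_intZ.
  have -> : complex.Re (l^*%C * ip f g) = s * n.
    by rewrite /l /n /nsq; case: (ip f g) => a b /=; ring.
  have -> : norm2 (fun t => l * g t) = s ^+ 2 * n * norm2 g.
    rewrite norm2Z // /l nsqM; congr (_ * _ * _).
    by rewrite /nsq /= expr0n addr0.
  by [].
have n0 : 0 <= n by exact: nsq_ge0.
have f0 := norm2_ge0 f; have g0 := norm2_ge0 g.
have [g00|gn0] := eqVneq (norm2 g) 0.
  rewrite g00 mulr0; have [//|np] := leP n 0.
  have := quad ((norm2 f + 1) / (2 * n)); rewrite g00 mulr0 addr0.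
  rewrite (_ : 2 * _ = norm2 f + 1); first lra.
  by field; rewrite gt_eqF.
have gp : 0 < norm2 g by rewrite lt_neqAle eq_sym gn0.
have := quad (norm2 g)^-1.
rewrite (_ : _ + _ = norm2 f - n / norm2 g); last by field.
by rewrite subr_ge0 ler_pdivrMr.
Qed.

End inner_product.

(** The recurrence multiplies the Wronskian by the unimodular ratio of the
    conjugate of D by D at each step, so its modulus is constant; it tends to 0
    since a does and b is bounded. Vanishing of the Wronskian spreads
    proportionality from two consecutive terms to all later ones. *)
Lemma wronskian_zero (R : realType) (D : R[i]) (w a b : nat -> R[i]) (M : R) : D != 0 ->
  (forall n, D * a n.+2 + D^*%C * a n = w n * a n.+1) ->
  (forall n, D * b n.+2 + D^*%C * b n = w n * b n.+1) ->
  (forall eps : R, 0 < eps -> exists K : nat, forall n, (K <= n)%N -> nsq (a n) <= eps) ->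
  (forall n, nsq (b n) <= M) -> forall n, a 0%N * b n = b 0%N * a n.
Proof.
move=> D0 ra rb a0 bM.
have nsq_conj z : nsq z^*%C = nsq z :> R by case: z => x y; rewrite /nsq /= sqrrN.
pose W n := a n * b n.+1 - a n.+1 * b n.
have WS n : D * W n.+1 = D^*%C * W n.
  have E1 : D * b n.+2 = w n * b n.+1 - D^*%C * b n by rewrite -rb addrK.
  have E2 : D * a n.+2 = w n * a n.+1 - D^*%C * a n by rewrite -ra addrK.
  rewrite /W mulrBr [D * (_ * b n.+2)]mulrCA E1 [D * (_ * b n.+1)]mulrA E2; ring.
have Wc n : nsq (W n) = nsq (W 0%N).
  elim: n => // n <-; have /(congr1 (@nsq R)) := WS n.
  by rewrite !nsqM nsq_conj; apply: mulfI; rewrite nsq_eq0.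
have M0 : 0 <= M := le_trans (nsq_ge0 _) (bM 0%N).
have W0 : W 0%N = 0.
  apply/eqP; rewrite -nsq_eq0 eq_le nsq_ge0 andbT; apply/ler_addgt0Pr => e e0; rewrite add0r.
  have e1 : 0 < e / (4 * (M + 1)) by rewrite divr_gt0 // mulr_gt0 // ltr_wpDl.
  have [K HK] := a0 _ e1; rewrite -(Wc K) /W (le_trans (nsqB_le _ _)) // !nsqM.
  have h1 := HK K (leqnn _); have h2 := HK K.+1 (leqnSn _).
  have t1 := ler_pM (nsq_ge0 (a K)) (nsq_ge0 (b K.+1)) h1 (bM _).
  have t2 := ler_pM (nsq_ge0 (a K.+1)) (nsq_ge0 (b K)) h2 (bM _).
  have : e / (4 * (M + 1)) * M <= e / 4.
    rewrite (_ : _ * M = e / 4 * (M / (M + 1))); last by field; rewrite gt_eqF // ltr_wpDl.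
    apply: ler_piMr; first by rewrite divr_ge0 ?ltW.
    by rewrite ler_pdivrMr ?ltr_wpDl // mul1r lerDl.
  lra.
have E n : a 0%N * b n = b 0%N * a n /\ a 0%N * b n.+1 = b 0%N * a n.+1.
  elim: n => [|n [IH1 IH2]].
    split; first by rewrite mulrC.
    by have /eqP := W0; rewrite subr_eq0 => /eqP ->; rewrite mulrC.
  split=> //; apply: (mulfI D0).
  have E1 : D * b n.+2 = w n * b n.+1 - D^*%C * b n by rewrite -rb addrK.
  have E2 : D * a n.+2 = w n * a n.+1 - D^*%C * a n by rewrite -ra addrK.
  rewrite mulrCA E1 [RHS]mulrCA E2 !mulrBr ![a 0%N * (_ * _)]mulrCA IH1 IH2; ring.
by move=> n; have [] := E n.
Qed.

(** * Relations between three shifts *)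

Section autocorrelation.
Context (R : realType).
Notation mu := (@lebesgue_measure R).
Notation RR := (measurableTypeR R).
Variable h : RR -> R[i].
Hypothesis Lh : square_int h.

(** The autocorrelation of h. *)
Definition rho (tau : R) : R[i] := ip (fun t => h (t + tau)) h.

Lemma ip_rho (a b : R) : ip (fun t => h (t + a)) (fun t => h (t + b)) = rho (a - b).
Proof.
rewrite /rho -(ip_shift b (square_int_shift (a - b) Lh) Lh); congr ip.
by apply/funext => t; congr h; ring.
Qed.

Lemma rho0 : rho 0 = ((norm2 h)%:C)%C.
Proof. by rewrite -ip_self // /rho; congr ip; apply/funext => t; rewrite addr0. Qed.

Lemma norm2_shift (tau : R) : norm2 (fun t => h (t + tau)) = norm2 h.
Proof. by rewrite /norm2 energy_shift //; case: Lh. Qed.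

Lemma rho_le tau : nsq (rho tau) <= norm2 h ^+ 2.
Proof.
rewrite (le_trans (cauchy_schwarz (square_int_shift tau Lh) Lh)) //.
by rewrite norm2_shift.
Qed.

Lemma rho_near0 (eps : R) : 0 < eps -> exists2 d : R, 0 < d &
  forall s : R, `|s| < d -> norm2 h - eps <= complex.Re (rho s).
Proof.
move=> e0; have [mh fh] := Lh.
have [d d0 dP] := L2_translation mh fh e0; exists d => // s /dP hs.
have := norm2B (square_int_shift s Lh) Lh; rewrite norm2_shift -/(rho s).
have : norm2 (fun t => h (t + s) - h t) <= eps.
  rewrite -lee_fin fineK // ge0_fin_numE ?energy_ge0 //.
  by rewrite (le_lt_trans hs) // ltry.
move=> *; lra.
Qed.

(** Split h into its restriction to a large window and a remainder of small
    norm; the windowed part is orthogonal to its distant translates. *)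
Lemma rho_decay (eps : R) : 0 < eps -> exists K : R, forall tau, K < `|tau| -> nsq (rho tau) <= eps.
Proof.
have alg (x y p r n e : R) : x <= p * r -> y <= r * n -> p * r <= n * r ->
    r * (4 * n + 1) <= e -> 0 <= r -> 2 * x + 2 * y <= e.
  by move=> *; lra.
move=> e0; have [mh fh] := Lh.
have N0 := norm2_ge0 h.
have N4 : 0 < 4 * norm2 h + 1 by rewrite ltr_wpDl // mulr_ge0.
have d0 : 0 < eps / (4 * norm2 h + 1) by rewrite divr_gt0.
have [n nP] := window_tail mh fh d0; have {}nP := nP n (leqnn n).
exists (2 * n%:R) => tau htau.
pose u t := cutoff (window n) h t; pose v t := cutoff (~` window n) h t.
have uv t : h t = u t + v t.
  by rewrite /u /v !cutoffE in_setC; case: ifP => _; rewrite ?addr0 ?add0r.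
have mW := @mwindow R n.
have sub f D : measurable D -> square_int f -> square_int (cutoff D f).
  move=> mD [mf ff]; split; first exact: cmeas_cutoff.
  apply: le_lt_trans ff; rewrite -[leRHS]mul1e; apply: le_energy => //; first exact: cmeas_cutoff.
  by move=> t _; rewrite mul1r cutoffE; case: ifP => // _; rewrite nsq0 nsq_ge0.
have Lu : square_int u by exact: sub.
have Lv : square_int v by apply: sub => //; exact: measurableC.
have Nv : norm2 v <= eps / (4 * norm2 h + 1).
  by rewrite -lee_fin fineK // ge0_fin_numE ?energy_ge0 //; case: Lv.
have Nu : norm2 u <= norm2 h.
  rewrite -lee_fin !fineK ?ge0_fin_numE ?energy_ge0 //; last by case: Lu.
  rewrite -[leRHS]mul1e; apply: le_energy => //; first by case: Lu.
  by move=> t _; rewrite mul1r /u cutoffE; case: ifP => // _; rewrite nsq0 nsq_ge0.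
have E : rho tau = ip (fun t => u (t + tau)) v + ip (fun t => v (t + tau)) h.
  have -> : rho tau = ip (fun t => u (t + tau)) h + ip (fun t => v (t + tau)) h.
    rewrite -(ipDl (square_int_shift tau Lu) (square_int_shift tau Lv) Lh) /rho.
    by congr (ip _ h); apply/funext => t; exact: uv.
  congr (_ + _).
  have -> : ip (fun t => u (t + tau)) h = ip (fun t => u (t + tau)) u + ip (fun t => u (t + tau)) v.
    rewrite -(ipDr Lu Lv (square_int_shift tau Lu)).
    by congr (ip _ _); apply/funext => t; exact: uv.
  rewrite [X in X + _](_ : _ = 0) ?add0r //.
  rewrite /ip (_ : (fun t => _) = (fun=> 0)).
    by rewrite /cint /Rintegral /= integral0.
  apply/funext => t; rewrite /u !cutoffE.
  case: ifP => [|_]; last by rewrite mul0r.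
  case: ifP => [|_]; last by rewrite conjc0 mulr0.
  rewrite !inE /window /= !in_itv /= => /andP[t1 t2] /andP[t3 t4]; exfalso.
  have : `|tau| <= 2 * n%:R by rewrite ler_norml; apply/andP; split; lra.
  by rewrite leNgt htau.
have c1 := cauchy_schwarz (square_int_shift tau Lu) Lv.
have c2 := cauchy_schwarz (square_int_shift tau Lv) Lh.
have Sv : norm2 (fun t => v (t + tau)) = norm2 v by rewrite /norm2 energy_shift //; case: Lv.
have Su : norm2 (fun t => u (t + tau)) = norm2 u by rewrite /norm2 energy_shift //; case: Lu.
rewrite Su in c1; rewrite Sv in c2.
rewrite E (le_trans (nsqD_le _ _)) //.
have v0 := norm2_ge0 v; have u0 := norm2_ge0 u.
move: Nv; rewrite ler_pdivlMr // => Nv.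
have h1 : norm2 u * norm2 v <= norm2 h * norm2 v by rewrite ler_wpM2r.
exact: alg c1 c2 h1 Nv v0.
Qed.

(** Correlate both sides of the relation with their translates by tau. On the
    right the modulation only leaves its value at tau, and the shift x0
    disappears. *)
Lemma rho_rec (a1 a3 a2 : R[i]) (beta gamma x0 tau : R) :
  {ae mu, forall t, a1 * h t + a3 * h (t - beta) = a2 * e1 (gamma * t) * h (t - x0)} ->
  a1 * a3^*%C * rho (tau + beta) + (a1 * a3^*%C)^*%C * rho (tau - beta) =
  (a2 * a2^*%C * e1 (gamma * tau) - a1 * a1^*%C - a3 * a3^*%C) * rho tau.
Proof.
move=> eq; have [mh fh] := Lh.
have S (c : R) : square_int (fun t => h (t + c)) by exact: square_int_shift.
pose F (t : RR) := a1 * h (t + 0) + a3 * h (t + (- beta)).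
pose F' (t : RR) := a1 * h (t + tau) + a3 * h (t + (tau - beta)).
pose k c (t : RR) := e1 (gamma * t) * h (t + c).
have ue t : nsq (e1 (gamma * t)) = 1 by exact: nsq_e1.
have mu1 : cmeas (fun t : RR => e1 (gamma * t)) by apply: cmeas_e1; exact: measurable_funM.
have Lk c : square_int (k c) by exact: (square_int_unimodular mu1 ue (S c)).
pose G (t : RR) := a2 * k (- x0) t.
pose G' (t : RR) := (a2 * e1 (gamma * tau)) * k (tau - x0) t.
have LF : square_int F by apply: square_intD; exact: square_intZ.
have LF' : square_int F' by apply: square_intD; exact: square_intZ.
have LG : square_int G by exact: square_intZ.
have LG' : square_int G' by exact: square_intZ.
have EF : {ae mu, forall t, F t = G t}.
  by apply: ae_imp eq => t; rewrite /F /G /k addr0 mulrA.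
have EF' : {ae mu, forall t, F' t = G' t}.
  apply: ae_imp (ae_shift tau eq) => t.
  by rewrite /F' /G' /k addrA => ->; rewrite mulrDr e1D addrA; ring.
have : ip F' F = ip G' G.
  rewrite /ip; apply: cint_ae; try (apply: cmeasM; last apply: cmeas_conj).
  - by case: LF'.
  - by case: LF.
  - by case: LG'.
  - by case: LG.
  - by apply: ae_imp2 EF' EF => t -> ->.
rewrite /F /F' ipDl; try exact: square_intZ; last exact: LF.
rewrite !ipDr; try exact: square_intZ.
rewrite !ipZl; try exact: square_intZ; try exact: S; try exact: Lk.
rewrite !ipZr; try exact: S; try exact: Lk.
rewrite !ip_rho.
have -> : ip (k (tau - x0)) (k (- x0)) = rho tau.
  have -> : tau = (tau - x0) - (- x0) by ring.
  rewrite -[in RHS]ip_rho /ip; congr cint; apply/funext => t.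
  rewrite /k conjcM mulrACA -nsqC nsq_e1 mul1r; congr (h _ * _); ring.
rewrite !subr0 opprK (_ : tau - beta + beta = tau); last by ring.
rewrite conjcM conjcK => H.
have {}H : a1 * a3^*%C * rho (tau + beta) + a1^*%C * a3 * rho (tau - beta) =
  a2 * e1 (gamma * tau) * (a2^*%C * rho tau) - a1 * (a1^*%C * rho tau) - a3 * (a3^*%C * rho tau).
  rewrite -H; ring.
rewrite H; ring.
Qed.

(** Comparison of the recurrence along n beta and along n beta + z, where the
    modulation does not see z. *)
Theorem three_points (a1 a3 a2 : R[i]) (beta gamma x0 : R) :
  a1 != 0 -> a3 != 0 -> beta != 0 ->
  {ae mu, forall t, a1 * h t + a3 * h (t - beta) = a2 * e1 (gamma * t) * h (t - x0)} ->
  {ae mu, forall t, h t = 0}.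
Proof.
move=> a10 a30 b0 eq; have [mh fh] := Lh.
have N0 := norm2_ge0 h.
have [Nz|Nn] := eqVneq (norm2 h) 0.
  have E0 : energy setT h = 0%E.
    by rewrite -[LHS]fineK ?ge0_fin_numE ?energy_ge0 // -/(norm2 h) Nz.
  by apply: ae_imp (energy_eq0 measurableT mh E0) => t; exact.
exfalso; have Np : 0 < norm2 h by rewrite lt_neqAle eq_sym Nn.
have [d d0 dP] := rho_near0 (divr_gt0 Np (ltr0n _ 4 : 0 < 4)).
have decay (eps : R) : 0 < eps -> exists K : nat, forall n : nat, (K <= n)%N -> nsq (rho (n%:R * beta)) <= eps.
  move=> /rho_decay [K HK].
  exists (Num.truncn (`|K| / `|beta|)).+1 => n nK; apply: HK.
  apply: (le_lt_trans (ler_norm _)); rewrite normrM normr_nat -ltr_pdivrMr ?normr_gt0 //.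
  by apply: (lt_le_trans (truncnS_gt _)); rewrite ler_nat.
have [N1 hN1] := decay _ (divr_gt0 (exprn_gt0 2 Np) (ltr0n _ 4 : 0 < 4)).
(* n beta + z is close to 0 although n is large: for gamma <> 0, z is a
   multiple of 1 / gamma given by Dirichlet's theorem for beta gamma. *)
have [n [z [nN1 ez hz]]] : exists n : nat, exists z : R,
    [/\ (N1 <= n)%N, e1 (gamma * z) = 1 & `|n%:R * beta + z| < d].
  have [->|g0] := eqVneq gamma 0.
    by exists N1, (- (N1%:R * beta)); rewrite leqnn mul0r e10 addrN normr0.
  have dg : 0 < d * `|gamma| by rewrite mulr_gt0 // normr_gt0.
  have [n [k [nN _ hk]]] := dirichlet (beta * gamma) N1 dg.
  exists n, (- k%:~R / gamma); split => //.
    by rewrite mulrC divfK // -mulrNz e1_int.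
  rewrite -(ltr_pM2r (_ : 0 < `|gamma|)) ?normr_gt0 // -normrM.
  by rewrite mulrDl divfK // -mulrA.
pose D := a1 * a3^*%C.
have D0 : D != 0 by rewrite mulf_neq0 // -nsq_eq0; case: (a3) a30 => x y; rewrite -nsq_eq0 /nsq /= sqrrN.
pose w m := a2 * a2^*%C * e1 (gamma * (m.+1%:R * beta)) - a1 * a1^*%C - a3 * a3^*%C.
have W := @wronskian_zero _ D w (fun m => rho (m%:R * beta)) (fun m => rho (m%:R * beta + z))
  (norm2 h ^+ 2) D0 _ _ decay (fun m => rho_le _).
have /= := W _ _ n; rewrite !mul0r add0r => H.
have {H} : rho 0 * rho (n%:R * beta + z) = rho z * rho (n%:R * beta).
  apply: H => m.
    rewrite -(rho_rec _ eq) -/D; congr (_ * rho _ + _ * rho _); rewrite -!natr1; ring.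
  have -> : w m = a2 * a2^*%C * e1 (gamma * (m.+1%:R * beta + z)) - a1 * a1^*%C - a3 * a3^*%C.
    by rewrite mulrDr e1D ez mulr1.
  rewrite -(rho_rec _ eq) -/D; congr (_ * rho _ + _ * rho _); rewrite -!natr1; ring.
move=> /(congr1 (@nsq R)); rewrite !nsqM rho0.
have -> : nsq ((norm2 h)%:C)%C = norm2 h ^+ 2 by rewrite /nsq /= expr0n addr0.
have h1 := hN1 n nN1; have h2 := rho_le z.
have h3 := ler_pM (nsq_ge0 _) (nsq_ge0 _) h2 h1.
have h4 := dP _ hz.
have h5 := Re2_le (rho (n%:R * beta + z)).
(* Near 0 the modulus of rho is at least 3/4 of rho(0), while proportionality
   and decay bound it by 1/2 of rho(0). *)
have h6 : (norm2 h * (3 / 4)) ^+ 2 <= complex.Re (rho (n%:R * beta + z)) ^+ 2.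
  have p34 : 0 <= norm2 h * (3 / 4) by rewrite mulr_ge0.
  have h5' : norm2 h * (3 / 4) <= complex.Re (rho (n%:R * beta + z)).
    by apply: le_trans h4; lra.
  by rewrite ler_sqr ?nnegrE // (le_trans p34).
move: h3 => /[swap] <-.
have N2 : 0 < norm2 h ^+ 2 by rewrite exprn_gt0.
rewrite ler_pM2l //; nra.
Qed.

End autocorrelation.

(** * Generic fibers of a four-term relation *)

Section exceptional_phases.
Context (R : realType).
Notation mu := (@lebesgue_measure R).
Notation RR := (measurableTypeR R).

Lemma ae_neq (a : R) : {ae mu, forall t, t <> a}.
Proof.
exists [set a]; split; first exact: measurable_set1.
  by rewrite lebesgue_measure_set1.
by move=> x /= /contrapT.
Qed.

(** The solutions of e(t) = z form a coset of Z, or are absent. *)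
Lemma ae_e1_neq (z : R[i]) : {ae mu, forall t, e1 t != z}.
Proof.
have [[t0 e0]|no] := pselect (exists t0 : R, e1 t0 = z); last first.
  by apply: aeW => t; apply/eqP => et; apply: no; exists t.
apply: ae_imp (ae_forall_int (fun m : int => ae_neq (t0 + m%:~R))) => t H.
apply/eqP => et; have : e1 (t - t0) = 1 by rewrite e1B et e0 divff // -e0 e1_neq0.
by move=> /e1_eq1 [m hm]; apply: (H m); rewrite -hm; ring.
Qed.

Lemma ae_e1_notin (s : seq R[i]) : {ae mu, forall t, e1 t \notin s}.
Proof.
elim: s => [|z s IH]; first exact: aeW.
by apply: ae_imp2 (ae_e1_neq z) IH => t h1 h2; rewrite inE negb_or h1 h2.
Qed.

Lemma ae_e1N_notin (s : seq R[i]) : {ae mu, forall t, e1 (- t) \notin s}.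
Proof.
apply: ae_imp (ae_e1_notin (map (fun z => z^-1) s)) => t; apply: contra => h.
by rewrite -[t]opprK e1N; exact: map_f.
Qed.

(** Replacing the conjugate of r by s / r turns the second equation into a
    quadratic one with nonzero leading coefficient. *)
Lemma circle_roots (c0 c2 : R[i]) (s q : R) : c0 != 0 -> c2 != 0 ->
  exists L : seq R[i], forall r, nsq r = s -> nsq (c0 + c2 * r) = q -> r \in L.
Proof.
move=> c00 c20.
pose a := c0^*%C * c2.
pose m := c0 * c0^*%C + c2 * c2^*%C * (s%:C)%C - (q%:C)%C.
pose c := c0 * c2^*%C * (s%:C)%C.
pose p : {poly R[i]} := a *: 'X^2 + m *: 'X + c%:P.
have a0 : a != 0 by rewrite mulf_neq0 // -nsq_eq0; case: (c0) c00 => x y; rewrite -nsq_eq0 /nsq /= sqrrN.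
have p0 : p != 0.
  apply/negP => /eqP /(congr1 (fun p : {poly R[i]} => p`_2)).
  by rewrite !coefD !coefZ coefXn coefX coefC coef0 /= mulr1 mulr0 !addr0 => /eqP; rewrite (negbTE a0).
have [L pL] := closed_field_poly_normal p.
exists L => r rs rq.
have : root p r.
  rewrite rootE !hornerE /=; apply/eqP.
  have E : (c0 + c2 * r) * (c0^*%C + c2^*%C * r^*%C) = (q%:C)%C.
    by rewrite -conjcM -conjcD -nsqC rq.
  have E2 : r * r^*%C = (s%:C)%C by rewrite -nsqC rs.
  rewrite /a /m /c -E -E2; ring.
by rewrite pL rootZ ?lead_coef_eq0 // root_prod_XsubC.
Qed.

(** A root r of modulus sqrt s satisfies |c0 + c2 r| = |b| / s^(k/2), which by
    [circle_roots] leaves finitely many r, each of which determines e(-xi). *)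
Lemma ae_no_root_of_modulus (k : nat) (c0 c2 b : R[i]) (s : R) : c0 != 0 -> c2 != 0 -> b != 0 ->
  0 < s -> {ae mu, forall xi, forall r, r ^+ k * (c0 + c2 * r) + b * e1 (- xi) = 0 -> nsq r != s}.
Proof.
move=> c00 c20 b0 s0.
have [L LP] := circle_roots s (nsq b / s ^+ k) c00 c20.
apply: ae_imp (ae_e1N_notin [seq - (r ^+ k * (c0 + c2 * r)) / b | r <- L]) => xi h r hr.
apply/eqP => rs; move/negP: h; apply; apply/mapP; exists r.
  apply: LP => //; have /eqP := hr; rewrite addr_eq0 => /eqP /(congr1 (@nsq R)).
  rewrite nsqN !nsqM nsq_e1 mulr1 => <-.
  have -> : nsq (r ^+ k) = s ^+ k by rewrite nsqE normcX exprAC -nsqE rs.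
  by rewrite mulrAC mulfV ?mul1r // expf_neq0 // gt_eqF.
by have /eqP := hr; rewrite addr_eq0 => /eqP ->; rewrite opprK mulrC mulKf.
Qed.

Lemma trinomial_factor (k : nat) (c0 c2 w : R[i]) : c2 != 0 -> exists rs : seq R[i],
  [/\ size rs = k.+1, forall r, r \in rs -> r ^+ k * (c0 + c2 * r) + w = 0 &
   forall z, z ^+ k * (c0 + c2 * z) + w = c2 * \prod_(r <- rs) (z - r)].
Proof.
move=> c20; pose p : {poly R[i]} := c2 *: 'X^(k.+1) + (c0 *: 'X^k + w%:P).
have sz : (size (c0 *: 'X^k + w%:P)%R < size (c2 *: 'X^(k.+1))%R)%N.
  rewrite size_scale // size_polyXn ltnS (leq_trans (size_polyD _ _)) //.
  rewrite geq_max (leq_trans (size_scale_leq _ _)) ?size_polyXn //=.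
  by rewrite (leq_trans (size_polyC_leq1 _)).
have [rs prs] := closed_field_poly_normal p.
have lc : lead_coef p = c2 by rewrite lead_coefDl // lead_coefZ lead_coefXn mulr1.
have ev z : p.[z] = z ^+ k * (c0 + c2 * z) + w.
  rewrite /p !(hornerD, hornerZ, hornerXn, hornerC) exprS; move: (z ^+ k) => y; ring.
exists rs; rewrite lc in prs; split.
- have := congr1 (size \o polyseq) prs.
  by rewrite /= size_scale // size_prod_XsubC size_polyDl // size_scale // size_polyXn => -[].
- move=> r rrs; rewrite -ev; apply/eqP; rewrite -/(root p r) prs rootZ //.
  by rewrite root_prod_XsubC.
- move=> z; rewrite -ev prs hornerZ horner_prod; congr (_ * _).
  by apply: eq_bigr => r _; rewrite !hornerE.
Qed.

(** The values of xi for which a root has modulus 1 or |c3 / c2| are excluded. If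
    k = 0, a root inside the disc gives winding number 1, and a root r outside
    gives Mahler measure |c2 r|, which is not |c3|. If k = 1, two roots inside
    or two outside give winding number 1 or -1, and in the mixed case the
    Mahler measure is |c2 r| for the root r outside, again not |c3|. *)
Lemma ae_fiber_cocycle (k : nat) (c0 c2 c3 b : R[i]) : (k <= 1)%N ->
  c0 != 0 -> c2 != 0 -> c3 != 0 -> b != 0 ->
  {ae mu, forall xi, exists rs : seq R[i],
   [/\ forall x, - (c0 + c2 * e1 x) - b * e1 (- k%:R * x) * e1 (- xi) = cocycle (- c2) k rs x,
       all (fun r => normc r != 1) rs &
       (mahler (- c2) rs != normc c3) || (winding k rs ^+ 2 == 1)]}.
Proof.
move=> k1 c00 c20 c30 b0.
have s0 : 0 < nsq c3 / nsq c2 by rewrite divr_gt0 // nsq_gt0.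
apply: ae_imp2 (ae_no_root_of_modulus k c00 c20 b0 ltr01)
  (ae_no_root_of_modulus k c00 c20 b0 s0) => xi h1 h2.
have [rs [szr rt E]] := trinomial_factor k c0 (b * e1 (- xi)) c20.
have r1 r : r \in rs -> normc r != 1.
  by move=> /rt /h1; rewrite nsqE sqrf_eq1 negb_or => /andP[].
have rm r : r \in rs -> normc (- c2) * normc r != normc c3.
  move=> /rt /h2; apply: contra => /eqP e; rewrite !nsqE -e normcN exprMn mulrAC mulfV ?mul1r //.
  by rewrite expf_neq0 // normc_eq0.
exists rs; split.
- move=> x; rewrite /cocycle; have := E (e1 x).
  have ek : e1 (- k%:R * x) * e1 x ^+ k = 1.
    by rewrite -e1MnE -e1D -[x *+ k]mulr_natl mulNr addNr e10.
  move=> e; transitivity (- (e1 (- k%:R * x) * (c2 * \prod_(r <- rs) (e1 x - r)))); last by ring.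
  rewrite -e mulrDr mulrA ek; ring.
- by apply/allP.
- clear h1 h2 rt E; case: k k1 szr => [|[|//]] _ szr.
    case: rs szr r1 rm => [//|r [|//]] _ r1 rm.
    rewrite /mahler /winding !big_seq1 subr0.
    have := r1 r; have := rm r; rewrite mem_head => /(_ isT) hm /(_ isT) hr.
    case: (ltrP (normc r) 1) => hr1; first by rewrite expr1n eqxx orbT.
    by rewrite hm.
  case: rs szr r1 rm => [//|r [//|r' [|//]]] _ r1 rm.
  rewrite /mahler /winding !big_cons !big_nil !addr0 mulr1.
  have := r1 r; have := rm r; rewrite mem_head => /(_ isT) hm /(_ isT) hr.
  have := r1 r'; have := rm r'; rewrite in_cons mem_head orbT => /(_ isT) hm' /(_ isT) hr'.
  case: (ltrP (normc r) 1) => hr1; case: (ltrP (normc r') 1) => hr1'.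
  + by apply/orP; right; apply/eqP; rewrite ?mulr1n ?mulr0n; ring.
  + by rewrite mul1r hm'.
  + by rewrite mulr1 hm.
  + by apply/orP; right; apply/eqP; rewrite ?mulr1n ?mulr0n; ring.
Qed.

End exceptional_phases.

(** * Vanishing theorems for shifts of one function *)

Section four_points.
Context (R : realType).
Notation mu := (@lebesgue_measure R).
Notation RR := (measurableTypeR R).

(** With at most one negative power in the coefficient of the unit shift, the
    fiber relation is governed by [ae_fiber_cocycle]. *)
Theorem four_points (h : RR -> R[i]) (k : nat) (alpha : R) (c0 c2 c3 b : R[i]) : square_int h ->
  nonroot (e1 alpha) -> (k <= 1)%N -> c0 != 0 -> c2 != 0 -> c3 != 0 -> b != 0 ->
  {ae mu, forall t, c0 * h t + b * e1 (- k%:R * t) * h (t - 1) + c2 * e1 t * h t + c3 * h (t - alpha) = 0} ->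
  {ae mu, forall t, h t = 0}.
Proof.
move=> [mh fh] nr k1 c00 c20 c30 b0 eq.
have per (x : R) (m : int) : e1 (x + m%:~R) = e1 x by rewrite e1D e1_int mulr1.
apply: (@zak_vanishing _ h c3 (fun x => - (c0 + c2 * e1 x)) (fun x => - (b * e1 (- k%:R * x))) alpha mh fh).
- by move=> x m; rewrite per.
- move=> x m; congr (- (_ * _)).
  by rewrite mulrDr (_ : - k%:R * m%:~R = (- (k%:Z * m))%:~R) ?per // intrN intrM mulNr.
- apply: ae_imp eq => t e.
  by apply/eqP; rewrite -subr_eq0 -e; apply/eqP; ring.
apply: ae_imp (ae_fiber_cocycle k1 c00 c20 c30 b0) => xi [rs [E r1 hyp]] H mH fH quasi coc.
apply: (fiber_vanishing nr mH fH (normc_e1 xi) quasi c30 _ r1 hyp).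
by apply: ae_imp coc => x ->; rewrite -E [X in _ + X]mulNr.
Qed.

(** Translate by x1 and pass from g to h = e(-s t^2) g, where s is chosen so that
    the relative modulation of the first two terms disappears. *)
Lemma three_shifts (g : RR -> R[i]) (a1 a2 a3 : R[i]) (x1 x2 x3 y1 y2 y3 : R) : square_int g ->
  a1 != 0 -> a2 != 0 -> x1 != x2 ->
  {ae mu, forall t, a1 * (e1 (y1 * t) * g (t - x1)) + a2 * (e1 (y2 * t) * g (t - x2)) +
     a3 * (e1 (y3 * t) * g (t - x3)) = 0} ->
  {ae mu, forall t, g t = 0}.
Proof.
move=> Lg a10 a20 x12 eq.
pose beta := x2 - x1; pose x0 := x3 - x1.
have b0 : beta != 0 by rewrite subr_eq0 eq_sym.
pose s := (y2 - y1) / (2 * beta).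
pose h (t : RR) := e1 (- (s * t ^+ 2)) * g t.
have mc : cmeas (fun t : RR => e1 (- (s * t ^+ 2))).
  by apply: cmeas_e1; apply: measurable_funN; apply: measurable_funM => //; exact: measurable_funX.
have Lh : square_int h.
  by apply: (square_int_unimodular mc) => // t; exact: nsq_e1.
have gh (t : R) : g t = e1 (s * t ^+ 2) * h t.
  by rewrite /h mulrA -e1D subrr e10 mul1r.
pose k2 := e1 ((y2 - y1) * x1 + s * beta ^+ 2).
pose k3 := e1 ((y3 - y1) * x1 + s * x0 ^+ 2).
suff hz : {ae mu, forall t, h t = 0} by apply: ae_imp hz => t; rewrite gh => ->; rewrite mulr0.
apply: (three_points Lh a10 (_ : a2 * k2 != 0) b0 (gamma := y3 - y1 - 2 * s * x0) (x0 := x0) (a2 := - (a3 * k3))).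
  by rewrite mulf_neq0 // e1_neq0.
apply: ae_imp (ae_shift x1 eq) => t e; apply/eqP; rewrite -subr_eq0; apply/eqP.
rewrite -[RHS](mulr0 (e1 (- (y1 * (t + x1)) - s * t ^+ 2))) -e.
have -> : t + x1 - x1 = t by ring.
have -> : t + x1 - x2 = t - beta by rewrite /beta; ring.
have -> : t + x1 - x3 = t - x0 by rewrite /x0; ring.
rewrite !gh [RHS]mulrDr [e1 _ * (_ + _)]mulrDr.
have ph (u v w : R) (a z : R[i]) : e1 u * (a * (e1 v * (e1 w * z))) = a * e1 (u + v + w) * z.
  by rewrite !e1D; ring.
rewrite !ph.
have -> : - (y1 * (t + x1)) - s * t ^+ 2 + y1 * (t + x1) + s * t ^+ 2 = 0 by ring.
have -> : - (y1 * (t + x1)) - s * t ^+ 2 + y2 * (t + x1) + s * (t - beta) ^+ 2 =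
   (y2 - y1) * x1 + s * beta ^+ 2.
  by rewrite /s; field.
have -> : - (y1 * (t + x1)) - s * t ^+ 2 + y3 * (t + x1) + s * (t - x0) ^+ 2 =
   (y3 - y1 - 2 * s * x0) * t + ((y3 - y1) * x1 + s * x0 ^+ 2).
  by ring.
rewrite -/k2 (e1D (_ * t)) -/k3 e10; ring.
Qed.

End four_points.

(** * The two irrational rotations and the conclusion *)

Section irrational_rotations.
Context (R : realType).

Lemma nonroot_e1 (alpha : R) : (forall (n : nat) (m : int), (0 < n)%N -> n%:R * alpha != m%:~R) ->
  nonroot (e1 alpha).
Proof.
move=> H n n0; apply/eqP; rewrite -e1MnE -mulr_natl => /e1_eq1 [m hm].
by have := H n m n0; rewrite hm eqxx.
Qed.

(** The exponent of 2 is odd in 2 n^2 and even in m^2. *)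
Lemma nonroot_sqrt2 : nonroot (e1 (Num.sqrt 2 : R)).
Proof.
apply: nonroot_e1 => n m n0; apply/eqP => /(congr1 (fun x : R => x ^+ 2)).
rewrite exprMn sqr_sqrtr // => E.
have {}E : (n ^ 2 * 2 = `|m| ^ 2)%N.
  apply/eqP; rewrite -(eqr_nat R) natrM !natrX E; apply/eqP.
  by rewrite natr_absz intr_norm -normrX ger0_norm // sqr_ge0.
have := congr1 (logn 2) E.
rewrite lognM ?expn_gt0 ?n0 // !lognX (_ : logn 2 2 = 1%N) //; lia.
Qed.

Lemma nonroot_pi : nonroot (e1 (pi : R)).
Proof.
apply: nonroot_e1 => n m n0; apply/eqP => E.
apply: (@pi_irrationnal R); apply/rationalP; exists m, n.
rewrite -E mulrC mulKf // pnatr_eq0; lia.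
Qed.

End irrational_rotations.

Section linear_independence.
Context (R : realType).
Notation mu := (@lebesgue_measure R).
Notation RR := (measurableTypeR R).

Lemma lin_indep4 (f0 f1 f2 f3 : R -> R[i]) : L2C f0 -> L2C f1 -> L2C f2 -> L2C f3 ->
  (forall c0 c1 c2 c3 : R[i],
    {ae mu, forall t, c0 * f0 t + c1 * f1 t + c2 * f2 t + c3 * f3 t = 0} ->
    [/\ c0 = 0, c1 = 0, c2 = 0 & c3 = 0]) ->
  L2C_lin_indep [:: f0; f1; f2; f3].
Proof.
move=> L0 L1 L2 L3 H; split.
  by case=> [[|[|[|[|]]]]].
move=> c /= eq.
pose i n (hn : (n < 4)%N) := Ordinal hn : 'I_4.
have [] := H (c (@i 0%N isT)) (c (@i 1%N isT)) (c (@i 2%N isT)) (c (@i 3%N isT)).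
  apply: ae_imp eq => t; rewrite !big_ord_recl big_ord0 addr0 /= => e.
  rewrite -[RHS]e !addrA; congr (_ * _ + _ * _ + _ * _ + _ * _); congr c; exact: val_inj.
move=> e0 e1 e2 e3 [[|[|[|[|//]]]] hj].
- by rewrite -e0; congr c; exact: val_inj.
- by rewrite -e1; congr c; exact: val_inj.
- by rewrite -e2; congr c; exact: val_inj.
- by rewrite -e3; congr c; exact: val_inj.
Qed.

Variable g : RR -> R[i].
Hypothesis Lg : square_int g.
Hypothesis g0 : ~ {ae mu, forall t, g t = 0}.

Lemma shift_scale_neq0 (c : R[i]) (x : R) : {ae mu, forall t, c * g (t - x) = 0} -> c = 0.
Proof.
move=> eq; have [//|c0] := eqVneq c 0; exfalso; apply: g0.
apply: ae_imp (ae_shift x eq) => t; rewrite addrK => /eqP.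
by rewrite mulf_eq0 (negbTE c0) => /eqP.
Qed.

(** Unless c0 = c2 = 0, the multiplier c0 + c2 e(t) vanishes at most on a coset
    of Z. *)
Lemma modulation_pair (c0 c2 : R[i]) : {ae mu, forall t, c0 * g t + c2 * (e1 t * g t) = 0} ->
  c0 = 0 /\ c2 = 0.
Proof.
move=> eq; have [c20|c20] := eqVneq c2 0.
  split=> //; apply: (@shift_scale_neq0 _ 0); apply: ae_imp eq => t.
  by rewrite c20 mul0r addr0 subr0.
exfalso; apply: g0; apply: ae_imp2 eq (ae_e1_neq (- c0 / c2)) => t.
rewrite mulrA -mulrDl => /eqP; rewrite mulf_eq0 => /orP[|/eqP //].
rewrite addrC addr_eq0 => /eqP e; rewrite -e mulrC mulKf ?eqxx //.
Qed.

(** The remaining terms always contain two with different translation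
    parameters, to which [three_shifts] applies, except when they are both
    untranslated or when there is only one. *)
Lemma degenerate_relation (alpha y : R) (c0 c1 c2 c3 : R[i]) : alpha != 0 -> alpha != 1 ->
  {ae mu, forall t, c0 * g t + c1 * g (t - 1) + c2 * (e1 t * g t) + c3 * (e1 (y * t) * g (t - alpha)) = 0} ->
  ~ [/\ c0 != 0, c1 != 0, c2 != 0 & c3 != 0] ->
  [/\ c0 = 0, c1 = 0, c2 = 0 & c3 = 0].
Proof.
move=> a0 a1 eq nd.
have T3 (b1 b2 b3 : R[i]) (x1 x2 x3 y1 y2 y3 : R) : b1 != 0 -> b2 != 0 -> x1 != x2 ->
    (forall t, c0 * g t + c1 * g (t - 1) + c2 * (e1 t * g t) + c3 * (e1 (y * t) * g (t - alpha)) =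
      b1 * (e1 (y1 * t) * g (t - x1)) + b2 * (e1 (y2 * t) * g (t - x2)) + b3 * (e1 (y3 * t) * g (t - x3))) -> False.
  move=> b10 b20 x12 E; apply: g0; apply: (three_shifts Lg b10 b20 x12 (a3 := b3) (x3 := x3) (y1 := y1) (y2 := y2) (y3 := y3)).
  by apply: ae_imp eq => t <-.
have [c10|c10] := eqVneq c1 0; have [c30|c30] := eqVneq c3 0.
- have [] := @modulation_pair c0 c2.
    by apply: ae_imp eq => t <-; rewrite c10 c30 !mul0r !addr0.
  by move=> -> ->.
- have [c00|c00] := eqVneq c0 0; have [c20|c20] := eqVneq c2 0.
  + have : c3 = 0; last by [].
    apply: (@shift_scale_neq0 _ alpha); apply: ae_imp eq => t.
    rewrite c10 c00 c20 !mul0r !add0r => e.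
    by rewrite -(mulr0 (e1 (- (y * t)))) -e mulrCA [e1 _ * (e1 _ * _)]mulrA -e1D addNr e10 mul1r.
  + exfalso; apply: (T3 c2 c3 0 0 alpha 0 1 y 0) => //; first by rewrite eq_sym.
    by move=> t; rewrite c00 c10 subr0 mul1r; ring.
  + exfalso; apply: (T3 c0 c3 0 0 alpha 0 0 y 0) => //; first by rewrite eq_sym.
    by move=> t; rewrite c20 c10 subr0 !mul0r e10; ring.
  + exfalso; apply: (T3 c0 c3 c2 0 alpha 0 0 y 1) => //; first by rewrite eq_sym.
    by move=> t; rewrite c10 subr0 !mul0r e10 !mul1r; ring.
- have [c00|c00] := eqVneq c0 0; have [c20|c20] := eqVneq c2 0.
  + have : c1 = 0; last by [].
    by apply: (@shift_scale_neq0 _ 1); apply: ae_imp eq => t <-; rewrite c30 c00 c20 !mul0r !addr0 add0r.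
  + exfalso; apply: (T3 c2 c1 0 0 1 0 1 0 0) => //; first by rewrite eq_sym oner_eq0.
    by move=> t; rewrite c00 c30 subr0 mul1r !mul0r e10; ring.
  + exfalso; apply: (T3 c0 c1 0 0 1 0 0 0 0) => //; first by rewrite eq_sym oner_eq0.
    by move=> t; rewrite c20 c30 subr0 !mul0r e10; ring.
  + exfalso; apply: (T3 c0 c1 c2 0 1 0 0 0 1) => //; first by rewrite eq_sym oner_eq0.
    by move=> t; rewrite c30 subr0 !mul0r e10 !mul1r; ring.
- exfalso; have [c00|c00] := eqVneq c0 0.
    apply: (T3 c1 c3 c2 1 alpha 0 0 y 1) => //; first by rewrite eq_sym.
    by move=> t; rewrite c00 subr0 !mul0r e10 !mul1r; ring.
  have c20 : c2 = 0 by apply/eqP/negPn/negP => c20; apply: nd.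
  apply: (T3 c1 c3 c0 1 alpha 0 0 y 0) => //; first by rewrite eq_sym.
  by move=> t; rewrite c20 subr0 !mul0r e10; ring.
Qed.

Lemma translate_relation (alpha : R) (c0 c1 c2 c3 : R[i]) : nonroot (e1 alpha) ->
  {ae mu, forall t, c0 * g t + c1 * g (t - 1) + c2 * (e1 t * g t) + c3 * g (t - alpha) = 0} ->
  ~ [/\ c0 != 0, c1 != 0, c2 != 0 & c3 != 0].
Proof.
move=> nr eq [c00 c10 c20 c30]; apply: g0.
apply: (@four_points _ g 0 alpha c0 c2 c3 c1) => //.
by apply: ae_imp eq => t <-; rewrite mulNr mul0r oppr0 e10; ring.
Qed.

(** For g(t) = e(t^2 / 2) h(t) the modulated shift by alpha becomes a pure shift,
    and the unit shift acquires the phase e(-t). *)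
Lemma chirp_relation (alpha : R) (c0 c1 c2 c3 : R[i]) : nonroot (e1 alpha) ->
  {ae mu, forall t, c0 * g t + c1 * g (t - 1) + c2 * (e1 t * g t) + c3 * (e1 (alpha * t) * g (t - alpha)) = 0} ->
  ~ [/\ c0 != 0, c1 != 0, c2 != 0 & c3 != 0].
Proof.
move=> nr eq [c00 c10 c20 c30]; apply: g0.
pose h (t : RR) := e1 (- (2^-1 * t ^+ 2)) * g t.
have mc : cmeas (fun t : RR => e1 (- (2^-1 * t ^+ 2))).
  by apply: cmeas_e1; apply: measurable_funN; apply: measurable_funM => //; exact: measurable_funX.
have Lh : square_int h.
  by apply: (square_int_unimodular mc) => // t; exact: nsq_e1.
have gh (t : R) : g t = e1 (2^-1 * t ^+ 2) * h t.
  by rewrite /h mulrA -e1D subrr e10 mul1r.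
pose u := e1 (2^-1 : R); pose v := e1 (2^-1 * alpha ^+ 2).
suff hz : {ae mu, forall t, h t = 0} by apply: ae_imp hz => t; rewrite gh => ->; rewrite mulr0.
apply: (@four_points _ h 1 alpha c0 c2 (c3 * v) (c1 * u)) => //.
- by rewrite mulf_neq0 // e1_neq0.
- by rewrite mulf_neq0 // e1_neq0.
apply: ae_imp eq => t e.
rewrite -[RHS](mulr0 (e1 (- (2^-1 * t ^+ 2)))) -e !gh.
have -> : e1 (2^-1 * (t - 1) ^+ 2) = e1 (2^-1 * t ^+ 2) * (u * e1 (- 1%:R * t)).
  by rewrite -!e1D; congr e1; field.
have -> : e1 (2^-1 * (t - alpha) ^+ 2) = e1 (2^-1 * t ^+ 2) * (v * e1 (- (alpha * t))).
  by rewrite -!e1D; congr e1; field.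
have E1 : e1 (- (2^-1 * t ^+ 2)) * e1 (2^-1 * t ^+ 2) = 1 by rewrite -e1D addNr e10.
have E2 : e1 (alpha * t) * e1 (- (alpha * t)) = 1 by rewrite -e1D addrN e10.
set w := e1 (- 1%:R * t).
transitivity (e1 (- (2^-1 * t ^+ 2)) * e1 (2^-1 * t ^+ 2) *
  (c0 * h t + c1 * (u * w * h (t - 1)) + c2 * (e1 t * h t) +
   c3 * (e1 (alpha * t) * e1 (- (alpha * t)) * (v * h (t - alpha))))); last by ring.
rewrite E1 E2; ring.
Qed.

End linear_independence.

Local Close Scope classical_set_scope.

Theorem corollary2p2 (R : realType) (g : R -> R[i])
    (gL2 : L2C g) (g_neq0 : ~ ae_zero g) :
  L2C_lin_indep
    [:: (fun t : R => g t);
        (fun t : R => g (t - 1));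
        (fun t : R => expi (2 * pi * t) * g t);
        (fun t : R => expi (2 * pi * Num.sqrt 2 * t) * g (t - Num.sqrt 2))]
  /\
  L2C_lin_indep
    [:: (fun t : R => g t);
        (fun t : R => g (t - 1));
        (fun t : R => expi (2 * pi * t) * g t);
        (fun t : R => g (t - pi))].
Proof.
have Lg : square_int g by apply/L2C_energy.
have L2 (f : measurableTypeR R -> R[i]) : square_int f -> L2C f by move=> ?; apply/L2C_energy.
have Ls x : square_int (fun t : measurableTypeR R => g (t - x)) by exact: square_int_shift.
have Lm a f : square_int f -> square_int (fun t : measurableTypeR R => expi (2 * pi * a * t) * f t).
  apply: square_int_unimodular => [|t]; last exact: nsq_expi.
  by apply: cmeas_expi; exact: measurable_funM.
have Lm1 : square_int (fun t : measurableTypeR R => expi (2 * pi * t) * g t).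
  by have := Lm 1 _ Lg; under eq_fun do rewrite mulr1.
have nz (a : R) : nonroot (e1 a) -> a != 0 /\ a != 1.
  by move=> nr; have := nr 1%N isT; rewrite expr1 => h; split; apply: contraNneq h => ->;
    rewrite ?e10 ?e11.
split; apply: lin_indep4; try exact: L2; try by apply: L2; exact: Lm.
  move=> c0 c1 c2 c3 eq.
  have {}eq : {ae lebesgue_measure, forall t : R, c0 * g t + c1 * g (t - 1) + c2 * (e1 t * g t) +
      c3 * (e1 (Num.sqrt 2 * t) * g (t - Num.sqrt 2)) = 0}.
    by apply: ae_imp eq => t; rewrite /e1 (mulrA (2 * pi)).
  have [s0 s1] := nz _ (@nonroot_sqrt2 R).
  apply: (degenerate_relation Lg g_neq0 s0 s1 eq).
  exact: (chirp_relation Lg g_neq0 (@nonroot_sqrt2 R) eq).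
move=> c0 c1 c2 c3 eq.
have [s0 s1] := nz _ (@nonroot_pi R).
apply: (degenerate_relation Lg g_neq0 s0 s1 (y := 0)).
  by apply: ae_imp eq => t; rewrite mul0r e10 mul1r.
exact: (translate_relation Lg g_neq0 (@nonroot_pi R) eq).
Qed.
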